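(* Let $B$ be a Brauer tree of type $(e,m)$, $e>1$, with exceptional vertex $v$, and let $B=B_\ell, B_{\ell-1},\dots,B_1,B_0$ be a complete mutation reduction of $B$ (so $B_0$ is the Brauer star), where $B_{k-1}$ is obtained from $B_k$ by the mutation $\mu^+$ centered at an edge $w_k$ of $B_k$, and suppose that for every $k$ the center $w_k$ is a leaf of $B_k$ which is a primary edge of $B_k$. Fix an initial branch of $B$. Let $A_k$ be the Brauer tree algebra of $B_k$, let $G_k: D^b(A_{k-1})\to D^b(A_k)$ be the equivalence given by the mutation centered at $w_k$, and let $F_\ell=G_\ell\circ\cdots\circ G_1: D^b(A_0)\to D^b(A_\ell)$. Identify $A_0$ with the Brauer star algebra $b$ of type $(e,m)$ by means of the natural numbering, i.e. so that the projective $P_i$ of $b$ corresponds to the edge with natural number $i$. Then the star-to-tree tilting complex $F_\ell^{-1}(A_\ell)=\bigoplus_E F_\ell^{-1}(P_E)$ over $b$ (the sum being over the edges $E$ of $B$, with $P_E$ the corresponding indecomposable projective $A_\ell$-module) is the star-to-tree complex of $B$ with the reversed pointing: for every edge $E$ of $B$, $F_\ell^{-1}(P_E)$ is isomorphic in $D^b(b)$ to the component $T_i$ of the star-to-tree complex of the reversed pointing, where $i$ is the number of $E$ in the edge numbering given by the reversed pointing (with the same initial branch).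
   Context: **Brauer trees.** A Brauer tree of type $(e,m)$ is a finite tree with $e$ edges, a cyclic ordering of the edges at each vertex, and a distinguished exceptional vertex $v$ of multiplicity $m$ (if $m=1$, some vertex is chosen as $v$). It is embedded in the plane so that the cyclic orderings are counterclockwise; ''next'' means next counterclockwise. The distance of a vertex is the number of edges on the path to $v$. For a vertex $u\ne v$ the entering edge of $u$ is the first edge on the path from $u$ to $v$. A leaf is an edge with an endpoint lying on no other edge. The Brauer star is the tree all of whose edges are attached to $v$. A branch is the subtree consisting of an edge at $v$ (its root) and all edges connected to $v$ through it. **Brauer tree algebras.** Algebras are over a field $K$ containing a primitive $e$-th root of unity, modules are left modules. The Brauer tree algebra $A$ of $B$ is the basic symmetric algebra (with $A/\mathrm{rad} A$ a product of copies of $K$) whose simple modules $S_E$ are in bijection with the edges $E$ of $B$, such that for the projective cover $P_E$ of $S_E$, $\mathrm{soc}(P_E)\cong S_E$ and $\mathrm{rad}(P_E)/\mathrm{soc}(P_E)$ is the direct sum of two (possibly zero) uniserial modules, one for each endpoint of $E$, whose composition factors from the top down are read by going clockwise around the endpoint, starting with the edge after $E$ and ending with the edge just before returning to $E$, going around once ($m$ times if the endpoint is $v$). **Brauer star algebra.** $b=(K[x]/x^{em+1})[C_e]$ is the skew group algebra with $C_e=\langle g\rangle$, $g^{-1}xg=\xi x$, $\xi$ a primitive $e$-th root of unity; $f_i=\frac1e\sum_{j=0}^{e-1}\xi^{-ij}g^j$ are idempotents (indices mod $e$) with $f_ix=xf_{i+1}$, and $P_i=bf_i$, $i=1,\dots,e$.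 It is the Brauer tree algebra of the star with edges numbered $1,\dots,e$ counterclockwise. For $i\neq j$, $h_{ij}:P_i\to P_j$ is the map $f_i\mapsto x^kf_j$ with $k\equiv j-i \pmod e$, $0<k<e$. **Mutation $\mu^+$ centered at an edge $i$.** Algebraically: for $A$ with projectives $P_j$, let $T^{(i)}_j$ be $P_j$ in degree $0$ for $j\ne i$, and let $T^{(i)}_i$ be $Q_i\xrightarrow{\pi_i} P_i$ with $Q_i$ in degree $0$ and $P_i$ in degree $1$, where $Q_i\to P_i$ is a minimal projective presentation of the largest quotient of $P_i$ all of whose composition factors are isomorphic to $S_i$. Then $T^{(i)}=\bigoplus_j T_j^{(i)}$ is a tilting complex; with $A'=\mathrm{End}_{D^b(A)}(T^{(i)})^{op}$, the equivalence given by the mutation is the triangulated equivalence $D^b(A')\to D^b(A)$ sending the projective $P'_j$ to $T_j^{(i)}$. Combinatorially, $A'$ is the Brauer tree algebra of the tree with the same vertices in which edge $i$ is detached from each of its endpoints and reattached at the farther end of the edge $p$ immediately before $i$ in the cyclic ordering at that endpoint, being inserted there immediately before $p$ in the cyclic ordering; an endpoint lying on no other edge stays attached to $i$. Edges of the old and new trees correspond bijectively. **Primary and coprimary edges.** At a vertex $u\neq v$ lying on at least two edges, the primary edge is the edge next counterclockwise after the entering edge of $u$, and the coprimary edge is the edge immediately before the entering edge in the counterclockwise cyclic ordering. **Mutation reduction.** A mutation reduction is a mutation or sequence of mutations $\mu^+$ such that the distance of each vertex from $v$ never increases and at least one such distance decreases. It is complete if it ends at the Brauer star. After a complete mutation reduction,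 the edges of each branch of $B$ form an interval around the star. The natural numbering of $B$ (for a chosen initial branch of $B$) is obtained by numbering the edges of the star $1,\dots,e$ counterclockwise, beginning with the interval coming from the initial branch, and transporting these numbers to $B$ through the bijections of edges. **Pointings.** A pointing chooses at each non-exceptional vertex $u$ a sector between two cyclically adjacent edges (the unique sector if $u$ lies on one edge), in which a point is placed. A pointing and an initial branch determine an edge numbering: take a Green's walk (a counterclockwise circuit of the planar tree) starting at $v$ along the initial branch, number the non-exceptional vertices $1,\dots,e$ in the order in which their points are met, and give each edge the number of its endpoint farther from $v$. The reversed pointing places the point at each vertex between the coprimary edge and the entering edge. **Star-to-tree complex of a pointing.** With edges numbered by the pointing, it is $\bigoplus_{i=1}^e T_i$, a complex of projective $b$-modules, defined recursively outward from $v$ together with integers $n_i$: if edge $i$ is at $v$, $T_i$ is $P_i$ in degree $n_i=0$. Otherwise let $j$ be the number of the endpoint of $i$ nearer to $v$. If $i<j$, set $n_i=n_j-1$ and let $T_i$ be $P_i\xrightarrow{h_{ij}}P_j$ with $P_i$ in degree $n_i$ and $P_j$ in degree $n_j$; if $i>j$, set $n_i=n_j+1$ and let $T_i$ be $P_j\xrightarrow{h_{ji}}P_i$ with $P_j$ in degree $n_j$ and $P_i$ in degree $n_i$. *)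

(* Defs.v *)
From HB Require Import structures.
From mathcomp Require Import all_boot all_order all_algebra all_field.
From mathcomp Require Import boolp.

Set Implicit Arguments.
Unset Strict Implicit.
Unset Printing Implicit Defensive.

Import Order.TTheory GRing.Theory Num.Theory.
Local Open Scope ring_scope.

(** * Planar trees *)

(* Walks are recorded by the edges they use, so parallel edges would count as
   distinct; [other ends a x] is the endpoint of [a] different from [x]. *)
Section Walks.
Variables (V E : finType) (ends : E -> {set V}).

Definition other (a : E) (x : V) : V := odflt x [pick y in ends a | y != x].

Fixpoint walk (x : V) (s : seq E) (y : V) : bool :=
  if s is a :: s' then (x \in ends a) && walk (other a x) s' y else x == y.

End Walks.

(* [next u a] is the edge following [a] in the counterclockwise cyclic ordering
   at the vertex [u]; it is only meaningful when [u] is an endpoint of [a].  A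
   tree is a connected graph without circuits. *)
Record brauer_tree (V E : finType) (e m : nat) := BrauerTree {
  ends : E -> {set V};
  next : V -> E -> E;
  exc : V;
  card_ends : forall a, #|ends a| = 2%N;
  tree_connected : forall x y, exists s, uniq s && walk ends x s y;
  tree_acyclic : forall x s, uniq s -> walk ends x s x -> s = [::];
  next_ends : forall u a, u \in ends a -> u \in ends (next u a);
  next_cyclic : forall u a b,
    u \in ends a -> u \in ends b -> fconnect (next u) a b;
  num_edges : #|E| = e;
  mult_gt0 : (0 < m)%N
}.

Section Trees.
Variables (V E : finType) (e m : nat).
Implicit Types (B : brauer_tree V E e m) (u : V) (a w : E).

(* The edges of the path from [u] to the exceptional vertex, starting at [u]. *)
Definition vpath B u : seq E := xchoose (tree_connected B u (exc B)).

Definition dist B u : nat := size (vpath B u).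

Definition edges_at B u : {set E} := [set a | u \in ends B a].

Definition lone B u : bool := #|edges_at B u| == 1%N.

Definition prev B u a : E :=
  odflt a [pick c in edges_at B u | next B u c == a].

Definition entering B u : option E := ohead (vpath B u).

Definition far B a : V :=
  odflt (exc B)
    [pick x in ends B a | (dist B (other (ends B) a x) < dist B x)%N].

Definition leaf B a : Prop := exists2 x, x \in ends B a & lone B x.

Definition primary B a : Prop :=
  exists u c, [/\ u != exc B, (1 < #|edges_at B u|)%N,
                  entering B u = Some c & a = next B u c].

Definition is_star B : Prop := forall a, exc B \in ends B a.

(* [vpath B (far B a)] goes from [a] to the root of the branch of [a]. *)
Definition branch B (r : E) : {set E} :=
  [set a | last a (vpath B (far B a)) == r].

(** ** Mutation of trees *)

Definition new_end B w x : V :=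
  if lone B x then x else other (ends B) (prev B x w) x.

Definition mut_ends B w a : {set V} :=
  if a == w then [set new_end B w x | x in ends B w] else ends B a.

(* The cyclic ordering at [y] once [w] has been removed from it ... *)
Definition del_next B w y a : E :=
  if next B y a == w then next B y w else next B y a.

(* ... and once [w] has been inserted immediately before [prev B x w], when
   [y] is the new endpoint of [w] replacing [x]. *)
Definition mut_next B w y a : E :=
  if [pick x in ends B w | ~~ lone B x && (new_end B w x == y)] is Some x then
    let p := prev B x w in
    if a == w then p else if del_next B w y a == p then w else del_next B w y a
  else del_next B w y a.

Definition is_mutation B w (B' : brauer_tree V E e m) : Prop :=
  [/\ exc B' = exc B,
      forall a, ends B' a = mut_ends B w a
    & forall y a, y \in ends B' a -> next B' y a = mut_next B w y a].

(* [B l, ..., B 0], with [B k] obtained from [B k.+1] by mutating at [w k.+1].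
   Only the trees [B k] with [k <= l] matter. *)
Definition mutation_reduction (l : nat) (B : nat -> brauer_tree V E e m)
    (w : nat -> E) : Prop :=
  [/\ forall k, (k < l)%N -> is_mutation (B k.+1) (w k.+1) (B k),
      forall k u, (k < l)%N -> (dist (B k) u <= dist (B k.+1) u)%N
    & exists u, (dist (B 0) u < dist (B l) u)%N].

Definition complete_mutation_reduction (l : nat)
    (B : nat -> brauer_tree V E e m) (w : nat -> E) : Prop :=
  mutation_reduction l B w /\ is_star (B 0).

(** ** Edge numberings *)

(* Numbering of the edges of [B] transported from the star [B0], beginning with
   the interval formed by the branch with root [r].  If [B] has a single branch,
   this interval is the whole circle and has no first element as a cyclic
   interval; it is then read as a linear interval ending at [r], since mutation
   inserts the edges reaching the exceptional vertex before an edge which is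
   already there. *)
Definition natural_numbering B (B0 : brauer_tree V E e m) (r : E)
    (num : E -> nat) : Prop :=
  [/\ injective num /\ (forall a, 1 <= num a <= e)%N,
      forall a, num (next B0 (exc B0) a) = (num a %% e).+1,
      forall a, (a \in branch B r) = (num a <= #|branch B r|)%N
    & branch B r = [set: E] -> num r = e].

(* A pointing is represented by a function [V -> option E]: the value [Some a]
   at [u] means that the point at [u] lies in the sector between [a] and
   [next B u a]; the value at the exceptional vertex is [None].

   The edge just before the entering edge is the coprimary edge if [u] lies on
   two edges or more, and the entering edge itself if [u] lies on one edge; in
   the latter case the sector is the unique one at [u]. *)
Definition reversed_pointing B u : option E :=
  omap (prev B u) (entering B u).

(* Green's walk: the pair [(x, a)] stands for walking along [a] from [x].  On
   reaching the other endpoint [y], the walk crosses the sector between [a] and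
   [next B y a]. *)
Definition green_step B (d : V * E) : V * E :=
  let y := other (ends B) d.2 d.1 in (y, next B y d.2).

Definition met_vertices B (pt : V -> option E) (r : E) : seq V :=
  [seq other (ends B) d.2 d.1 |
     d <- traject (green_step B) (exc B, r) (2 * e)%N
     & pt (other (ends B) d.2 d.1) == Some d.2].

Definition pointing_number B (pt : V -> option E) (r : E) a : nat :=
  (index (far B a) (met_vertices B pt r)).+1.

End Trees.

(** * Modules *)

Section Modules.
Variable A : nzRingType.
Implicit Types M S : lmodType A.

Definition fingen M : Prop :=
  exists s : seq M, forall x, exists c : seq A,
    x = \sum_(i < size s) c`_i *: s`_i.

Definition submodule M (N : M -> Prop) : Prop :=
  N 0 /\ forall a x y, N x -> N y -> N (a *: x + y).

Definition sub M (N N' : M -> Prop) : Prop := forall x, N x -> N' x.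

Definition full M : M -> Prop := fun=> True.
Definition null M : M -> Prop := fun x => x = 0.

Definition iso_mod M M' : Prop := exists f : {linear M -> M'}, bijective f.

Definition simple_mod S : Prop :=
  (exists x : S, x <> 0) /\
  forall N : S -> Prop, submodule N -> sub (@full S) N \/ sub N (@null S).

(* For submodules [N'] of [N]: the quotient [N / N'] is isomorphic to [S], the
   isomorphism being given by a surjection from [N] onto [S] with kernel [N']
   (the values of [f] outside [N] are irrelevant). *)
Definition subquot_iso M (N N' : M -> Prop) S : Prop :=
  exists f : M -> S,
    [/\ forall a x y, N x -> N y -> f (a *: x + y) = a *: f x + f y,
        forall s, exists2 x, N x & f x = s
      & forall x, N x -> f x = 0 <-> N' x].

Definition maximal_in M (N N' : M -> Prop) : Prop :=
  [/\ submodule N', sub N' N, ~ sub N N'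
    & forall N'', submodule N'' -> sub N' N'' -> sub N'' N ->
        sub N'' N' \/ sub N N''].

Definition rad_mod M : M -> Prop :=
  fun x => forall N : M -> Prop, maximal_in (@full M) N -> N x.

(* The sum of the simple submodules. *)
Definition soc_mod M : M -> Prop :=
  fun x => forall N : M -> Prop, submodule N ->
    (forall N' : M -> Prop, submodule N' -> maximal_in N' (@null M) ->
       sub N' N) -> N x.

Definition uniserial M : Prop :=
  forall N N' : M -> Prop, submodule N -> submodule N' -> sub N N' \/ sub N' N.

(* Composition factors from the top down. *)
Definition composition_factors M (s : seq (lmodType A)) : Prop :=
  exists N : nat -> M -> Prop,
    [/\ forall i, submodule (N i),
        forall x, N 0 x,
        sub (N (size s)) (@null M),
        forall i, (i < size s)%N -> sub (N i.+1) (N i)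
      & forall i, (i < size s)%N ->
          subquot_iso (N i) (N i.+1) (nth (M : lmodType A) s i)].

(* All composition factors of [M / N] are isomorphic to [S]. *)
Definition quot_factors_iso M (N : M -> Prop) S : Prop :=
  forall N1 N2 : M -> Prop, submodule N1 -> sub N N2 -> maximal_in N1 N2 ->
    subquot_iso N1 N2 S.

Definition projective_mod (Q : lmodType A) : Prop :=
  forall (M N : lmodType A) (p : {linear M -> N}) (f : {linear Q -> N}),
    (forall y, exists x, p x = y) ->
    exists g : {linear Q -> M}, forall x, p (g x) = f x.

(* [pi : Q -> P] is a minimal projective presentation of the largest quotient
   [P / N] of the projective module [P] all of whose composition factors are
   isomorphic to the simple module [S], the top of [P].  So [P] is the
   projective cover of [P / N], and [Q] is the projective cover of [N]. *)
Definition mutation_presentation (Q P : lmodType A) (pi : {linear Q -> P})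
    (S : lmodType A) : Prop :=
  exists N : P -> Prop,
    [/\ submodule N /\ quot_factors_iso N S,
        forall N' : P -> Prop, submodule N' -> quot_factors_iso N' S -> sub N N',
        projective_mod Q,
        forall y, N y <-> exists x, pi x = y
      & forall x, pi x = 0 -> rad_mod x].

End Modules.

(** ** Finitely generated modules *)

Record fgmod (A : nzRingType) := FgMod {
  fgmod_sort :> lmodType A;
  fgmodP : fingen fgmod_sort
}.

Section FgModules.
Variable A : nzRingType.

Definition lideal_pred (f : A) : {pred A^o} := fun y => `[< exists a, y = a * f >].

Fact lideal_submod f : submod_closed (lideal_pred f).
Proof.
split; first by apply/asboolP; exists 0; rewrite mul0r.
move=> a u v /asboolP[b ->] /asboolP[c ->]; apply/asboolP.
by exists (a * b + c); rewrite mulrDl -mulrA.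
Qed.

HB.instance Definition _ f :=
  GRing.isSubmodClosed.Build A A^o (lideal_pred f) (lideal_submod f).

(* The left ideal [A f]. *)
Definition lideal (f : A) := {y : A^o | lideal_pred f y}.
HB.instance Definition _ f := SubChoice.on (lideal f).
HB.instance Definition _ f := [SubChoice_isSubLmodule of lideal f by <:].

Fact lideal_elemP (f a : A) : lideal_pred f (a * f).
Proof. by apply/asboolP; exists a. Qed.

Definition lideal_elem (f a : A) : lideal f := Sub (a * f) (lideal_elemP f a).

Fact lideal_fingen f : fingen (lideal f).
Proof.
exists [:: lideal_elem f 1] => -[y yP]; have /asboolP[a ya] := yP.
exists [:: a]; rewrite big_ord1 /=; apply/val_inj; rewrite linearZ /= ya.
by rewrite mul1r.
Qed.

Definition fg_lideal f : fgmod A := FgMod (lideal_fingen f).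

(* The homomorphism [A f -> M] given on [f] by [f |-> f *: c]. *)
Definition lideal_hom (f : A) (M : lmodType A) (c : M) (y : lideal f) : M :=
  (val y : A) *: c.

Fact lideal_hom_linear f (M : lmodType A) (c : M) : linear (@lideal_hom f M c).
Proof. by move=> a x y; rewrite /lideal_hom linearP /= scalerDl scalerA. Qed.

HB.instance Definition _ f (M : lmodType A) (c : M) :=
  GRing.isLinear.Build A (lideal f) M _ (@lideal_hom f M c) (lideal_hom_linear c).

Fact zero_fingen : fingen 'rV[A]_0.
Proof. by exists [::] => x; exists [::]; rewrite big_ord0 [x]thinmx0. Qed.

Definition fg_zero : fgmod A := FgMod zero_fingen.

Fact pair_fingen (M N : fgmod A) : fingen (M * N)%type.
Proof.
case: (fgmodP M) (fgmodP N) => s sP [t tP].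
exists ([seq (x, 0) | x <- s] ++ [seq (0, y) | y <- t]) => -[x y].
have [c cx] := sP x; have [d dy] := tP y.
exists (mkseq (nth 0 c) (size s) ++ mkseq (nth 0 d) (size t)).
rewrite size_cat !size_map big_split_ord /=.
under eq_bigr => i _.
  rewrite !nth_cat size_mkseq size_map ltn_ord nth_mkseq // (nth_map 0) //.
  over.
under [X in _ + X]eq_bigr => i _.
  rewrite !nth_cat size_mkseq size_map ltnNge leq_addr /= addKn.
  rewrite nth_mkseq // (nth_map 0) //.
  over.
apply: injective_projections; rewrite raddfD /= !raddf_sum /=.
  by rewrite [X in _ + X]big1 ?addr0 // => i _; rewrite scaler0.
by rewrite [X in X + _]big1 ?add0r // => i _; rewrite scaler0.
Qed.

Definition fg_pair (M N : fgmod A) : fgmod A := FgMod (pair_fingen M N).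

End FgModules.

(** * Bounded complexes *)

Record cplx (A : nzRingType) := Cplx {
  cobj :> int -> fgmod A;
  cdif : forall i, {linear cobj i -> cobj (i + 1)};
  cdif_sq : forall i x, cdif (i + 1) (cdif i x) = 0;
  cbounded : exists N : int, forall i, N < `|i| -> forall x : cobj i, x = 0
}.

Record cmap (A : nzRingType) (X Y : cplx A) := CMap {
  cmap_fun :> forall i, {linear X i -> Y i};
  cmap_comm : forall i x, cmap_fun (i + 1) (cdif X i x) = cdif Y i (cmap_fun i x)
}.

Section Complexes.
Variable A : nzRingType.
Implicit Types X Y Z : cplx A.

Definition ceq X Y (f g : cmap X Y) : Prop := forall i x, f i x = g i x.

Definition cid X : cmap X X :=
  @CMap A X X (fun i => idfun : {linear X i -> X i}) (fun i x => erefl).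

Fact ccomp_comm X Y Z (g : cmap Y Z) (f : cmap X Y) i x :
  (g (i + 1) \o f (i + 1)) (cdif X i x) = cdif Z i ((g i \o f i) x).
Proof. by rewrite /= !cmap_comm. Qed.

Definition ccomp X Y Z (g : cmap Y Z) (f : cmap X Y) : cmap X Z :=
  @CMap A X Z (fun i => g i \o f i : {linear X i -> Z i}) (ccomp_comm g f).

(* Bijectivity on the cohomology in degree [i + 1], for all [i : int]. *)
Definition quasi_iso X Y (s : cmap X Y) : Prop :=
  forall i,
    (forall x : X (i + 1), cdif X (i + 1) x = 0 ->
       (exists y, s (i + 1) x = cdif Y i y) -> exists x', x = cdif X i x') /\
    (forall y : Y (i + 1), cdif Y (i + 1) y = 0 ->
       exists2 x, cdif X (i + 1) x = 0
                & exists y', s (i + 1) x = y + cdif Y i y').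

(** ** Shift and cone *)

Fact shift_sq X i x : (\- cdif X (i + 1 + 1)) ((\- cdif X (i + 1)) x) = 0.
Proof. by rewrite /= linearN cdif_sq !oppr0. Qed.

Fact shift_bounded X :
  exists N : int, forall i, N < `|i| -> forall x : X (i + 1), x = 0.
Proof.
have [N NP] := cbounded X; exists (N + 1) => i Ni; apply: NP.
rewrite -(ltrD2r 1); apply: lt_le_trans Ni _.
by rewrite -{1}(addrK 1 i) (le_trans (ler_normB _ _)) // normr1.
Qed.

(* [(X[1])^i = X^(i+1)], with differential [- d]. *)
Definition shift X : cplx A :=
  @Cplx A (fun i => X (i + 1))
    (fun i => \- cdif X (i + 1) : {linear X (i + 1) -> X (i + 1 + 1)})
    (@shift_sq X) (shift_bounded X).

Fact cshift_comm X Y (f : cmap X Y) i x :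
  f (i + 1 + 1) (cdif (shift X) i x) = cdif (shift Y) i (f (i + 1) x).
Proof. by rewrite /= linearN cmap_comm. Qed.

Definition cshift X Y (f : cmap X Y) : cmap (shift X) (shift Y) :=
  @CMap A (shift X) (shift Y) (fun i => f (i + 1)) (cshift_comm f).

Fact quasi_iso_shift X Y (s : cmap X Y) : quasi_iso s -> quasi_iso (cshift s).
Proof.
move=> qs i; have [s_inj s_surj] := qs (i + 1); split.
  move=> x /= /eqP; rewrite oppr_eq0 => /eqP dx [y sx].
  have [|x' ->] := s_inj x dx; first by exists (- y); rewrite linearN.
  by exists (- x'); rewrite linearN opprK.
move=> y /= /eqP; rewrite oppr_eq0 => /eqP dy.
have [x dx [y' sx]] := s_surj y dy; exists x; first by rewrite dx oppr0.
by exists (- y'); rewrite linearN opprK.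
Qed.

Section Cone.
Variables (X Y : cplx A) (f : cmap X Y).

Definition cone_obj (i : int) : fgmod A := fg_pair (X (i + 1)) (Y i).

Definition cone_dif i (z : cone_obj i) : cone_obj (i + 1) :=
  (- cdif X (i + 1) z.1, f (i + 1) z.1 + cdif Y i z.2).

Fact cone_dif_linear i : linear (@cone_dif i).
Proof.
move=> a [x y] [x' y']; rewrite /cone_dif /=; congr pair => /=.
  by rewrite linearP opprD -scalerN.
by rewrite !linearP scalerDr addrACA.
Qed.

HB.instance Definition _ i :=
  GRing.isLinear.Build A (cone_obj i) (cone_obj (i + 1)) _ (@cone_dif i)
    (@cone_dif_linear i).

Fact cone_sq i x : cone_dif (@cone_dif i x) = 0.
Proof.
rewrite /cone_dif /= linearN cdif_sq !oppr0 linearN linearD cdif_sq addr0.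
by rewrite cmap_comm addNr.
Qed.

Fact cone_bounded :
  exists N : int, forall i, N < `|i| -> forall x : cone_obj i, x = 0.
Proof.
have [N NP] := shift_bounded X; have [N' NP'] := cbounded Y.
exists (Num.max N N') => i; rewrite gt_max => /andP[Ni N'i] [x y].
by rewrite (NP _ Ni x) (NP' _ N'i y).
Qed.

Definition cone : cplx A :=
  @Cplx A cone_obj (fun i => @cone_dif i) cone_sq cone_bounded.

Definition cone_in_fun i (y : Y i) : cone i := (0, y).
Fact cone_in_linear i : linear (@cone_in_fun i).
Proof. by move=> a y y'; apply: injective_projections; rewrite /= ?scaler0 ?addr0. Qed.
HB.instance Definition _ i :=
  GRing.isLinear.Build A (Y i) (cone i) _ (@cone_in_fun i) (@cone_in_linear i).
Fact cone_in_comm i y :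
  cone_in_fun (cdif Y i y) = cdif cone i (cone_in_fun y).
Proof.
by apply: injective_projections; rewrite /= /cone_dif /= linear0 ?oppr0 ?add0r.
Qed.
Definition cone_in : cmap Y cone :=
  @CMap A Y cone (fun i => @cone_in_fun i) cone_in_comm.

Definition cone_out_fun i (z : cone i) : shift X i := z.1.
Fact cone_out_linear i : linear (@cone_out_fun i).
Proof. by []. Qed.
HB.instance Definition _ i :=
  GRing.isLinear.Build A (cone i) (shift X i) _ (@cone_out_fun i)
    (@cone_out_linear i).
Fact cone_out_comm i z :
  cone_out_fun (cdif cone i z) = cdif (shift X) i (cone_out_fun z).
Proof. by []. Qed.
Definition cone_out : cmap cone (shift X) :=
  @CMap A cone (shift X) (fun i => @cone_out_fun i) cone_out_comm.

End Cone.

(** ** Complexes with at most two nonzero terms *)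

Section TwoTerm.
Variables (n : int) (P Q : fgmod A) (h : {linear P -> Q}).

Definition tt_obj (i : int) : fgmod A :=
  match i with Posz 0 => P | Posz 1 => Q | _ => fg_zero A end.

Definition tt_dif (i j : int) : {linear tt_obj i -> tt_obj j} :=
  match i, j with
  | Posz 0, Posz 1 => h
  | i, j => (\0 : {linear tt_obj i -> tt_obj j})
  end.

Fact tt_sq i j k x : tt_dif j k (tt_dif i j x) = 0.
Proof.
by case: i x => [[|[|i]]|i] x; case: j => [[|[|j]]|j];
   case: k => [[|[|k]]|k] //=; rewrite ?linear0.
Qed.

Fact tt_bounded :
  exists N : int, forall i, N < `|i| -> forall x : tt_obj (i - n), x = 0.
Proof.
exists (`|n| + 1) => i ni; have: 1 < `|i - n|.
  by rewrite (lt_le_trans _ (lerB_dist _ _)) // ltrBrDl.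
by case: (i - n) => [[|[|j]]|j] // _ x; apply/matrixP => ? [].
Qed.

(* [P -> Q] with [P] in degree [n] and [Q] in degree [n + 1]. *)
Definition two_term : cplx A :=
  @Cplx A (fun i => tt_obj (i - n)) (fun i => tt_dif (i - n) (i + 1 - n))
    (fun i => @tt_sq (i - n) (i + 1 - n) (i + 1 + 1 - n)) tt_bounded.

End TwoTerm.

(* [P] in degree [n]. *)
Definition stalk (n : int) (P : fgmod A) : cplx A :=
  two_term n (\0 : {linear P -> fg_zero A}).

(** * The bounded derived category *)

(* The localization of the category of bounded complexes of finitely generated
   modules at the quasi-isomorphisms: morphisms are formal composites of chain
   maps and of inverses of quasi-isomorphisms, up to the congruence [deq]. *)
Inductive dmor : cplx A -> cplx A -> Type :=
  | DMap X Y (f : cmap X Y) : dmor X Y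
  | DInv X Y (s : cmap X Y) (qs : quasi_iso s) : dmor Y X
  | DComp X Y Z (g : dmor Y Z) (f : dmor X Y) : dmor X Z.

Definition did X : dmor X X := DMap (cid X).

Inductive deq : forall X Y, dmor X Y -> dmor X Y -> Prop :=
  | deq_refl X Y (f : dmor X Y) : deq f f
  | deq_sym X Y (f g : dmor X Y) : deq f g -> deq g f
  | deq_trans X Y (f g h : dmor X Y) : deq f g -> deq g h -> deq f h
  | deq_comp X Y Z (g g' : dmor Y Z) (f f' : dmor X Y) :
      deq g g' -> deq f f' -> deq (DComp g f) (DComp g' f')
  | deq_assoc X Y Z T (h : dmor Z T) (g : dmor Y Z) (f : dmor X Y) :
      deq (DComp h (DComp g f)) (DComp (DComp h g) f)
  | deq_idl X Y (f : dmor X Y) : deq (DComp (did Y) f) f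
  | deq_idr X Y (f : dmor X Y) : deq (DComp f (did X)) f
  | deq_map X Y (f g : cmap X Y) : ceq f g -> deq (DMap f) (DMap g)
  | deq_map_comp X Y Z (g : cmap Y Z) (f : cmap X Y) :
      deq (DMap (ccomp g f)) (DComp (DMap g) (DMap f))
  | deq_invl X Y (s : cmap X Y) (qs : quasi_iso s) :
      deq (DComp (DInv qs) (DMap s)) (did X)
  | deq_invr X Y (s : cmap X Y) (qs : quasi_iso s) :
      deq (DComp (DMap s) (DInv qs)) (did Y).

Definition is_diso X Y (f : dmor X Y) : Prop :=
  exists g : dmor Y X, deq (DComp g f) (did X) /\ deq (DComp f g) (did Y).

Definition diso X Y : Prop := exists f : dmor X Y, is_diso f.

Fixpoint dshift X Y (f : dmor X Y) : dmor (shift X) (shift Y) :=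
  match f with
  | DMap _ _ f => DMap (cshift f)
  | DInv _ _ _ qs => DInv (quasi_iso_shift qs)
  | DComp _ _ _ g f => DComp (dshift g) (dshift f)
  end.

(* Triangles isomorphic to the triangle of the cone of a chain map. *)
Definition distinguished X Y Z (u : dmor X Y) (v : dmor Y Z)
    (t : dmor Z (shift X)) : Prop :=
  exists X' Y' (f : cmap X' Y')
         (a : dmor X X') (b : dmor Y Y') (c : dmor Z (cone f)),
    [/\ is_diso a /\ is_diso b, is_diso c,
        deq (DComp b u) (DComp (DMap f) a),
        deq (DComp c v) (DComp (DMap (cone_in f)) b)
      & deq (DComp (dshift a) t) (DComp (DMap (cone_out f)) c)].

End Complexes.

Record dfunctor (A A' : nzRingType) := DFunctor {
  fobj :> cplx A -> cplx A';
  fmor : forall X Y, dmor X Y -> dmor (fobj X) (fobj Y);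
  fmor_deq : forall X Y (f g : dmor X Y), deq f g -> deq (fmor f) (fmor g);
  fmor_id : forall X, deq (fmor (did X)) (did (fobj X));
  fmor_comp : forall X Y Z (g : dmor Y Z) (f : dmor X Y),
    deq (fmor (DComp g f)) (DComp (fmor g) (fmor f))
}.

Definition quasi_inverse (A A' : nzRingType)
    (F : dfunctor A A') (H : dfunctor A' A) : Prop :=
  (exists eta : forall X, dmor (H (F X)) X,
     (forall X, is_diso (eta X)) /\
     forall X Y (f : dmor X Y),
       deq (DComp (eta Y) (fmor H (fmor F f))) (DComp f (eta X))) /\
  (exists eps : forall X, dmor (F (H X)) X,
     (forall X, is_diso (eps X)) /\
     forall X Y (f : dmor X Y),
       deq (DComp (eps Y) (fmor F (fmor H f))) (DComp f (eps X))).

(* Additivity is not listed, as it follows from the preservation of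
   distinguished triangles. *)
Definition triangulated (A A' : nzRingType) (F : dfunctor A A') : Prop :=
  exists sh : forall X, dmor (F (shift X)) (shift (F X)),
    [/\ forall X, is_diso (sh X),
        forall X Y (f : dmor X Y),
          deq (DComp (sh Y) (fmor F (dshift f)))
              (DComp (dshift (fmor F f)) (sh X))
      & forall X Y Z (u : dmor X Y) (v : dmor Y Z) (t : dmor Z (shift X)),
          distinguished u v t ->
          distinguished (fmor F u) (fmor F v) (DComp (sh X) (fmor F t))].

Section Scalars.
Variables (K : fieldType) (A : falgType K).

Definition scal_fun (c : K) (M : lmodType A) (x : M) : M := (c%:A : A) *: x.

Fact scal_linear c (M : lmodType A) : linear (@scal_fun c M).
Proof.
by move=> a x y; rewrite /scal_fun scalerDr !scalerA mulr_algl mulr_algr.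
Qed.

HB.instance Definition _ c (M : lmodType A) :=
  GRing.isLinear.Build A M M _ (@scal_fun c M) (@scal_linear c M).

Fact scal_comm c (X : cplx A) i x :
  scal_fun c (cdif X i x) = cdif X i (scal_fun c x).
Proof. by rewrite /scal_fun linearZ. Qed.

Definition scal_map (c : K) (X : cplx A) : cmap X X :=
  @CMap A X X (fun i => @scal_fun c (X i) : {linear X i -> X i}) (@scal_comm c X).

End Scalars.

(* For an additive functor, compatibility with the scalar endomorphisms
   amounts to [K]-linearity on morphisms. *)
Definition K_linear (K : fieldType) (A A' : falgType K) (F : dfunctor A A') :=
  forall (c : K) (X : cplx A),
    deq (fmor F (DMap (scal_map c X))) (DMap (scal_map c (F X))).

Definition triangulated_equivalence (K : fieldType) (A A' : falgType K)
    (F : dfunctor A A') (H : dfunctor A' A) : Prop :=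
  [/\ triangulated F, K_linear F & quasi_inverse F H].

(** * Brauer tree algebras *)

Definition symmetric_algebra (K : fieldType) (A : falgType K) : Prop :=
  exists phi : {scalar A},
    (forall x y, phi (x * y) = phi (y * x)) /\
    (forall x, (forall y, phi (x * y) = 0) -> x = 0).

(* The quotient of [A] by its radical is a product of copies of [K]; in
   particular [A] is basic. *)
Definition split_basic (K : fieldType) (A : falgType K) : Prop :=
  exists (n : nat) (chi : 'I_n -> {lrmorphism A -> K^o}),
    (forall c : 'I_n -> K, exists x, forall i, chi i x = c i) /\
    (forall x : A, rad_mod (x : A^o) <-> forall i, chi i x = 0).

Section BrauerTreeAlgebras.
Variables (K : fieldType) (V E : finType) (e m : nat).

(* The edges met by going clockwise around the endpoint [u] of [a], once or, at
   the exceptional vertex, [m] times; [a] itself is left out at the beginning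
   and at the end. *)
Definition clockwise (B : brauer_tree V E e m) (u : V) (a : E) : seq E :=
  [seq iter t (prev B u) a |
     t <- iota 1 ((if u == exc B then m else 1) * #|edges_at B u|).-1%N].

(* The projective cover of the simple module [bt_simple a] is the left ideal
   generated by the idempotent [bt_idem a]. *)
Record brauer_tree_algebra (A : falgType K) (B : brauer_tree V E e m) :=
  BrauerTreeAlgebra {
  bt_simple : E -> lmodType A;
  bt_idem : E -> A;
  bt_symmetric : symmetric_algebra A;
  bt_split : split_basic A;
  bt_simpleP : forall a, simple_mod (bt_simple a);
  bt_simple_inj : forall a b, iso_mod (bt_simple a) (bt_simple b) -> a = b;
  bt_simple_surj : forall S : lmodType A, simple_mod S ->
    exists a, iso_mod (bt_simple a) S;
  bt_idem_mul : forall a b,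
    bt_idem a * bt_idem b = if a == b then bt_idem a else 0;
  bt_idem_sum : \sum_a bt_idem a = 1;
  bt_top : forall a,
    subquot_iso (@full _ (lideal (bt_idem a))) (@rad_mod _ (lideal (bt_idem a)))
      (bt_simple a);
  bt_soc : forall a,
    subquot_iso (@soc_mod _ (lideal (bt_idem a))) (@null _ (lideal (bt_idem a)))
      (bt_simple a);
  bt_heart : forall a, exists (u u' : V) (U U' : lmodType A),
    [/\ ends B a = [set u; u'],
        subquot_iso (@rad_mod _ (lideal (bt_idem a)))
          (@soc_mod _ (lideal (bt_idem a))) (U * U')%type,
        uniserial U /\ uniserial U',
        composition_factors U (map bt_simple (clockwise B u a))
      & composition_factors U' (map bt_simple (clockwise B u' a))]
}.

Definition bt_proj (A : falgType K) (B : brauer_tree V E e m)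
    (D : brauer_tree_algebra A B) (a : E) : fgmod A :=
  fg_lideal (bt_idem D a).

(* [T] is the component indexed by [j] of the tilting complex of the mutation
   centered at [w]. *)
Definition mutation_component (A : falgType K) (B : brauer_tree V E e m)
    (D : brauer_tree_algebra A B) (w j : E) (T : cplx A) : Prop :=
  if j == w then
    exists (Q : fgmod A) (pi : {linear Q -> bt_proj D w}),
      mutation_presentation pi (bt_simple D w) /\ T = two_term 0 pi
  else T = stalk 0 (bt_proj D j).

(* [F] is an equivalence given by the mutation of [A] centered at [w], with
   quasi-inverse [H].  It identifies [A'] with the opposite of the endomorphism
   algebra of the tilting complex, compatibly with the labelling by edges. *)
Definition mutation_equivalence (A A' : falgType K) (B B' : brauer_tree V E e m)
    (D : brauer_tree_algebra A B) (D' : brauer_tree_algebra A' B') (w : E)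
    (F : dfunctor A' A) (H : dfunctor A A') : Prop :=
  triangulated_equivalence F H /\
  forall j, exists2 T, mutation_component D w j T
                     & diso (F (stalk 0 (bt_proj D' j))) T.

End BrauerTreeAlgebras.

(** * The Brauer star algebra *)

Section Star.
Variables (K : fieldType) (e m : nat) (xi : K).

(* [b] is the skew group algebra of the cyclic group [<g>] of order [e] over
   [K[x]/x^(em+1)]: a free left [K[x]/x^(em+1)]-module on the powers of [g]. *)
Definition star_algebra (b : falgType K) (x g : b) : Prop :=
  [/\ x ^+ (e * m).+1%N = 0, g ^+ e = 1, g^-1 * x * g = xi *: x
    & bijective (fun c : 'M[K]_((e * m).+1%N, e) =>
        \sum_i \sum_j c i j *: (x ^+ i * g ^+ j))].

Variables (b : falgType K) (x g : b).

Definition star_idem (i : nat) : b :=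
  e%:R^-1 *: \sum_(j < e) xi ^- (i * j)%N *: g ^+ j.

Definition star_proj (i : nat) : fgmod b := fg_lideal (star_idem i).

(* The exponent [k] with [k = j - i] modulo [e] and [0 < k < e], for distinct
   [i] and [j] between [1] and [e]. *)
Definition star_exp (i j : nat) : nat := ((j + (e - i)) %% e)%N.

Definition star_hom (i j : nat) : {linear star_proj i -> star_proj j} :=
  lideal_hom (lideal_elem (star_idem j) (x ^+ star_exp i j)).

(* The degree [n_i] of the edge [i] of number [num a], [s] being the path to
   the exceptional vertex which starts with [a]. *)
Fixpoint tree_degree (E : Type) (num : E -> nat) (s : seq E) : int :=
  match s with
  | a :: (c :: _) as s' =>
      if (num a < num c)%N then tree_degree num s' - 1
      else tree_degree num s' + 1
  | _ => 0
  end.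

(* The component of the edge [a] in the star-to-tree complex of a pointing,
   whose edge numbering is [num].  The second edge [c] of the path from [a] is
   the one whose farther endpoint is the endpoint of [a] nearer to the
   exceptional vertex, so that [num c] is the number of this endpoint. *)
Definition tree_component (V E : finType) (B : brauer_tree V E e m)
    (num : E -> nat) (a : E) : cplx b :=
  match vpath B (far B a) with
  | [:: _, c & s] =>
      if (num a < num c)%N then
        two_term (tree_degree num [:: a, c & s]) (star_hom (num a) (num c))
      else
        two_term (tree_degree num [:: c & s]) (star_hom (num c) (num a))
  | _ => stalk 0 (star_proj (num a))
  end.

End Star.

(* The value at an object of the composite [H_1 o ... o H_l]. *)
Fixpoint composite_inverse (A : nat -> nzRingType)
    (H : forall k, dfunctor (A k.+1) (A k)) (l : nat) : cplx (A l) -> cplx (A 0) :=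
  match l with
  | 0 => fun X => X
  | l'.+1 => fun X => composite_inverse H (H l' X)
  end.

(* Main.v *)
(* Both complexes are compared one mutation at a time.  Let [w] be the centre, [c]
   the edge entering the inner end of [w], and let [T'] be the star-to-tree
   components before [w] is moved away from the exceptional vertex.  All
   components but [T'_w] persist.  The equivalence sends [T'_w] to [Q -> P_w] and
   [T'_c] to [P_c], where [Q] is isomorphic to [P_c] because [w] is a leaf, so
   that [P_w] is the cone of a map [p] through which every map from the first
   complex to the second factors.  Hence the canonical map from [T'_w] to [T'_c]
   corresponds to [p] up to an endomorphism of [T'_c], which is invertible for
   degree reasons; its cone [P_w -> P_c] is the new component [T_w].

   On the combinatorial side, these mutations preserve the cyclic postorder of
   the edges, which is the order of the points of the reversed pointing. *)

(* The equivalences are known on objects, up to isomorphism; nothing is given about the images of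
   morphisms. So the two cones cannot be matched by naming the image of a map: fullness and
   faithfulness transport a factorization, and preservation of cones concludes. This is what
   [exact_embedding] records.

   Equality in the derived category is generated by relations, hence information must be drawn from
   it through invariants: homotopy classes of maps out of a complex of projectives turn [deq] back
   into homotopy, and cohomology turns isomorphisms back into quasi-isomorphisms.

   The degree reason is the filtration of [b] by powers of [x]. For [i < j] every map from [P_i] to
   [P_j] is divisible by x^(j-i), and [star_hom i j] is not divisible by x^(j-i+1); an endomorphism
   through which it factors up to homotopy must therefore have a nonzero constant coefficient, and
   such endomorphisms are invertible. This needs numbers that increase along paths towards the
   exceptional vertex, which postorder provides; consequently only the case [i < j] of the recursive
   definition of the components ever occurs. *)
From HB Require Import structures.
From mathcomp Require Import all_boot all_order all_algebra all_field.
From mathcomp Require Import boolp zify.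
Require Import Defs.

Set Implicit Arguments.
Unset Strict Implicit.
Unset Printing Implicit Defensive.

Import Order.TTheory GRing.Theory Num.Theory.
Local Open Scope ring_scope.

(* Identities in abelian groups are decided by comparing, atom by atom, the
   integer coefficients of both sides. *)
Module ZmodTactic.

Inductive expr := Zero | Atom of nat | Add of expr & expr | Opp of expr.

Fixpoint eval (V : zmodType) (env : seq V) (t : expr) : V :=
  match t with
  | Zero => 0
  | Atom i => nth 0 env i
  | Add s t => eval env s + eval env t
  | Opp s => - eval env s
  end.

Fixpoint coef (i : nat) (t : expr) : int :=
  match t with
  | Zero => 0
  | Atom j => (i == j)%:Z
  | Add s t => coef i s + coef i t
  | Opp s => - coef i s
  end.

Lemma eval_coef (V : zmodType) (env : seq V) t :
  eval env t = \sum_(i < size env) env`_i *~ coef i t.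
Proof.
elim: t => /= [|j|s -> t ->|s ->].
- by rewrite big1.
- have [ltj|gej] := ltnP j (size env).
    rewrite (bigD1 (Ordinal ltj)) //= eqxx big1 ?addr0 // => i /negPf.
    by rewrite -val_eqE /= => ->.
  rewrite nth_default // big1 // => i _.
  by case: eqP => // ij; move: (ltn_ord i); rewrite ij ltnNge gej.
- by rewrite -big_split; apply: eq_bigr => i _; rewrite /= mulrzDr.
by rewrite -sumrN; apply: eq_bigr => i _; rewrite /= mulrNz.
Qed.

Lemma decide (V : zmodType) (env : seq V) s t :
  all (fun i => coef i s == coef i t) (iota 0 (size env)) ->
  eval env s = eval env t.
Proof.
move=> /allP st; rewrite !eval_coef; apply: eq_bigr => i _.
by rewrite (eqP (st i _)) // mem_iota ltn_ord.
Qed.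

Ltac find_atom x env :=
  match env with
  | ?y :: _ => let u := match goal with _ => unify x y end in constr:(0%N)
  | _ :: ?env' => let n := find_atom x env' in constr:(n.+1)
  end.

Ltac add_atom x env :=
  match env with
  | [::] => constr:([:: x])
  | ?y :: _ => let u := match goal with _ => unify x y end in env
  | ?y :: ?env' => let env'' := add_atom x env' in constr:(y :: env'')
  end.

Ltac atoms t env :=
  match t with
  | 0 => env
  | ?a + ?b => let env' := atoms a env in atoms b env'
  | - ?a => atoms a env
  | _ => add_atom t env
  end.

Ltac reify t env :=
  match t with
  | 0 => constr:(Zero)
  | ?a + ?b =>
      let s := reify a env in let s' := reify b env in constr:(Add s s')
  | - ?a => let s := reify a env in constr:(Opp s)
  | _ => let n := find_atom t env in constr:(Atom n)
  end.

End ZmodTactic.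

Ltac zmod :=
  match goal with
  | |- @eq ?T ?a ?b =>
      let env0 := ZmodTactic.atoms a (@nil T) in
      let env := ZmodTactic.atoms b env0 in
      let s := ZmodTactic.reify a env in
      let t := ZmodTactic.reify b env in
      let H := fresh in pose proof (@ZmodTactic.decide _ env s t (erefl true)) as H; cbn [ZmodTactic.eval nth] in H; exact H
  end.

Lemma addNr_eq0 (V : zmodType) (a b : V) : - a + b = 0 -> b = a.
Proof. by move=> ab; rewrite -[b](addKr (- a)) ab opprK addr0. Qed.

(** * Homotopies of chain maps out of complexes of projectives *)

Section SubmoduleType.
Variables (A : nzRingType) (M : lmodType A) (N : M -> Prop) (sN : submodule N).

(** The proof of [submodule N] is an argument so that the closure instance, hence the module
    structure on the subtype, is found from the term alone. *)
Definition submod_pred of submodule N : {pred M} := fun x => `[< N x >].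

Fact submod_pred_closed : submod_closed (submod_pred sN).
Proof.
have [N0 Nl] := sN; split; first exact/asboolP.
by move=> a u v /asboolP Nu /asboolP Nv; apply/asboolP/Nl.
Qed.

HB.instance Definition _ :=
  GRing.isSubmodClosed.Build A M (submod_pred sN) submod_pred_closed.

Definition submod := {x : M | submod_pred sN x}.
HB.instance Definition _ := SubChoice.on submod.
HB.instance Definition _ := [SubChoice_isSubLmodule of submod by <:].

Lemma submodP (x : submod) : N (val x).
Proof. exact: asboolW (valP x). Qed.

Definition to_submod x (Nx : N x) : submod := Sub x (asboolT Nx).

End SubmoduleType.

(** Both maps are corestricted to the image of [d], where [d] becomes surjective as the definition
    of [projective_mod] demands. *)
Lemma projective_lift (A : nzRingType) (Q C C' : lmodType A)
    (d : {linear C -> C'}) (f : {linear Q -> C'}) :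
  projective_mod Q -> (forall q, exists c, d c = f q) ->
  exists g : {linear Q -> C}, forall q, d (g q) = f q.
Proof.
move=> Qproj dsurj; pose N y := exists c, d c = y.
have sN : submodule N.
  split; first by exists 0; rewrite linear0.
  by move=> a _ _ [x <-] [y <-]; exists (a *: x + y); rewrite linearP.
pose d1 c : submod sN := to_submod sN (ex_intro (fun c => d c = _) c (erefl (d c))).
pose f1 q : submod sN := to_submod sN (dsurj q).
have d1l : linear d1 by move=> a x y; apply: val_inj; rewrite /= !linearP.
have f1l : linear f1 by move=> a x y; apply: val_inj; rewrite /= !linearP.
pose d2 := HB.pack d1 (GRing.isLinear.Build A C (submod sN) _ d1 d1l)
  : {linear C -> submod sN}.
pose f2 := HB.pack f1 (GRing.isLinear.Build A Q (submod sN) _ f1 f1l)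
  : {linear Q -> submod sN}.
have [|g gP] := Qproj _ _ d2 f2.
  by move=> y; have [c dc] := submodP y; exists c; apply: val_inj.
by exists g => q; have := congr1 val (gP q).
Qed.

Section Reindex.
Variable T : int -> Type.

(** Homotopies live in degrees [i + 1], whereas a chain map needs a component in every degree; the
    cast goes along [j - 1 + 1 = j]. *)
Definition reindex (f : forall i, T (i + 1)) j : T j :=
  ecast k (T k) (subrK 1 j) (f (j - 1)).

Lemma reindexE f i : reindex f (i + 1) = f i.
Proof.
rewrite /reindex; move: (subrK 1 (i + 1)) (addrK 1 i).
by move: (i + 1 - 1) => j ej ji; move: ej; rewrite {j}ji => ej; rewrite eq_axiomK.
Qed.

End Reindex.

Section Homotopy.
Variable A : nzRingType.
Implicit Types X Y Z M C : cplx A.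

(** Stated in degrees [i + 1], which are all integers, so that the incoming differential [cdif Y i]
    typechecks without transport. *)
Definition homotopic X Y (f g : cmap X Y) : Prop :=
  exists s : forall i, {linear X (i + 1) -> Y i}, forall i x,
    f (i + 1) x - g (i + 1) x = cdif Y i (s i x) + s (i + 1) (cdif X (i + 1) x).

Definition termwise_projective X : Prop := forall i, projective_mod (X i).

Definition acyclic X : Prop :=
  forall i (x : X (i + 1)), cdif X (i + 1) x = 0 -> exists y, x = cdif X i y.

Lemma homotopic_refl X Y (f : cmap X Y) : homotopic f f.
Proof.
by exists (fun i => \0 : {linear X (i + 1) -> Y i}) => i x; rewrite subrr linear0 addr0.
Qed.

Lemma ceq_homotopic X Y (f g : cmap X Y) : ceq f g -> homotopic f g.
Proof.
move=> fg; exists (fun i => \0 : {linear X (i + 1) -> Y i}) => i x.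
by rewrite fg subrr linear0 addr0.
Qed.

Lemma homotopic_sym X Y (f g : cmap X Y) : homotopic f g -> homotopic g f.
Proof.
move=> [s sP]; exists (fun i => \- s i : {linear X (i + 1) -> Y i}) => i x /=.
by rewrite -opprB sP linearN opprD.
Qed.

Lemma homotopic_trans X Y (f g h : cmap X Y) :
  homotopic f g -> homotopic g h -> homotopic f h.
Proof.
move=> [s sP] [t tP].
exists (fun i => s i \+ t i : {linear X (i + 1) -> Y i}) => i x /=.
rewrite linearD addrACA -sP -tP; zmod.
Qed.

Lemma homotopic_comp X Y Z (g g' : cmap Y Z) (f f' : cmap X Y) :
  homotopic g g' -> homotopic f f' -> homotopic (ccomp g f) (ccomp g' f').
Proof.
move=> [t tP] [s sP].
exists (fun i => (g i \o s i) \+ (t i \o f' (i + 1)) : {linear X (i + 1) -> Z i}) => i x /=.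
rewrite (linearD (cdif Z i)) -cmap_comm.
have := congr1 (g (i + 1)) (sP i x); rewrite linearB (linearD (g (i + 1))) => e1.
rewrite -[LHS](subrKA (g (i + 1) (f' (i + 1) x))) e1 (tP i) (cmap_comm f'); zmod.
Qed.

(** The homotopy is built downwards from the degrees where [M] vanishes. Once it is known above,
    [f - s d] takes values in cocycles, hence in boundaries of the acyclic [C], and projectivity
    lifts it through the differential. *)
Lemma null_homotopic M C (f : cmap M C) :
  termwise_projective M -> acyclic C ->
  exists s : forall i, {linear M (i + 1) -> C i}, forall i x,
    f (i + 1) x = cdif C i (s i x) + s (i + 1) (cdif M (i + 1) x).
Proof.
move=> Mproj Cac; have [N NP] := cbounded M.
pose P (s : forall i, {linear M (i + 1) -> C i}) i := forall x,
  f (i + 1) x = cdif C i (s i x) + s (i + 1) (cdif M (i + 1) x).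
have step k : exists s, forall i, `|N| - k%:Z <= i -> P s i.
  elim: k => [|k [s sP]].
    exists (fun i => \0 : {linear M (i + 1) -> C i}) => i iN x.
    by rewrite [x]NP ?linear0 ?addr0 //; lia.
  pose j := `|N| - k.+1%:Z.
  (* Only degree [j] matters; quantifying over all [i] and choosing afterwards avoids a transport
     along [i = j]. *)
  have ex i : exists g : {linear M (i + 1) -> C i}, i = j ->
      forall x, cdif C i (g x) = f (i + 1) x - s (i + 1) (cdif M (i + 1) x).
    have [ij|nij] := pselect (i = j); last by exists \0.
    pose h := f (i + 1) \- (s (i + 1) \o cdif M (i + 1))
      : {linear M (i + 1) -> C (i + 1)}.
    have [q|g gP] := @projective_lift _ _ _ _ (cdif C i) h (Mproj _); last first.
      by exists g.
    have [|y hy] := Cac i (h q); last by exists y.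
    rewrite /= linearB -cmap_comm.
    have := sP (i + 1) _ (cdif M (i + 1) q).
    rewrite cdif_sq linear0 addr0 => -> //; first exact: subrr.
    by rewrite ij /j; lia.
  pose g i := projT1 (boolp.cid (ex i)).
  exists (fun i => if i == j then g i else s i) => i; rewrite /P => ij x.
  have -> : (i + 1 == j) = false by apply/eqP; rewrite /j; lia.
  have [eij|nij] := eqVneq i j; last by apply: sP; lia.
  by rewrite /g; case: (boolp.cid _) => g0 /= -> //; rewrite subrK.
(* After 2|N|+2 descents the bound is -|N|-2, and below it [M] is zero again. *)
have [s sP] := step (`|N|.*2.+2)%N; exists s => i x.
have [/sP-> //|lt_i] := lerP (`|N| - (`|N|.*2.+2)%N%:Z) i.
by rewrite [x]NP ?linear0 ?addr0 //; lia.
Qed.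

Lemma acyclic_cone X Y (s : cmap X Y) : quasi_iso s -> acyclic (cone s).
Proof.
move=> qs i [x y] [/eqP]; rewrite oppr_eq0 => /eqP dx sxy.
have [s_inj _] := qs (i + 1); have [_ s_surj] := qs i.
have [|x' xE] := s_inj x dx.
  exists (- y); rewrite linearN; apply/eqP; rewrite -addr_eq0; exact/eqP.
have [|x2 dx2 [y' sx2]] := s_surj (y + s (i + 1) x').
  by rewrite linearD -cmap_comm -xE [LHS]addrC.
exists (x2 - x', - y'); apply: injective_projections; rewrite /= /cone_dif /=.
  by rewrite linearB dx2 sub0r opprK.
rewrite linearB sx2 linearN; zmod.
Qed.

(** The composite of [u] with the inclusion into the acyclic cone of [s] is null homotopic. The
    first component of the homotopy is a chain map to [X], and the second is a homotopy from its
    image under [s] to [u]. *)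
Lemma quasi_iso_lift X Y M (s : cmap X Y) (u : cmap M Y) :
  quasi_iso s -> termwise_projective M ->
  exists v : cmap M X, homotopic (ccomp s v) u.
Proof.
move=> qs Mproj.
have [k kP] := null_homotopic (ccomp (cone_in s) u) Mproj (acyclic_cone qs).
pose a i := fst \o k i : {linear M (i + 1) -> X (i + 1)}.
pose b i := snd \o k i : {linear M (i + 1) -> Y i}.
have aP i x : a (i + 1) (cdif M (i + 1) x) = cdif X (i + 1) (a i x).
  by have /esym/addNr_eq0 := congr1 fst (kP i x).
have bP i x : u (i + 1) x =
    s (i + 1) (a i x) + cdif Y i (b i x) + b (i + 1) (cdif M (i + 1) x).
  by have := congr1 snd (kP i x).
pose v := @reindex (fun j => {linear M j -> X j}) a.
have vP j x : v (j + 1) (cdif M j x) = cdif X j (v j x).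
  by move: x; rewrite -(subrK 1 j) => x; rewrite /v !reindexE aP.
exists (CMap vP); exists (fun i => \- b i : {linear M (i + 1) -> Y i}) => i x.
by rewrite /= /v reindexE linearN bP; zmod.
Qed.

(** A homotopy [h] between the composites makes [(u - v, - h)] a chain map from the shift of [M] to
    the acyclic cone of [s]; the first component of its contraction is, up to sign, the homotopy
    sought. *)
Lemma quasi_iso_homotopic X Y M (s : cmap X Y) (u v : cmap M X) :
  quasi_iso s -> termwise_projective M ->
  homotopic (ccomp s u) (ccomp s v) -> homotopic u v.
Proof.
move=> qs Mproj [h hP].
pose F1 i (m : shift M i) : cone s i := (u (i + 1) m - v (i + 1) m, - h i m).
have F1l i : linear (@F1 i).
  move=> a x y; apply: injective_projections; rewrite /= !linearP.
    by rewrite /= scalerBr scalerN; zmod.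
  by [].
pose F i := HB.pack (@F1 i)
  (GRing.isLinear.Build A (shift M i) (cone s i) _ (@F1 i) (@F1l i))
  : {linear shift M i -> cone s i}.
have FP i x : F (i + 1) (cdif (shift M) i x) = cdif (cone s) i (F i x).
  apply: injective_projections; rewrite /= /cone_dif /=.
    by rewrite !linearN linearB !cmap_comm /=; zmod.
  by rewrite !linearN (linearB (s _)) (hP i) /=; zmod.
have [K KP] := null_homotopic (CMap FP) (fun i => Mproj (i + 1)) (acyclic_cone qs).
pose t1 i := \- (fst \o K i) : {linear M (i + 1 + 1) -> X (i + 1)}.
pose t := @reindex (fun j => {linear M (j + 1) -> X j}) t1.
exists t => j; rewrite -(subrK 1 j) => x; rewrite /t !reindexE /t1 /=.
have := congr1 fst (KP (j - 1) x); rewrite /= /cone_dif /= => ->.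
by rewrite !linearN.
Qed.

End Homotopy.

(** * Morphisms of the derived category *)

(* A functor on complexes which inverts quasi-isomorphisms, with values in sets
   with an equivalence relation.  It extends to the derived category, whose
   morphisms act on it as relations. *)
Record localizing (A : nzRingType) := Localizing {
  lobj :> cplx A -> Type;
  lrel : forall X, lobj X -> lobj X -> Prop;
  lact : forall X Y, cmap X Y -> lobj X -> lobj Y;
  lrel_refl : forall X (u : lobj X), lrel u u;
  lrel_sym : forall X (u v : lobj X), lrel u v -> lrel v u;
  lrel_trans : forall X (u v t : lobj X), lrel u v -> lrel v t -> lrel u t;
  lact_rel : forall X Y (f : cmap X Y) u v, lrel u v -> lrel (lact f u) (lact f v);
  lact_ceq : forall X Y (f g : cmap X Y) u, ceq f g -> lrel (lact f u) (lact g u);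
  lact_id : forall X (u : lobj X), lrel (lact (Defs.cid X) u) u;
  lact_comp : forall X Y Z (g : cmap Y Z) (f : cmap X Y) u,
    lrel (lact (ccomp g f) u) (lact g (lact f u));
  lact_inj : forall X Y (s : cmap X Y) u v,
    quasi_iso s -> lrel (lact s u) (lact s v) -> lrel u v;
  lact_surj : forall X Y (s : cmap X Y) v,
    quasi_iso s -> exists u, lrel (lact s u) v
}.

Section Localizing.
Variables (A : nzRingType) (T : localizing A).

(** A formal inverse acts as a converse relation, so no preimages have to be chosen. *)
Fixpoint dact X Y (f : dmor X Y) : T X -> T Y -> Prop :=
  match f with
  | DMap _ _ f => fun u v => lrel (lact f u) v
  | DInv _ _ s _ => fun u v => lrel (lact s v) u
  | DComp _ _ _ g f => fun u v => exists2 t, dact f u t & dact g t v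
  end.

Lemma dact_rel X Y (f : dmor X Y) u u' v v' :
  lrel u u' -> lrel v v' -> dact f u v -> dact f u' v'.
Proof.
elim: f u u' v v' => /= {X Y} [X Y f|X Y s qs|X Y Z g IHg f IHf] u u' v v' uu' vv'.
- move=> fuv; apply: lrel_trans vv'; apply: lrel_trans fuv.
  exact/lact_rel/lrel_sym.
- move=> svu; apply: lrel_trans uu'; apply: lrel_trans svu.
  exact/lact_rel/lrel_sym.
move=> [t fut gtv]; exists t.
  by apply: IHf fut => //; exact: lrel_refl.
by apply: IHg gtv => //; exact: lrel_refl.
Qed.

(** The relations [deq_invl] and [deq_invr] are respected thanks to [lact_inj] and [lact_surj]
    respectively; the others are functoriality. *)
Lemma deq_dact X Y (f g : dmor X Y) :
  deq f g -> forall u v, dact f u v <-> dact g u v.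
Proof.
elim=> {X Y f g} /=.
- by [].
- by move=> X Y f g _ fg u v; rewrite fg.
- by move=> X Y f g h _ fg _ gh u v; rewrite fg gh.
- move=> X Y Z g g' f f' _ gg' _ ff' u v.
  by split=> -[t /ff' ft /gg' gt]; exists t.
- move=> X Y Z T' h g f u v; split=> [[t [t' ? ?] ?]|[t ? [t' ? ?]]].
    by exists t' => //; exists t.
  by exists t' => //; exists t.
- move=> X Y f u v; split=> [[t fut tv]|fuv].
    apply: dact_rel fut; first exact: lrel_refl.
    exact: lrel_trans (lrel_sym (lact_id _)) tv.
  by exists v => //; apply: lact_id.
- move=> X Y f u v; split=> [[t ut ftv]|fuv].
    apply: dact_rel ftv; last exact: lrel_refl.
    exact: lrel_trans (lrel_sym ut) (lact_id _).
  by exists u => //; apply: lact_id.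
- move=> X Y f g fg u v; split; apply: lrel_trans.
    exact/lrel_sym/lact_ceq.
  exact: lact_ceq.
- move=> X Y Z g f u v; split=> [guv|[t fut gtv]].
    exists (lact f u); first exact: lrel_refl.
    exact: lrel_trans (lrel_sym (lact_comp _ _ _)) guv.
  apply: lrel_trans (lact_comp _ _ _) _; apply: lrel_trans gtv.
  exact: lact_rel.
- move=> X Y s qs u v; split=> [[t su sv]|uv].
    apply: lrel_trans (lact_id _) _; apply: lact_inj qs _.
    exact: lrel_trans su (lrel_sym sv).
  exists (lact s v); last exact: lrel_refl.
  by apply: lact_rel; apply: lrel_trans uv; apply/lrel_sym/lact_id.
move=> X Y s qs u v; split=> [[t su sv]|uv].
  apply: lrel_trans (lact_id _) _; exact: lrel_trans (lrel_sym su) sv.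
have [t tv] := lact_surj v qs; exists t => //.
by apply: lrel_trans tv (lrel_sym _); apply: lrel_trans uv; apply/lrel_sym/lact_id.
Qed.

End Localizing.

Section LocalizingExamples.
Variable A : nzRingType.
Implicit Types X Y Z M : cplx A.

Section HomotopyClasses.
Variables (M : cplx A) (Mproj : termwise_projective M).

Program Definition homotopy_classes : localizing A :=
  @Localizing A (fun X => cmap M X) (fun X u v => homotopic u v)
    (fun X Y f u => ccomp f u) _ _ _ _ _ _ _ _ _.
Next Obligation. exact: homotopic_refl. Qed.
Next Obligation. exact: homotopic_sym. Qed.
Next Obligation. exact: homotopic_trans H H0. Qed.
Next Obligation. exact: homotopic_comp (homotopic_refl _) H. Qed.
Next Obligation. by apply: ceq_homotopic => i x; apply: H. Qed.
Next Obligation. exact: ceq_homotopic. Qed.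
Next Obligation. exact: ceq_homotopic. Qed.
Next Obligation. exact: quasi_iso_homotopic H _ H0. Qed.
Next Obligation. exact: quasi_iso_lift. Qed.

(** Both morphisms act on the class of the identity of [M], as in the Yoneda lemma. *)
Lemma deq_homotopic X (f g : cmap M X) : deq (DMap f) (DMap g) -> homotopic f g.
Proof.
move=> /(@deq_dact _ homotopy_classes) /(_ (Defs.cid M) f) [+ _] /=.
move=> /(_ _)[]; first exact: ceq_homotopic.
move=> s sP; apply: homotopic_sym.
apply: homotopic_trans (ex_intro _ s sP); exact: ceq_homotopic.
Qed.

End HomotopyClasses.

Section Cohomology.
Variable i : int.

Definition cocycle X := {x : X (i + 1) | cdif X (i + 1) x = 0}.

Definition cohomologous X (x y : cocycle X) : Prop :=
  exists z, sval x = sval y + cdif X i z.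

Definition cocycle_map X Y (f : cmap X Y) (x : cocycle X) : cocycle Y :=
  exist _ (f (i + 1) (sval x))
    (etrans (esym (cmap_comm f (sval x)))
       (etrans (congr1 _ (svalP x)) (linear0 _))).

Program Definition cohomology : localizing A :=
  @Localizing A cocycle cohomologous cocycle_map _ _ _ _ _ _ _ _ _.
Next Obligation. by exists 0; rewrite linear0 addr0. Qed.
Next Obligation.
case: H => z uv; exists (- z); rewrite uv linearN; zmod.
Qed.
Next Obligation.
case: H => z e; case: H0 => z' e'; exists (z' + z); rewrite e e' linearD; zmod.
Qed.
Next Obligation.
by case: H => z e; exists (f i z); rewrite /= e linearD cmap_comm.
Qed.
Next Obligation. by exists 0; rewrite linear0 addr0 /= H. Qed.
Next Obligation. by exists 0; rewrite linear0 addr0. Qed.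
Next Obligation. by exists 0; rewrite linear0 addr0. Qed.
Next Obligation.
have [s_inj _] := H i; case: H0 => z /= e.
have [||x' uv] := s_inj (sval u - sval v).
- by rewrite linearB (svalP u) (svalP v) subrr.
- by exists z; rewrite linearB e; zmod.
by exists x'; rewrite -uv; zmod.
Qed.
Next Obligation.
have [_ s_surj] := H i; have [x dx [y' sx]] := s_surj _ (svalP v).
by exists (exist _ x dx); exists y'.
Qed.

End Cohomology.

(** The inverse acts on cohomology as a relation inverse to the action of [s]: comparing with the
    class of 0 gives injectivity, and composing on the other side gives surjectivity. *)
Lemma is_diso_quasi_iso X Y (s : cmap X Y) : is_diso (DMap s) -> quasi_iso s.
Proof.
move=> [t [ts st]] i; split.
  move=> x dx [y sx].
  have /(deq_dact (T := cohomology i)) := ts; rewrite /=.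
  pose o : cocycle i X := exist _ 0 (linear0 _).
  move=> tsE; have [_ /(_ _)[]] := tsE o o; first exact: (@lrel_refl _ (cohomology i)).
  move=> t0 so tt0; pose x' : cocycle i X := exist _ x dx.
  have [/(_ _)[]] := tsE x' o.
    exists t0 => //; apply: (@lrel_trans _ (cohomology i)) so.
    by exists y; rewrite /= sx linear0 add0r.
  by move=> z + _; rewrite /= add0r; exists z.
move=> y dy; have /(deq_dact (T := cohomology i)) := st; rewrite /=.
pose y' : cocycle i Y := exist _ y dy.
move=> /(_ y' y')[_ /(_ _)[]]; first exact: (@lrel_refl _ (cohomology i)).
by move=> t0 _ [z zP]; exists (sval t0); [exact: (svalP t0)|exists z].
Qed.

End LocalizingExamples.

Section DerivedCategory.
Variable A : nzRingType.
Implicit Types X Y Z M N : cplx A.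

Lemma deq_compl X Y Z (g : dmor Y Z) (f f' : dmor X Y) :
  deq f f' -> deq (DComp g f) (DComp g f').
Proof. exact: deq_comp (deq_refl _). Qed.

Lemma deq_compr X Y Z (g g' : dmor Y Z) (f : dmor X Y) :
  deq g g' -> deq (DComp g f) (DComp g' f).
Proof. by move=> gg'; apply: deq_comp gg' (deq_refl _). Qed.

Lemma deq_cancell X Y Z (g : dmor Y Z) (g' : dmor Z Y) (f : dmor X Y) :
  deq (DComp g' g) (did Y) -> deq (DComp g' (DComp g f)) f.
Proof.
move=> gg; apply: deq_trans (deq_assoc _ _ _) _.
exact: deq_trans (deq_compr _ gg) (deq_idl _).
Qed.

Lemma deq_cancelr X Y Z (g : dmor Y Z) (g' : dmor X Y) (f : dmor Y X) :
  deq (DComp g' f) (did Y) -> deq (DComp (DComp g g') f) g.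
Proof.
move=> gg; apply: deq_trans (deq_sym (deq_assoc _ _ _)) _.
exact: deq_trans (deq_compl _ gg) (deq_idr _).
Qed.

Lemma is_diso_id X : is_diso (did X).
Proof. by exists (did X); split; apply: deq_idl. Qed.

Lemma is_diso_comp X Y Z (g : dmor Y Z) (f : dmor X Y) :
  is_diso g -> is_diso f -> is_diso (DComp g f).
Proof.
move=> [g' [g'g gg']] [f' [f'f ff']]; exists (DComp f' g'); split.
  apply: deq_trans (deq_assoc _ _ _) _; apply: deq_trans f'f.
  exact/deq_compr/deq_cancelr.
apply: deq_trans (deq_assoc _ _ _) _; apply: deq_trans gg'.
exact/deq_compr/deq_cancelr.
Qed.

Lemma is_diso_deq X Y (f g : dmor X Y) : deq f g -> is_diso f -> is_diso g.
Proof.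
move=> fg [f' [f'f ff']]; exists f'; split.
  exact: deq_trans (deq_compl _ (deq_sym fg)) f'f.
exact: deq_trans (deq_compr _ (deq_sym fg)) ff'.
Qed.

Lemma quasi_iso_is_diso X Y (s : cmap X Y) : quasi_iso s -> is_diso (DMap s).
Proof. by move=> qs; exists (DInv qs); split; [apply: deq_invl|apply: deq_invr]. Qed.

Lemma diso_refl X : diso X X.
Proof. by exists (did X); apply: is_diso_id. Qed.

Lemma diso_sym X Y : diso X Y -> diso Y X.
Proof. by move=> [f [g [gf fg]]]; exists g, f. Qed.

Lemma diso_trans X Y Z : diso X Y -> diso Y Z -> diso X Z.
Proof. by move=> [f Df] [g Dg]; exists (DComp g f); apply: is_diso_comp. Qed.

Lemma quasi_iso_diso X Y (s : cmap X Y) : quasi_iso s -> diso X Y.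
Proof. by move=> qs; exists (DMap s); apply: quasi_iso_is_diso. Qed.

Section Cylinder.
Variables X Y : cplx A.

Let P i : fgmod A := fg_pair (X i) (Y i).

Definition sum_dif i (z : P i) : P (i + 1) := (cdif X i z.1, cdif Y i z.2).

Fact sum_dif_linear i : linear (@sum_dif i).
Proof. by move=> a x y; apply: injective_projections; rewrite /= linearP. Qed.

HB.instance Definition _ i :=
  GRing.isLinear.Build A (P i) (P (i + 1)) _ (@sum_dif i) (@sum_dif_linear i).

Fact sum_dif_sq i x : sum_dif (@sum_dif i x) = 0.
Proof. by apply: injective_projections; rewrite /= cdif_sq. Qed.

Fact sum_bounded :
  exists N : int, forall i, N < `|i| -> forall x : P i, x = 0.
Proof.
have [N NP] := cbounded X; have [N' NP'] := cbounded Y.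
exists (Num.max N N') => i; rewrite gt_max => /andP[Ni N'i] [x y].
by rewrite (NP _ Ni x) (NP' _ N'i y).
Qed.

Definition csum : cplx A :=
  @Cplx A P (fun i => @sum_dif i) sum_dif_sq sum_bounded.

Lemma sum_fst_comm i (z : csum i) : (cdif csum i z).1 = cdif X i z.1.
Proof. by []. Qed.

Definition sum_fst : cmap csum X :=
  @CMap A csum X (fun i => fst : {linear csum i -> X i}) sum_fst_comm.

Lemma sum_fst_quasi_iso : acyclic Y -> quasi_iso sum_fst.
Proof.
move=> Yac i; split.
  move=> [x y] [dx dy] [x' /= xE]; have [y' yE] := Yac i y dy.
  by exists (x', y'); rewrite xE yE.
move=> y dy; exists (y, 0); first by rewrite /= /sum_dif /= dy linear0.
by exists 0; rewrite linear0 addr0.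
Qed.

End Cylinder.

(* The sum of [X] and of the cone of its identity is a cylinder of [X]: both
   inclusions of [X] are sections of the projection, hence equal in the derived
   category. *)
Lemma homotopic_deq X Y (f g : cmap X Y) : homotopic f g -> deq (DMap f) (DMap g).
Proof.
move=> [h hP]; pose C := cone (Defs.cid X); pose Z := csum X C.
have Cac : acyclic C.
  move=> i [x y] [/= _ /eqP]; rewrite addr_eq0 => /eqP ->.
  exists (y, 0); rewrite /= /cone_dif /=; apply: injective_projections => //=.
  by rewrite linear0 addr0.
pose i0 i (x : X i) : Z i := (x, 0).
pose i1 i (x : X i) : Z i := (x, (0, x)).
have i0l i : linear (@i0 i).
  by move=> a x y; rewrite /i0; apply: injective_projections; rewrite //= scaler0 addr0.
have i1l i : linear (@i1 i).
  move=> a x y; rewrite /i1; apply: injective_projections => //=.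
  by apply: injective_projections; rewrite //= scaler0 addr0.
pose j0 i := HB.pack (@i0 i)
  (GRing.isLinear.Build A (X i) (Z i) _ (@i0 i) (@i0l i)) : {linear X i -> Z i}.
pose j1 i := HB.pack (@i1 i)
  (GRing.isLinear.Build A (X i) (Z i) _ (@i1 i) (@i1l i)) : {linear X i -> Z i}.
have j0P i x : j0 (i + 1) (cdif X i x) = cdif Z i (j0 i x).
  rewrite /= /sum_dif /= /i0; congr pair; exact: (esym (linear0 (cdif C i))).
have j1P i x : j1 (i + 1) (cdif X i x) = cdif Z i (j1 i x).
  rewrite /= /sum_dif /= /i1; congr pair; rewrite /cone_dif /= linear0 oppr0.
  by rewrite add0r.
(* This map restricts to [g] along [j0] and to [f] along [j1]; the homotopy identity is exactly its
   compatibility with the differentials. *)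
pose k0 i (z : Z i) : Y i := g i z.1 + (h i z.2.1 + (f i z.2.2 - g i z.2.2)).
have k0l i : linear (@k0 i).
  move=> a x y; rewrite /k0 /= !linearP /=.
  by rewrite !scalerDr !scalerN; zmod.
pose k i := HB.pack (@k0 i)
  (GRing.isLinear.Build A (Z i) (Y i) _ (@k0 i) (@k0l i)) : {linear Z i -> Y i}.
have kP i x : k (i + 1) (cdif Z i x) = cdif Y i (k i x).
  case: x => x [a b]; rewrite /= /k0 /= /cone_dif /=.
  rewrite (linearN (h _)) !(linearD (f _)) !(linearD (g _)) !(linearD (cdif _ _)).
  rewrite (linearN (cdif _ _)) -!cmap_comm.
  rewrite -[f (i + 1) a](subrK (g (i + 1) a)) hP /=; zmod.
pose J0 := CMap j0P; pose J1 := CMap j1P; pose k' := CMap kP.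
have fst_inv := quasi_iso_is_diso (@sum_fst_quasi_iso X C Cac).
have J01 : deq (DMap J0) (DMap J1).
  have [t [tf _]] := fst_inv.
  apply: deq_trans (deq_sym (deq_cancell _ tf)) _.
  apply: deq_trans (deq_cancell _ tf); apply: deq_compl.
  apply: deq_trans (deq_sym (deq_map_comp _ _)) _.
  by apply: deq_trans (deq_map_comp _ _); apply: deq_map.
have kf : ceq f (ccomp k' J1).
  by move=> i x; rewrite /= /k0 /i1 /= (linear0 (h i)); zmod.
have kg : ceq g (ccomp k' J0).
  by move=> i x; rewrite /= /k0 /i0 /= (linear0 (h i)) !linear0; zmod.
apply: deq_trans (deq_map kf) _; apply: deq_trans (deq_sym (deq_map kg)).
apply: deq_trans (deq_map_comp _ _) _; apply: deq_trans (deq_sym (deq_map_comp _ _)).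
exact/deq_compl/deq_sym.
Qed.

(** Each formal inverse in the word [f] is removed by lifting through its quasi-isomorphism. The
    induction carries a chain map [u] out of [M] because the intermediate complexes need not be
    projective. *)
Lemma projective_full M X (f : dmor M X) :
  termwise_projective M -> exists v : cmap M X, deq f (DMap v).
Proof.
move=> Mproj.
suff lift Y Z (h : dmor Y Z) (u : cmap M Y) :
    exists v : cmap M Z, deq (DComp h (DMap u)) (DMap v).
  have [v fv] := lift _ _ f (Defs.cid M); exists v.
  exact: deq_trans (deq_sym (deq_idr _)) fv.
elim: h u => {Y Z f} [Y Z f|Y Z s qs|W Y Z g IHg f IHf] u.
- by exists (ccomp f u); apply/deq_sym/deq_map_comp.
- have [v sv] := quasi_iso_lift u qs Mproj; exists v.
  apply: deq_trans (deq_compl _ (homotopic_deq (homotopic_sym sv))) _.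
  apply: deq_trans (deq_compl _ (deq_map_comp _ _)) _.
  exact/deq_cancell/deq_invl.
have [v fv] := IHf u; have [t gt] := IHg v; exists t; apply: deq_trans gt.
apply: deq_trans (deq_sym (deq_assoc _ _ _)) _; exact: deq_compl.
Qed.

Section ConeMap.
Variables (M N X Y : cplx A) (p : cmap M N) (f : cmap X Y).
Variables (u : cmap M X) (v : cmap N Y).

(** The square commutes only up to [h], which corrects the second component of the map of cones.
    That this map is a quasi-isomorphism is the five lemma, chased on elements. *)
Lemma cone_quasi_iso :
  homotopic (ccomp f u) (ccomp v p) -> quasi_iso u -> quasi_iso v ->
  exists s : cmap (cone p) (cone f), quasi_iso s.
Proof.
move=> [h hP] qu qv.
have hE i x : v (i + 1) (p (i + 1) x) = f (i + 1) (u (i + 1) x) -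
    (cdif Y i (h i x) + h (i + 1) (cdif M (i + 1) x)).
  by rewrite -hP /=; zmod.
pose s0 i (z : cone p i) : cone f i := (u (i + 1) z.1, v i z.2 - h i z.1).
have s0l i : linear (@s0 i).
  move=> a x y; apply: injective_projections; rewrite /= !linearP //=.
  by rewrite scalerDr scalerN; zmod.
pose s i := HB.pack (@s0 i)
  (GRing.isLinear.Build A (cone p i) (cone f i) _ (@s0 i) (@s0l i))
  : {linear cone p i -> cone f i}.
have sP i x : s (i + 1) (cdif (cone p) i x) = cdif (cone f) i (s i x).
  case: x => x y; apply: injective_projections; rewrite /= /cone_dif /=.
    by rewrite !linearN cmap_comm.
  rewrite (linearN (h _)) (linearD (v _)) hE (linearB (cdif _ _)) cmap_comm; zmod.
exists (CMap sP) => i; have [u_inj u_surj] := qu (i + 1); have [v_inj v_surj] := qv i.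
have [u_inj' u_surj'] := qu i; split.
  move=> [x y]; rewrite /= /cone_dif /s0 /= => -[/eqP]; rewrite oppr_eq0 => /eqP dx pxy.
  move=> [[a b] []] /= ux vy.
  have [|x' xE] := u_inj x dx; first by exists (- a); rewrite linearN.
  have [|x2 dx2 [y' ux2]] := u_surj' (u (i + 1) x' + a).
    by rewrite linearD -cmap_comm -xE ux addNr.
  pose x1 := x2 - x'.
  have dx1 : cdif M (i + 1) x1 = - x by rewrite /x1 linearB dx2 sub0r -xE.
  have ux1 : u (i + 1) x1 = a + cdif X i y' by rewrite /x1 linearB ux2; zmod.
  have [||y1 yE] := v_inj (y - p (i + 1) x1).
  - by rewrite linearB -cmap_comm dx1 linearN opprK -pxy [RHS]addrC.
  - exists (b - f i y' + h i x1); rewrite linearB hE ux1 dx1 (linearD (f _)).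
    rewrite cmap_comm -[v (i + 1) y](subrK (h (i + 1) x)) vy (linearN (h _)).
    rewrite (linearD (cdif Y i)) (linearB (cdif Y i)); zmod.
  exists (x1, y1); apply: injective_projections; rewrite /= /cone_dif /=.
    by rewrite dx1 opprK.
  by rewrite -yE; zmod.
move=> [a b]; rewrite /= /cone_dif /s0 /= => -[/eqP]; rewrite oppr_eq0 => /eqP da fab.
have [x dx [y uxy]] := u_surj a da.
have [v_inj' _] := qv (i + 1).
have vpE : v (i + 1 + 1) (p (i + 1 + 1) x) = f (i + 1 + 1) a +
    (f (i + 1 + 1) (cdif X (i + 1) y) - cdif Y (i + 1) (h (i + 1) x)).
  by rewrite hE uxy dx linear0 (linearD (f _)); zmod.
have aE : f (i + 1 + 1) a = - cdif Y (i + 1) b.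
  by rewrite -[LHS](addrK (cdif Y (i + 1) b)) fab sub0r.
have [||n0 n0E] := v_inj' (p (i + 1 + 1) x).
- by rewrite -cmap_comm dx linear0.
- exists (f (i + 1) y - b - h (i + 1) x); rewrite vpE aE cmap_comm.
  by rewrite !(linearB (cdif _ _)); zmod.
have [|n2 dn2 [z vn2]] := v_surj (v (i + 1) (- n0) - h (i + 1) x - b + f (i + 1) y).
  rewrite (linearD (cdif _ _)) !(linearB (cdif _ _)) -!cmap_comm linearN -n0E.
  by rewrite (linearN (v _)) vpE aE; zmod.
exists (x, - n0 - n2); rewrite /= /cone_dif /=.
  by rewrite dx oppr0 linearB linearN dn2 -n0E subr0 subrr.
exists (- y, - z); apply: injective_projections; rewrite /= /s0 /cone_dif /=.
  by rewrite uxy linearN opprK.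
by rewrite (linearB (v _)) vn2 !linearN /=; zmod.
Qed.

End ConeMap.
End DerivedCategory.

(** * Cones under exact embeddings *)

Section Functors.

Lemma fmor_is_diso (A A' : nzRingType) (F : dfunctor A A') X Y (f : dmor X Y) :
  is_diso f -> is_diso (fmor F f).
Proof.
move=> [g [gf fg]]; exists (fmor F g); split.
  apply: deq_trans (deq_sym (fmor_comp _ _ _)) _.
  exact: deq_trans (fmor_deq F gf) (fmor_id _ _).
apply: deq_trans (deq_sym (fmor_comp _ _ _)) _.
exact: deq_trans (fmor_deq F fg) (fmor_id _ _).
Qed.

Lemma fobj_diso (A A' : nzRingType) (F : dfunctor A A') X Y :
  diso X Y -> diso (F X) (F Y).
Proof. by move=> [f Df]; exists (fmor F f); apply: fmor_is_diso. Qed.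

Definition did_functor (A : nzRingType) : dfunctor A A :=
  @DFunctor A A id (fun X Y f => f) (fun X Y f g fg => fg)
    (fun X => deq_refl _) (fun X Y Z g f => deq_refl _).

Section Comp.
Variables (A A' A'' : nzRingType) (G : dfunctor A' A'') (F : dfunctor A A').

Fact comp_fmor_id X : deq (fmor G (fmor F (did X))) (did (G (F X))).
Proof. exact: deq_trans (fmor_deq G (fmor_id F X)) (fmor_id _ _). Qed.

Fact comp_fmor_comp X Y Z (g : dmor Y Z) (f : dmor X Y) :
  deq (fmor G (fmor F (DComp g f)))
      (DComp (fmor G (fmor F g)) (fmor G (fmor F f))).
Proof. exact: deq_trans (fmor_deq G (fmor_comp _ _ _)) (fmor_comp _ _ _). Qed.

Definition dcomp_functor : dfunctor A A'' :=
  @DFunctor A A'' (fun X => G (F X)) (fun X Y f => fmor G (fmor F f))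
    (fun X Y f g fg => fmor_deq G (fmor_deq F fg)) comp_fmor_id comp_fmor_comp.

End Comp.

Section Props.
Variables (A A' : nzRingType) (F : dfunctor A A').

Definition dfull := forall X Y (f : dmor (F X) (F Y)),
  exists g : dmor X Y, deq (fmor F g) f.

Definition dfaithful := forall X Y (f g : dmor X Y),
  deq (fmor F f) (fmor F g) -> deq f g.

(** [F f] need not be a chain map, so it is represented by some chain map [f']. Compatibility of the
    last isomorphism with the triangles is dropped, since only objects are compared in the end; in
    this form the property composes easily. *)
Definition preserves_cones := forall X Y (f : cmap X Y),
  exists X' Y' (f' : cmap X' Y') (a : dmor (F X) X') (b : dmor (F Y) Y'),
    [/\ is_diso a, is_diso b, deq (DComp b (fmor F (DMap f))) (DComp (DMap f') a)
      & diso (F (cone f)) (cone f')].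

Definition exact_embedding := [/\ dfull, dfaithful & preserves_cones].

Lemma natural_iso_faithful (H : dfunctor A' A) (eta : forall X, dmor (H (F X)) X) :
  (forall X, is_diso (eta X)) ->
  (forall X Y (f : dmor X Y),
     deq (DComp (eta Y) (fmor H (fmor F f))) (DComp f (eta X))) ->
  dfaithful.
Proof.
move=> eta_iso etaP X Y f g fg; have [t [_ et]] := eta_iso X.
apply: deq_trans (deq_sym (deq_cancelr _ et)) _.
apply: deq_trans (deq_cancelr _ et); apply: deq_compr.
apply: deq_trans (deq_sym (etaP _ _ _)) _; apply: deq_trans (etaP _ _ _).
exact/deq_compl/fmor_deq.
Qed.

(** The triangle of a cone is distinguished through identities, and its image is by definition
    isomorphic to the triangle of another cone. *)
Lemma triangulated_preserves_cones : triangulated F -> preserves_cones.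
Proof.
move=> [sh [_ _ Ftri]] X Y f.
have tri : distinguished (DMap f) (DMap (cone_in f)) (DMap (cone_out f)).
  exists X, Y, f, (did X), (did Y), (did (cone f)).
  split; try by [exact: is_diso_id | split; exact: is_diso_id].
  - exact: deq_trans (deq_idl _) (deq_sym (deq_idr _)).
  - exact: deq_trans (deq_idl _) (deq_sym (deq_idr _)).
  apply: deq_trans (deq_sym (deq_idr _)).
  apply: deq_trans (deq_idl _); apply: deq_compr; exact: deq_map.
have [X' [Y' [f' [a [b [c [[Da Db] Dc ba _ _]]]]]]] := Ftri _ _ _ _ _ _ tri.
by exists X', Y', f', a, b; split=> //; exists c.
Qed.

End Props.

(** The candidate is the preimage of [H f] under the natural isomorphism [eta]. It is checked after
    applying [H], which is faithful because of [eps]. *)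
Lemma quasi_inverse_full (A A' : nzRingType) (F : dfunctor A A') (H : dfunctor A' A) :
  quasi_inverse F H -> dfull F.
Proof.
move=> [[eta [eta_iso etaP]] [eps [eps_iso epsP]]] X Y f.
have Hf := natural_iso_faithful eps_iso epsP.
have [t [te et]] := eta_iso X; have [t' [te' et']] := eta_iso Y.
exists (DComp (DComp (eta Y) (fmor H f)) t); apply: Hf.
set g := DComp (DComp _ _) t.
apply: deq_trans (deq_sym (deq_cancell _ te')) _.
apply: deq_trans (deq_compl _ (etaP _ _ g)) _.
apply: deq_trans (deq_compl _ (deq_cancelr _ te)) _.
exact: deq_cancell.
Qed.

Lemma equivalence_exact_embedding (A A' : nzRingType)
    (F : dfunctor A A') (H : dfunctor A' A) :
  triangulated F -> quasi_inverse F H -> exact_embedding F.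
Proof.
move=> Ftri FH; split; first exact: quasi_inverse_full FH.
  by have [[eta [eta_iso etaP]] _] := FH; apply: natural_iso_faithful etaP.
exact: triangulated_preserves_cones.
Qed.

Lemma did_exact_embedding A : exact_embedding (did_functor A).
Proof.
split=> //; first by move=> X Y f; exists f; apply: deq_refl.
move=> X Y f; exists X, Y, f, (did X), (did Y); split; try exact: is_diso_id.
  exact: deq_trans (deq_idl _) (deq_sym (deq_idr _)).
exact: diso_refl.
Qed.

Lemma comp_exact_embedding (A A' A'' : nzRingType)
    (G : dfunctor A' A'') (F : dfunctor A A') :
  exact_embedding G -> exact_embedding F -> exact_embedding (dcomp_functor G F).
Proof.
move=> [Gfull Gfaith Gcone] [Ffull Ffaith Fcone]; split.
- move=> X Y f; have [g gf] := Gfull _ _ f; have [h hg] := Ffull _ _ g.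
  by exists h; apply: deq_trans gf; apply: fmor_deq.
- by move=> X Y f g /Gfaith/Ffaith.
move=> X Y f; have [X' [Y' [f' [a [b [Da Db ba cf]]]]]] := Fcone _ _ f.
have [X2 [Y2 [f2 [a' [b' [Da' Db' ba' cf']]]]]] := Gcone _ _ f'.
exists X2, Y2, f2, (DComp a' (fmor G a)), (DComp b' (fmor G b)); split.
- by apply: is_diso_comp; last exact: fmor_is_diso.
- by apply: is_diso_comp; last exact: fmor_is_diso.
- apply: deq_trans (deq_sym (deq_assoc _ _ _)) _ => /=.
  apply: deq_trans (deq_compl _ (deq_sym (fmor_comp G _ _))) _.
  apply: deq_trans (deq_compl _ (fmor_deq G ba)) _.
  apply: deq_trans (deq_compl _ (fmor_comp _ _ _)) _.
  apply: deq_trans (deq_assoc _ _ _) _.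
  apply: deq_trans (deq_compr _ ba') _.
  exact/deq_sym/deq_assoc.
exact: diso_trans (fobj_diso G cf) cf'.
Qed.

(** The representative [f'] supplied by [Fcone] may be replaced by any [p] between projective
    complexes: the isomorphisms from [M] and [N] to the ends of [f'] are then chain maps and the
    square commutes up to homotopy. *)
Lemma preserves_cones_diso (A A' : nzRingType) (F : dfunctor A A')
    X Y (f : cmap X Y) M N (p : cmap M N) (a : dmor (F X) M) (b : dmor (F Y) N) :
  preserves_cones F -> termwise_projective M -> termwise_projective N ->
  is_diso a -> is_diso b ->
  deq (DComp b (fmor F (DMap f))) (DComp (DMap p) a) ->
  diso (F (cone f)) (cone p).
Proof.
move=> Fcone Mproj Nproj [a' [a'a aa']] [b' [b'b bb']] ba.
have [X' [Y' [f' [c [d [Dc Dd dc cf]]]]]] := Fcone _ _ f.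
have [u uE] := projective_full (DComp c a') Mproj.
have [v vE] := projective_full (DComp d b') Nproj.
apply: diso_trans cf (diso_sym _).
have [|||s qs] := @cone_quasi_iso _ _ _ _ _ p f' u v; last exact: quasi_iso_diso qs.
- apply: deq_homotopic => //.
  apply: deq_trans (deq_map_comp _ _) _.
  apply: deq_trans (deq_compl _ (deq_sym uE)) _.
  apply: deq_trans (deq_assoc _ _ _) _.
  apply: deq_trans (deq_compr _ (deq_sym dc)) _.
  apply: deq_trans (deq_sym (deq_assoc _ _ _)) _.
  apply: deq_sym; apply: deq_trans (deq_map_comp _ _) _.
  apply: deq_trans (deq_compr _ (deq_sym vE)) _.
  apply: deq_trans (deq_sym (deq_assoc _ _ _)) _; apply: deq_compl.
  apply: deq_trans (deq_sym (deq_cancelr _ aa')) _.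
  apply: deq_compr; apply: deq_trans (deq_sym (deq_assoc _ _ _)) _.
  apply: deq_trans (deq_compl _ (deq_sym ba)) _.
  exact: deq_cancell.
- apply: is_diso_quasi_iso; apply: is_diso_deq uE _.
  by apply: is_diso_comp => //; exists a.
apply: is_diso_quasi_iso; apply: is_diso_deq vE _.
by apply: is_diso_comp => //; exists b.
Qed.

(* The morphism [F f] factors through [p], the preimage of the second factor
   being invertible by the last hypothesis; so [F f] may be replaced by [p]. *)
Lemma cone_correspondence (A A' : nzRingType) (F : dfunctor A A')
    X Y (f : cmap X Y) M N (p : cmap M N) :
  exact_embedding F ->
  termwise_projective X -> termwise_projective Y ->
  termwise_projective M -> termwise_projective N ->
  diso (F X) M -> diso (F Y) N ->
  (forall h : cmap M N, exists q : cmap N N, homotopic h (ccomp q p)) ->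
  (forall (h : cmap X Y) (q : cmap Y Y), homotopic f (ccomp q h) -> quasi_iso q) ->
  diso (F (cone f)) (cone p).
Proof.
move=> [Ffull Ffaith Fcone] Xproj Yproj Mproj Nproj [a Da] [b Db] pfact funit.
have [a' [a'a aa']] := Da; have [b' [b'b bb']] := Db.
have [h hE] := Ffull _ _ (DComp b' (DComp (DMap p) a)).
have [h1 h1E] := projective_full h Xproj.
have [t tE] := projective_full (DComp (DComp b (fmor F (DMap f))) a') Mproj.
have [q qE] := pfact t.
have [k kE] := Ffull _ _ (DComp b' (DComp (DMap q) b)).
have [k1 k1E] := projective_full k Yproj.
have bfE : deq (DComp b (fmor F (DMap f))) (DComp (DMap q) (DComp (DMap p) a)).
  apply: deq_trans (deq_sym (deq_cancelr _ a'a)) _.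
  apply: deq_trans (deq_compr _ tE) _.
  apply: deq_trans (deq_compr _ (homotopic_deq qE)) _.
  apply: deq_trans (deq_compr _ (deq_map_comp _ _)) _.
  exact/deq_sym/deq_assoc.
have fE : deq (DMap f) (DComp k h).
  apply: Ffaith; apply: deq_trans (deq_sym (deq_cancell _ b'b)) _.
  apply: deq_trans (deq_compl _ bfE) _.
  apply: deq_sym; apply: deq_trans (fmor_comp _ _ _) _.
  apply: deq_trans (deq_comp kE hE) _.
  apply: deq_trans (deq_sym (deq_assoc _ _ _)) _; apply: deq_compl.
  apply: deq_trans (deq_sym (deq_assoc _ _ _)) _; apply: deq_compl.
  exact: deq_cancell.
(* Nothing is known about [q] itself, but its preimage [k] is a second factor of [f], to which
   [funit] applies. *)
have qk : quasi_iso k1.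
  apply: (funit h1); apply: deq_homotopic => //.
  apply: deq_trans fE _; apply: deq_trans (deq_comp k1E h1E) _.
  exact/deq_sym/deq_map_comp.
have [l [lk kl]] : is_diso (fmor F k).
  apply: fmor_is_diso; apply: is_diso_deq (deq_sym k1E) _.
  exact: quasi_iso_is_diso.
have Dl : is_diso l by exists (fmor F k).
(* Correcting [b] by the inverse of [F k] turns [F f] into [p]. *)
apply: (@preserves_cones_diso _ _ F _ _ f _ _ p a (DComp b l)) => //.
  exact: is_diso_comp.
apply: deq_trans (deq_sym (deq_assoc _ _ _)) _.
apply: deq_trans (deq_compl _ (deq_compl _ (fmor_deq F fE))) _.
apply: deq_trans (deq_compl _ (deq_compl _ (fmor_comp _ _ _))) _.
apply: deq_trans (deq_compl _ (deq_cancell _ lk)) _.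
apply: deq_trans (deq_compl _ hE) _.
exact: deq_cancell.
Qed.

End Functors.

(** * Two-term complexes *)

Section TwoTermMaps.
Variable A : nzRingType.
Implicit Types P Q : fgmod A.

Lemma tt_obj_eq0 P Q j (x : tt_obj P Q j) : j <> 0 -> j <> 1 -> x = 0.
Proof.
case: j x => [[|[|j]]|j] x j0 j1.
- by case: j0.
- by case: j1.
- by apply/matrixP => ? [].
by apply/matrixP => ? [].
Qed.

(** Three consecutive degrees occur in each identity below. As variables with equations they can be
    replaced by numerals, on which [tt_obj] computes; outside four values of [k] all three terms are
    zero. *)
Lemma int_cases (k a c : int) : a = k + 1 -> c = k + 2 ->
  [\/ [/\ k = Negz 1, a = Negz 0 & c = Posz 0], [/\ k = Negz 0, a = Posz 0 & c = Posz 1],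
      [/\ k = Posz 0, a = Posz 1 & c = Posz 2] | [/\ k = Posz 1, a = Posz 2 & c = Posz 3]] \/
  [/\ k <> 0 /\ k <> 1, a <> 0 /\ a <> 1 & c <> 0 /\ c <> 1].
Proof.
move=> -> ->; case: k => [[|[|k]]|[|[|k]]].
- by left; constructor 3; split; lia.
- by left; constructor 4; split; lia.
- by right; split; split; lia.
- by left; constructor 2; split; lia.
- by left; constructor 1; split; lia.
by right; split; split; lia.
Qed.

Section Components.
Variables (P Q : fgmod A) (h : {linear P -> Q}).

(** Defined in every degree [j], by zero away from the right one: [n - n] equals [0] only
    propositionally, so [P] is not convertible to the term of degree [n]. *)
Definition tt_in0 (j : int) : {linear P -> tt_obj P Q j} :=
  match j with Posz 0 => (idfun : {linear P -> P}) | _ => \0 end.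
Definition tt_in1 (j : int) : {linear Q -> tt_obj P Q j} :=
  match j with Posz 1 => (idfun : {linear Q -> Q}) | _ => \0 end.
Definition tt_out0 (j : int) : {linear tt_obj P Q j -> P} :=
  match j with Posz 0 => (idfun : {linear P -> P}) | _ => \0 end.
Definition tt_out1 (j : int) : {linear tt_obj P Q j -> Q} :=
  match j with Posz 1 => (idfun : {linear Q -> Q}) | _ => \0 end.

Lemma tt_dif_in0 j k x :
  j = 0 -> k = 1 -> tt_dif h j k (tt_in0 j x) = tt_in1 k (h x).
Proof. by move=> -> ->. Qed.

Lemma tt_out1_dif j k x :
  j = 0 -> k = 1 -> tt_out1 k (tt_dif h j k x) = h (tt_out0 j x).
Proof. by move=> jE kE; subst. Qed.

End Components.

Section Map.
Variables (P Q P' Q' : fgmod A).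

Definition tt_map (p : {linear P -> P'}) (q : {linear Q -> Q'}) (j : int) :
    {linear tt_obj P Q j -> tt_obj P' Q' j} :=
  match j with
  | Posz 0 => p
  | Posz 1 => q
  | _ => \0
  end.

Variables (h : {linear P -> Q}) (h' : {linear P' -> Q'}).

Lemma tt_map_comm (p : {linear P -> P'}) (q : {linear Q -> Q'}) j k x :
  (forall x, q (h x) = h' (p x)) ->
  tt_map p q k (tt_dif h j k x) = tt_dif h' j k (tt_map p q j x).
Proof.
move=> qh; case: j x => [[|[|j]]|j] x; case: k => [[|[|k]]|k] //=;
  by rewrite ?linear0.
Qed.

Definition tt_cmap n (p : {linear P -> P'}) (q : {linear Q -> Q'})
    (qh : forall x, q (h x) = h' (p x)) : cmap (two_term n h) (two_term n h') :=
  @CMap A (two_term n h) (two_term n h') (fun i => tt_map p q (i - n))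
    (fun i x => @tt_map_comm p q (i - n) (i + 1 - n) x qh).

Lemma tt_cmap_quasi_iso n (p : {linear P -> P'}) (q : {linear Q -> Q'})
    (qh : forall x, q (h x) = h' (p x)) :
  bijective p -> bijective q -> quasi_iso (tt_cmap n qh).
Proof.
move=> pbij qbij.
have bij j : bijective (tt_map p q j).
  case: j => [[|[|j]]|j] //=.
    by exists (fun=> 0) => x; apply/matrixP => ? [].
  by exists (fun=> 0) => x; apply/matrixP => ? [].
set s := tt_cmap n qh; have sbij i : bijective (s i) by apply: bij.
move=> i; split.
  move=> x _ [y sx]; have [t st ts] := sbij i; exists (t y).
  by apply: (bij_inj (sbij (i + 1))); rewrite sx cmap_comm ts.
move=> y dy; have [t st ts] := sbij (i + 1); exists (t y).
  by apply: (bij_inj (sbij _)); rewrite cmap_comm ts dy linear0.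
by exists 0; rewrite linear0 addr0 ts.
Qed.

Lemma tt_cmapP n (f : cmap (two_term n h) (two_term n h')) :
  exists (p : {linear P -> P'}) (q : {linear Q -> Q'})
    (qh : forall x, q (h x) = h' (p x)), ceq f (tt_cmap n qh).
Proof.
pose p := tt_out0 P' Q' (n - n) \o f n \o tt_in0 P Q (n - n) : {linear P -> P'}.
pose q := tt_out1 P' Q' (n + 1 - n) \o f (n + 1) \o tt_in1 P Q (n + 1 - n)
  : {linear Q -> Q'}.
have n0 : n - n = 0 by lia.
have n1 : n + 1 - n = 1 by lia.
have qh x : q (h x) = h' (p x).
  rewrite /q /= -(tt_dif_in0 h _ n0 n1); have := cmap_comm f (tt_in0 P Q (n - n) x).
  by move=> /= ->; rewrite tt_out1_dif.
exists p, q, qh => i x /=.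
have [e0|ne0] := pselect (i = n).
  subst i; rewrite /p; clear qh p; clear -n0.
  move: (f n) x => /=; move: (n - n) n0 => j jE; subst j.
  by move=> g x.
have [e1|ne1] := pselect (i = n + 1).
  subst i; rewrite /q; clear -n1.
  move: (f (n + 1)) x => /=; move: (n + 1 - n) n1 => j jE; subst j.
  by move=> g x.
rewrite [x]tt_obj_eq0 ?linear0 //; lia.
Qed.

(** Only the component from the upper term [Q] to the lower term [P'] of a homotopy can be
    nonzero. *)
Lemma tt_homotopic n (p : {linear P -> P'}) (q : {linear Q -> Q'})
    (qh : forall x, q (h x) = h' (p x)) (p' : {linear P -> P'})
    (q' : {linear Q -> Q'}) (qh' : forall x, q' (h x) = h' (p' x)) :
  homotopic (tt_cmap n qh) (tt_cmap n qh') ->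
  exists s : {linear Q -> P'},
    (forall x, p x - p' x = s (h x)) /\ (forall y, q y - q' y = h' (s y)).
Proof.
(* Homotopies are indexed by degrees of the form [i + 1], so [n] is given this form. *)
rewrite -(subrK 1 n); move: (n - 1) => k [s sP].
have k0 : k + 1 - (k + 1) = 0 by lia.
have k1 : k + 1 + 1 - (k + 1) = 1 by lia.
exists (tt_out0 P' Q' (k + 1 - (k + 1)) \o s (k + 1) \o tt_in1 P Q (k + 1 + 1 - (k + 1))).
split=> [x|y] /=.
  rewrite -(tt_dif_in0 h x k0 k1).
  have := sP k (tt_in0 P Q (k + 1 - (k + 1)) x); rewrite /=.
  rewrite [s k _]tt_obj_eq0 ?linear0 ?add0r; try lia.
  move=> <-; rewrite linearB; clear -k0.
  by move: (k + 1 - (k + 1)) k0 => j ->.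
rewrite -(tt_out1_dif h' _ k0 k1).
have := sP (k + 1) (tt_in1 P Q (k + 1 + 1 - (k + 1)) y); rewrite /=.
rewrite [tt_dif _ _ _ (tt_in1 _ _ _ _)]tt_obj_eq0 ?linear0 ?addr0; try lia.
move=> <-; rewrite linearB; clear -k1.
by move: (k + 1 + 1 - (k + 1)) k1 => j ->.
Qed.

End Map.

Lemma stalk_diso n P P' (f : {linear P -> P'}) :
  bijective f -> diso (stalk n P) (stalk n P').
Proof.
move=> fbij.
have qh : forall x, (idfun : {linear fg_zero A -> fg_zero A})
    ((\0 : {linear P -> fg_zero A}) x) = (\0 : {linear P' -> fg_zero A}) (f x) by [].
by apply: quasi_iso_diso (tt_cmap_quasi_iso n qh fbij _); exists id.
Qed.

Lemma fg_zero_projective : projective_mod (fg_zero A).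
Proof.
move=> M N p f _; exists \0 => x /=.
by rewrite [x]thinmx0 !linear0.
Qed.

Lemma two_term_projective n P Q (h : {linear P -> Q}) :
  projective_mod P -> projective_mod Q -> termwise_projective (two_term n h).
Proof.
move=> Pp Qp i /=; have zproj := fg_zero_projective.
by case: (i - n) => [[|[|j]]|j].
Qed.

End TwoTermMaps.

Lemma homotopy_equivalence_diso (A : nzRingType) (X Y : cplx A)
    (s : cmap X Y) (r : cmap Y X) :
  homotopic (ccomp r s) (Defs.cid X) -> homotopic (ccomp s r) (Defs.cid Y) ->
  diso X Y.
Proof.
move=> /homotopic_deq rs /homotopic_deq sr; exists (DMap s), (DMap r); split.
  exact: deq_trans (deq_sym (deq_map_comp _ _)) rs.
exact: deq_trans (deq_sym (deq_map_comp _ _)) sr.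
Qed.

Section LinearPairs.
Variable A : nzRingType.

Lemma pair_linear (M N N' : lmodType A) (f : {linear M -> N}) (g : {linear M -> N'}) :
  linear (fun x => (f x, g x)).
Proof. by move=> a x y; rewrite !linearP. Qed.

Definition lin_pair (M N N' : lmodType A) (f : {linear M -> N}) (g : {linear M -> N'})
    : {linear M -> (N * N')%type} :=
  HB.pack (fun x => (f x, g x))
    (GRing.isLinear.Build A M (N * N')%type _ (fun x => (f x, g x)) (pair_linear f g)).

Lemma copair_linear (M N N' : lmodType A) (f : {linear N -> M}) (g : {linear N' -> M}) :
  linear (fun z : N * N' => f z.1 + g z.2).
Proof. by move=> a x y; rewrite /= !linearP scalerDr /=; zmod. Qed.

Definition lin_copair (M N N' : lmodType A) (f : {linear N -> M}) (g : {linear N' -> M})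
    : {linear (N * N')%type -> M} :=
  HB.pack (fun z : N * N' => f z.1 + g z.2)
    (GRing.isLinear.Build A (N * N')%type M _ (fun z : N * N' => f z.1 + g z.2)
       (copair_linear f g)).

End LinearPairs.

Ltac degree_cases k a c :=
  let ea := fresh in let ec := fresh in
  move=> ea ec;
  case: (int_cases ea ec);
  [case=> -[? ? ?]; clear ea ec; subst k a c
  |case=> -[? ?] [? ?] [? ?]; clear ea ec].

Lemma fg_zero_eq (A : nzRingType) (x y : fg_zero A) : x = y.
Proof. by rewrite [x]thinmx0 [y]thinmx0. Qed.

Ltac tt_zero :=
  first [exact: fg_zero_eq | by rewrite [LHS]tt_obj_eq0 // [RHS]tt_obj_eq0].

Section ConeSameTarget.
Variables (A : nzRingType) (n : int) (P P' Q : fgmod A).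
Variables (h : {linear P -> Q}) (h' : {linear P' -> Q}) (p : {linear P -> P'}).
Hypothesis hE : forall x, (idfun : {linear Q -> Q}) (h x) = h' (p x).

(** In the cone of [(p, id)] the two copies of [Q] cancel. [s1] and [s2] are the components of the
    inclusion of [P -> P'], the term [- h'] making it a chain map; [r1] and [r2] are those of a
    retraction, and [t] contracts the complement. *)
Let s1 (b : int) : {linear tt_obj P P' b -> tt_obj P Q b} :=
  match b with
  | Posz 0 => (idfun : {linear P -> P})
  | Posz 1 => (\- h' : {linear P' -> Q})
  | _ => \0
  end.
Let s2 (b k : int) : {linear tt_obj P P' b -> tt_obj P' Q k} :=
  match b, k with
  | Posz 1, Posz 0 => (idfun : {linear P' -> P'})
  | b, k => (\0 : {linear tt_obj P P' b -> tt_obj P' Q k})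
  end.
Let r1 (b : int) : {linear tt_obj P Q b -> tt_obj P P' b} :=
  match b with Posz 0 => (idfun : {linear P -> P}) | _ => \0 end.
Let r2 (k b : int) : {linear tt_obj P' Q k -> tt_obj P P' b} :=
  match k, b with
  | Posz 0, Posz 1 => (idfun : {linear P' -> P'})
  | k, b => (\0 : {linear tt_obj P' Q k -> tt_obj P P' b})
  end.
Let t (b : int) : {linear tt_obj P' Q b -> tt_obj P Q b} :=
  match b with Posz 1 => (\- idfun : {linear Q -> Q}) | _ => \0 end.
Let f := tt_map p (idfun : {linear Q -> Q}).

Lemma cone_incl_comm1 k a c x : a = k + 1 -> c = k + 2 ->
  s1 c (tt_dif p a c x) = - tt_dif h a c (s1 a x).
Proof.
degree_cases k a c; rewrite /= ?linear0 ?oppr0 //.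
  by rewrite -hE.
tt_zero.
Qed.

Lemma cone_incl_comm2 k a c x : a = k + 1 -> c = k + 2 ->
  s2 c a (tt_dif p a c x) = f a (s1 a x) + tt_dif h' k a (s2 a k x).
Proof.
degree_cases k a c; rewrite /= ?linear0 ?addr0 ?add0r ?addNr //.
tt_zero.
Qed.

Lemma cone_retr_comm k a c x y : a = k + 1 -> c = k + 2 ->
  r1 c (- tt_dif h a c x) + r2 a c (f a x + tt_dif h' k a y) =
  tt_dif p a c (r1 a x + r2 k a y).
Proof.
degree_cases k a c; rewrite /= ?linear0 ?addr0 ?add0r ?oppr0 //.
tt_zero.
Qed.

Lemma cone_retr_incl k a c (x : tt_obj P P' a) : a = k + 1 -> c = k + 2 ->
  r1 a (s1 a x) + r2 k a (s2 a k x) = x.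
Proof.
degree_cases k a c; rewrite /= ?linear0 ?addr0 ?add0r //;
  tt_zero.
Qed.

Lemma cone_htpy1 k a c x y : a = k + 1 -> c = k + 2 ->
  s1 c (r1 c x + r2 a c y) - x =
  - tt_dif h a c (t a y) + t c (f c x + tt_dif h' a c y).
Proof.
degree_cases k a c; rewrite /= ?addr0 ?add0r ?subrr ?oppr0 ?addr0 //.
- by rewrite linear0 oppr0 add0r opprD [RHS]addrC.
- tt_zero.
- tt_zero.
tt_zero.
Qed.

Lemma cone_htpy2 k a c x y : a = k + 1 -> c = k + 2 ->
  s2 c a (r1 c x + r2 a c y) - y = f a (t a y).
Proof.
degree_cases k a c; rewrite /= ?linear0 ?addr0 ?add0r ?subrr ?sub0r ?oppr0 //;
  tt_zero.
Qed.

(* The degree [i - (n - 1)] of the target is only propositionally equal to the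
   degree [i + 1 - n] occurring in the cone, whence the parameter [phi]. *)
Lemma cone_same_target_reindex (phi : int -> int)
    (sq : forall i x, tt_dif p (phi (i + 1)) (phi (i + 1 + 1))
            (tt_dif p (phi i) (phi (i + 1)) x) = 0)
    (bd : exists N : int, forall i, N < `|i| -> forall x : tt_obj P P' (phi i), x = 0) :
  phi = (fun i => i + 1 - n) ->
  diso (cone (tt_cmap n hE)) (@Cplx A (fun i => tt_obj P P' (phi i))
    (fun i => tt_dif p (phi i) (phi (i + 1))) sq bd).
Proof.
move=> phiE; subst phi; set W := Cplx _ _; pose C := cone (tt_cmap n hE).
have ea i : i + 1 - n = i - n + 1 by lia.
have ec i : i + 1 + 1 - n = i - n + 2 by lia.
pose s i : {linear W i -> C i} := lin_pair (s1 (i + 1 - n)) (s2 (i + 1 - n) (i - n)).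
pose r i : {linear C i -> W i} := lin_copair (r1 (i + 1 - n)) (r2 (i - n) (i + 1 - n)).
have sP i x : s (i + 1) (cdif W i x) = cdif C i (s i x).
  apply: injective_projections; rewrite /= /cone_dif /=.
    exact: (cone_incl_comm1 _ (ea i) (ec i)).
  exact: (cone_incl_comm2 _ (ea i) (ec i)).
have rP i x : r (i + 1) (cdif C i x) = cdif W i (r i x).
  by case: x => x y; apply: (cone_retr_comm _ _ (ea i) (ec i)).
apply: diso_sym; apply: (@homotopy_equivalence_diso _ _ _ (CMap sP) (CMap rP)).
  by apply: ceq_homotopic => i x; apply: (cone_retr_incl _ (ea i) (ec i)).
pose k i : {linear C (i + 1) -> C i} :=
  lin_pair (t (i + 1 - n) \o snd : {linear C (i + 1) -> _}) (\0 : {linear C (i + 1) -> _}).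
exists k => i [x y]; apply: injective_projections; rewrite /= /cone_dif /=.
  exact: (cone_htpy1 _ _ (ea i) (ec i)).
by rewrite linear0 !addr0; apply: (cone_htpy2 _ _ (ea i) (ec i)).
Qed.

Lemma cone_same_target_diso :
  diso (cone (tt_cmap n hE)) (two_term (n - 1) p).
Proof. by apply: cone_same_target_reindex; apply: funext => i; lia. Qed.

End ConeSameTarget.

Section ConeProjection.
Variables (A : nzRingType) (n : int) (P Q : fgmod A) (h : {linear P -> Q}).

Fact stalk_projE x :
  (\0 : {linear Q -> fg_zero A}) (h x)
  = (\0 : {linear P -> fg_zero A}) ((idfun : {linear P -> P}) x).
Proof. by []. Qed.

Definition stalk_proj : cmap (two_term n h) (stalk n P) :=
  tt_cmap n stalk_projE.

(** The target has no term in degree [n + 1], so a map to it is its component on [P], and it factors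
    strictly. *)
Lemma stalk_proj_factor (f : cmap (two_term n h) (stalk n P)) :
  exists q : cmap (stalk n P) (stalk n P), homotopic f (ccomp q stalk_proj).
Proof.
have [p [q [qh fE]]] := tt_cmapP f.
have qh' x : (idfun : {linear fg_zero A -> fg_zero A})
    ((\0 : {linear P -> fg_zero A}) x) = (\0 : {linear P -> fg_zero A}) (p x) by [].
exists (tt_cmap n qh'); apply: ceq_homotopic => i x; rewrite fE /=.
have compE j y : tt_map p q j y = tt_map p (idfun : {linear fg_zero A -> fg_zero A}) j
    (tt_map (idfun : {linear P -> P}) (\0 : {linear Q -> fg_zero A}) j y).
  by case: j y => [[|[|j]]|j] y //=; apply: fg_zero_eq.
exact: compE.
Qed.

(** Now the two copies of [P] cancel and [Q] survives, in degree [n]. The component [h] of the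
    retraction is forced by compatibility with the differentials. *)
Let s (k a : int) : {linear tt_obj Q (fg_zero A) k -> tt_obj P Q a} :=
  match k, a with
  | Posz 0, Posz 1 => (idfun : {linear Q -> Q})
  | k, a => (\0 : {linear tt_obj Q (fg_zero A) k -> tt_obj P Q a})
  end.
Let r1 (k a : int) : {linear tt_obj P Q a -> tt_obj Q (fg_zero A) k} :=
  match k, a with
  | Posz 0, Posz 1 => (idfun : {linear Q -> Q})
  | k, a => (\0 : {linear tt_obj P Q a -> tt_obj Q (fg_zero A) k})
  end.
Let r2 (k : int) : {linear tt_obj P (fg_zero A) k -> tt_obj Q (fg_zero A) k} :=
  match k with
  | Posz 0 => h
  | _ => \0
  end.
Let t (k : int) : {linear tt_obj P (fg_zero A) k -> tt_obj P Q k} :=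
  match k with Posz 0 => (\- idfun : {linear P -> P}) | _ => \0 end.
Let f := tt_map (idfun : {linear P -> P}) (\0 : {linear Q -> fg_zero A}).
Let o1 : {linear P -> fg_zero A} := \0.
Let o2 : {linear Q -> fg_zero A} := \0.

Lemma stalk_incl_comm1 k a c x : a = k + 1 -> c = k + 2 ->
  s a c (tt_dif o2 k a x) = - tt_dif h a c (s k a x).
Proof.
degree_cases k a c; rewrite /= ?linear0 ?oppr0 //.
tt_zero.
Qed.

Lemma stalk_incl_comm2 k a c x : a = k + 1 -> c = k + 2 ->
  0 = f a (s k a x).
Proof.
degree_cases k a c; rewrite /= ?linear0 //.
tt_zero.
Qed.

Lemma stalk_retr_comm k a c x y : a = k + 1 -> c = k + 2 ->
  r1 a c (- tt_dif h a c x) + r2 a (f a x + tt_dif o1 k a y) =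
  tt_dif o2 k a (r1 k a x + r2 k y).
Proof.
degree_cases k a c; rewrite /= ?linear0 ?addr0 ?add0r ?oppr0 ?addNr //.
tt_zero.
Qed.

Lemma stalk_retr_incl k a c (x : tt_obj Q (fg_zero A) k) : a = k + 1 -> c = k + 2 ->
  r1 k a (s k a x) = x.
Proof. degree_cases k a c; rewrite /= //; tt_zero. Qed.

Lemma stalk_htpy1 k a c x y : a = k + 1 -> c = k + 2 ->
  s a c (r1 a c x + r2 a y) - x =
  - tt_dif h a c (t a y) + t c (f c x + tt_dif o1 a c y).
Proof.
degree_cases k a c; rewrite /= ?addr0 ?add0r ?subrr ?oppr0 ?addr0 //;
  try tt_zero.
  by rewrite sub0r.
by rewrite linearN opprK [LHS]addrAC subrr add0r.
Qed.

Lemma stalk_htpy2 k a c y : a = k + 1 -> c = k + 2 ->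
  - y = f a (t a y).
Proof. by degree_cases k a c; rewrite /= //; tt_zero. Qed.

Lemma cone_stalk_proj_reindex (phi : int -> int)
    (sq : forall i x, tt_dif o2 (phi (i + 1)) (phi (i + 1 + 1))
            (tt_dif o2 (phi i) (phi (i + 1)) x) = 0)
    (bd : exists N : int, forall i, N < `|i| ->
            forall x : tt_obj Q (fg_zero A) (phi i), x = 0) :
  phi = (fun i => i - n) ->
  diso (cone stalk_proj) (@Cplx A (fun i => tt_obj Q (fg_zero A) (phi i))
    (fun i => tt_dif o2 (phi i) (phi (i + 1))) sq bd).
Proof.
move=> phiE; subst phi; set W := Cplx _ _; pose C := cone stalk_proj.
have ea i : i + 1 - n = i - n + 1 by lia.
have ec i : i + 1 + 1 - n = i - n + 2 by lia.
pose s' i : {linear W i -> C i} := lin_pair (s (i - n) (i + 1 - n))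
  (\0 : {linear W i -> tt_obj P (fg_zero A) (i - n)}).
pose r i : {linear C i -> W i} := lin_copair (r1 (i - n) (i + 1 - n)) (r2 (i - n)).
have sP i x : s' (i + 1) (cdif W i x) = cdif C i (s' i x).
  apply: injective_projections; rewrite /= /cone_dif /=.
    exact: (stalk_incl_comm1 _ (ea i) (ec i)).
  by rewrite linear0 addr0; apply: (stalk_incl_comm2 _ (ea i) (ec i)).
have rP i x : r (i + 1) (cdif C i x) = cdif W i (r i x).
  by case: x => x y; apply: (stalk_retr_comm _ _ (ea i) (ec i)).
apply: diso_sym; apply: (@homotopy_equivalence_diso _ _ _ (CMap sP) (CMap rP)).
  apply: ceq_homotopic => i x /=.
  by rewrite linear0 addr0; apply: (stalk_retr_incl _ (ea i) (ec i)).
pose k i : {linear C (i + 1) -> C i} :=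
  lin_pair (t (i + 1 - n) \o snd : {linear C (i + 1) -> _}) (\0 : {linear C (i + 1) -> _}).
exists k => i [x y]; apply: injective_projections; rewrite /= /cone_dif /=.
  exact: (stalk_htpy1 _ _ (ea i) (ec i)).
by rewrite linear0 !addr0 sub0r; apply: (stalk_htpy2 _ (ea i) (ec i)).
Qed.

Lemma cone_stalk_proj_diso : diso (cone stalk_proj) (stalk n Q).
Proof. by apply: cone_stalk_proj_reindex. Qed.

End ConeProjection.

(** * The Brauer star algebra *)

Section StarAlgebra.
Variables (K : fieldType) (e m : nat) (xi : K) (b : falgType K) (x g : b).
Hypotheses (e_gt1 : (1 < e)%N) (m_gt0 : (0 < m)%N).
Hypotheses (xi_prim : e.-primitive_root xi) (star : star_algebra e m xi x g).

Local Notation f := (star_idem e xi g).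

Lemma star_unit_xi : xi != 0.
Proof.
apply/eqP => xi0; move: (prim_expr_order xi_prim).
by rewrite xi0 expr0n -[e]prednK ?(ltnW e_gt1) //= => /esym/eqP; rewrite oner_eq0.
Qed.

Lemma star_order_neq0 : e%:R != 0 :> K.
Proof. exact: (prim_root_natf_neq0 xi_prim). Qed.

Lemma star_comm : g * x = xi^-1 *: (x * g).
Proof.
have [_ ge gxg _] := star.
have gU : g \is a GRing.unit.
  by rewrite -(@unitrX_pos _ _ e) ?(ltnW e_gt1) // ge unitr1.
have := congr1 (fun y => xi^-1 *: (g * y)) gxg.
rewrite !mulrA divrr // mul1r -scalerAr scalerA mulVf ?star_unit_xi // scale1r.
by move=> ->.
Qed.

Lemma star_commX j : g ^+ j * x = xi ^- j *: (x * g ^+ j).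
Proof.
elim: j => [|j IH]; first by rewrite !expr0 invr1 scale1r mul1r mulr1.
rewrite exprSr -mulrA star_comm -scalerAr (mulrA (g ^+ j)) IH -scalerAl scalerA.
by rewrite -mulrA [in RHS]exprS invfM.
Qed.

(** Moving [x] past g^j costs xi^(-j), which changes the character xi^(-ij) into xi^(-(i+1)j). *)
Lemma star_idem_x i : f i * x = x * f i.+1.
Proof.
rewrite /star_idem -scalerAl -scalerAr mulr_suml mulr_sumr; congr (_ *: _).
apply: eq_bigr => j _; rewrite -scalerAl -scalerAr star_commX scalerA.
by rewrite -invfM -exprD mulSn addnC.
Qed.

Lemma star_idem_xk i k : f i * x ^+ k = x ^+ k * f (i + k)%N.
Proof.
elim: k i => [|k IH] i; first by rewrite addn0 mul1r mulr1.
by rewrite exprS mulrA star_idem_x -mulrA IH mulrA addSnnS.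
Qed.

(** Multiplication by [g] shifts the summation index cyclically; the term that wraps around is
    settled by g^e = 1 and xi^e = 1. *)
Lemma star_g_idem i : g * f i = xi ^+ i *: f i.
Proof.
have [_ ge _ _] := star.
rewrite /star_idem -scalerAr scalerA mulrC -scalerA; congr (_ *: _).
rewrite mulr_sumr scaler_sumr.
have e0 : (0 < e)%N by apply: ltnW.
case: e e0 ge xi_prim => // n _ ge xp.
rewrite big_ord_recr [RHS]big_ord_recl /= [RHS]addrC; congr (_ + _).
  apply: eq_bigr => j _; rewrite /bump /= add1n -scalerAr scalerA -exprS.
  congr (_ *: _); rewrite mulnS exprD invfM mulrA divff ?mul1r //.
  by rewrite expf_neq0 ?star_unit_xi.
rewrite muln0 invr1 expr0 -scalerAr -exprS ge scalerA mulr1; congr (_ *: _).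
apply: (mulIf (expf_neq0 (i * n) star_unit_xi)).
rewrite mulVf ?expf_neq0 ?star_unit_xi // -exprD -mulnS mulnC exprM.
by rewrite (prim_expr_order xp) expr1n.
Qed.

Lemma star_gX_idem i j : g ^+ j * f i = xi ^+ (i * j) *: f i.
Proof.
elim: j => [|j IH]; first by rewrite muln0 !expr0 mul1r scale1r.
rewrite exprSr -mulrA star_g_idem -scalerAr IH scalerA -exprD; congr (_ ^+ _ *: _).
by rewrite mulnS.
Qed.

(** By [star_gX_idem] the product is a geometric sum of the [e]-th root of unity [z], which vanishes
    unless [z] is 1. *)
Lemma star_idem_mul i j :
  f i * f j = if i == j %[mod e] then f j else 0.
Proof.
rewrite {1}/star_idem -scalerAl mulr_suml.
under eq_bigr => t _ do rewrite -scalerAl star_gX_idem scalerA !exprM -exprVn -exprMn.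
rewrite -scaler_suml; set z := _ * _.
have zE : (z == 1) = (i == j %[mod e]).
  rewrite /z -(eq_prim_root_expr xi_prim) -(inj_eq (mulfI (expf_neq0 i star_unit_xi))).
  by rewrite mulrA divff ?expf_neq0 ?star_unit_xi // mul1r mulr1 eq_sym.
have ze : z ^+ e = 1.
  by rewrite /z exprMn exprVn -!exprM ![(_ * e)%N]mulnC !exprM (prim_expr_order xi_prim) !expr1n invr1 mulr1.
rewrite -zE; have [->|z1] := eqVneq z 1.
  under eq_bigr do rewrite expr1n.
  by rewrite sumr_const card_ord scalerA mulVf ?scale1r ?star_order_neq0.
have : (z - 1) * (\sum_(t < e) z ^+ t) = 0 by rewrite -subrX1 ze subrr.
by move/eqP; rewrite mulf_eq0 subr_eq0 (negPf z1) /= => /eqP ->; rewrite scale0r scaler0.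
Qed.

Lemma star_idem_idem i : f i * f i = f i.
Proof. by rewrite star_idem_mul eqxx. Qed.

(** In the basis of the x^s g^t, the coefficient at x^k g^0 is the inverse of [e]. *)
Lemma star_xk_idem_neq0 k i : (k <= e * m)%N -> x ^+ k * f i != 0.
Proof.
move=> kem; have [_ _ _ bij] := star; have e0 : (0 < e)%N by apply: ltnW.
pose c : 'M[K]_((e * m).+1, e) := \matrix_(s, t)
  if s == inord k then e%:R^-1 * xi ^- (i * t) else 0.
apply/eqP => xf0.
have c0 : c = 0.
  apply: (bij_inj bij); rewrite [RHS]big1 => [|s _]; last first.
    by rewrite big1 // => t _; rewrite mxE scale0r.
  rewrite (bigD1 (inord k)) //= [X in _ + X]big1 ?addr0 => [|s sk]; last first.
    by rewrite big1 // => t _; rewrite mxE (negPf sk) scale0r.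
  rewrite -[RHS]xf0 /star_idem -scalerAr mulr_sumr scaler_sumr.
  apply: eq_bigr => t _; rewrite mxE eqxx inordK ?ltnS // -scalerAr scalerA //.
have := congr1 (fun M : 'M_(_, _) => M (inord k) (Ordinal e0)) c0.
rewrite !mxE eqxx muln0 expr0 invr1 mulr1 => /eqP.
by rewrite invr_eq0 (negPf star_order_neq0).
Qed.

Lemma star_mul_idem y j : exists c : 'I_(e * m).+1 -> K,
  y * f j = \sum_k c k *: (x ^+ k * f j).
Proof.
have [_ _ _ [c' _ cK]] := star; rewrite -[y]cK; move: (c' y) => c.
exists (fun k => \sum_t c k t * xi ^+ (j * t)); rewrite mulr_suml.
apply: eq_bigr => k _; rewrite mulr_suml scaler_suml.
by apply: eq_bigr => t _; rewrite -scalerAl -mulrA star_gX_idem -scalerAr scalerA.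
Qed.

(** The right ideal generated by x^n. By [xpow_comm] it is two-sided, the [n]-th power of the ideal
    generated by [x]; this is the filtration used for leading coefficients. *)
Definition xpow n (y : b) : Prop := exists z, y = x ^+ n * z.

Lemma xpow0 n : xpow n 0.
Proof. by exists 0; rewrite mulr0. Qed.

Lemma xpowD n y z : xpow n y -> xpow n z -> xpow n (y + z).
Proof. by move=> [y' ->] [z' ->]; exists (y' + z'); rewrite mulrDr. Qed.

Lemma xpowZ n a y : xpow n y -> xpow n (a *: y).
Proof. by move=> [y' ->]; exists (a *: y'); rewrite scalerAr. Qed.

Lemma xpow_sum n (I : finType) (P : pred I) (F : I -> b) :
  (forall i, P i -> xpow n (F i)) -> xpow n (\sum_(i | P i) F i).
Proof. by move=> FP; apply: big_ind => //; [apply: xpow0|apply: xpowD]. Qed.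

Lemma xpow_le n n' y : (n <= n')%N -> xpow n' y -> xpow n y.
Proof. by move=> le [z ->]; exists (x ^+ (n' - n) * z); rewrite mulrA -exprD subnKC. Qed.

Lemma xpowMr n y z : xpow n y -> xpow n (y * z).
Proof. by move=> [y' ->]; exists (y' * z); rewrite mulrA. Qed.

Lemma xpow_comm1 y : exists y', y * x = x * y'.
Proof.
have [_ _ _ [c' _ cK]] := star; rewrite -[y]cK; move: (c' y) => c.
suff h : xpow 1 ((\sum_k \sum_t c k t *: (x ^+ k * g ^+ t)) * x).
  by have [z zE] := h; exists z.
rewrite mulr_suml; apply: xpow_sum => k _; rewrite mulr_suml.
apply: xpow_sum => t _; rewrite -scalerAl -mulrA star_commX -scalerAr !mulrA -exprSr.
by do 2!apply: xpowZ; apply: xpowMr; exists (x ^+ k); rewrite exprS.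
Qed.

Lemma xpow_comm n y : exists y', y * x ^+ n = x ^+ n * y'.
Proof.
elim: n y => [|n IH] y; first by exists y; rewrite mulr1 mul1r.
have [y1 e1] := xpow_comm1 y; have [y2 e2] := IH y1; exists y2.
by rewrite exprS mulrA e1 -mulrA e2 mulrA.
Qed.

Lemma xpowM n n' y z : xpow n y -> xpow n' z -> xpow (n + n') (y * z).
Proof.
move=> [y' ->] [z' ->]; have [t tE] := xpow_comm n' y'; exists (t * z').
by rewrite mulrA -(mulrA _ y') tE exprD !mulrA.
Qed.

Lemma xpow_nil n y : (e * m < n)%N -> xpow n y -> y = 0.
Proof.
move=> en [z ->]; have [xe _ _ _] := star.
by rewrite -(subnK en) exprD xe mulr0 mul0r.
Qed.

(** Multiplying by x^(em-n) would put the nonzero element x^(em) f_j in the ideal of x^(em+1), which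
    is zero. *)
Lemma xpow_leading n j : (n <= e * m)%N -> ~ xpow n.+1 (x ^+ n * f j).
Proof.
move=> nem [z zE]; have := star_xk_idem_neq0 j (leqnn (e * m)).
rewrite -{1}(subnK nem) exprD -mulrA zE mulrA -exprD addnS subnK //.
by have [-> _ _ _] := star; rewrite mul0r eqxx.
Qed.

(** The corner is spanned by the x^k f_j with [k] congruent to [j - i] modulo [e]. The least such
    [k] is [j - i], and every other one is larger. *)
Lemma star_corner i j y : (0 < i <= e)%N -> (i <= j <= e)%N ->
  f i * y = y -> y * f j = y ->
  exists lam, xpow (j - i).+1 (y - lam *: (x ^+ (j - i) * f j)).
Proof.
move=> /andP[i0 ie] /andP[ij je] fy yf; have [c cE] := star_mul_idem y j.
have e0 : (0 < e)%N by apply: ltnW.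
have jiem : (j - i < (e * m).+1)%N.
  rewrite ltnS; apply: leq_trans (leq_subr _ _) _; apply: leq_trans je _.
  by rewrite leq_pmulr.
exists (c (Ordinal jiem)).
have -> : y = \sum_k c k *: (x ^+ k * (f (i + k)%N * f j)).
  rewrite -{1}fy -yf cE mulr_sumr; apply: eq_bigr => k _.
  by rewrite -scalerAr (mulrA (f i)) star_idem_xk -mulrA.
rewrite (bigD1 (Ordinal jiem)) //= subnKC // star_idem_idem addrAC subrr add0r.
apply: xpow_sum => k nk; apply: xpowZ; rewrite star_idem_mul.
case: ifPn => [/eqP ikj|_]; last by rewrite mulr0; apply: xpow0.
apply: xpow_le (xpowMr _ (ex_intro _ 1 (esym (mulr1 _)))).
rewrite ltn_neqAle eq_sym -val_eqE /= in nk *; rewrite nk /=.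
rewrite leqNgt; apply/negP => kji.
have : ((j - (i + k)) %% e = 0)%N.
  by apply/eqP; rewrite -/(dvdn _ _) -eqn_mod_dvd ?ikj //; lia.
by rewrite modn_small; lia.
Qed.

Local Notation P := (star_proj e xi g).

Definition star_gen i : P i := lideal_elem (f i) 1.

Lemma val_star_gen i : val (star_gen i) = f i.
Proof. by rewrite /= mul1r. Qed.

Lemma star_proj_idem i (v : P i) : val v * f i = val v.
Proof.
by case: v => v vP /=; have /asboolP[a ->] := vP; rewrite -mulrA star_idem_idem.
Qed.

(** Reduces module maps to right multiplications, hence to elements of the corner studied in
    [star_corner]. *)
Lemma star_proj_hom i j (h : {linear P i -> P j}) (v : P i) :
  val (h v) = val v * val (h (star_gen i)).
Proof.
suff {1}-> : v = (val v : b) *: star_gen i by rewrite linearZ.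
by apply: val_inj; rewrite /= mul1r; apply/esym/star_proj_idem.
Qed.

Lemma star_hom_idem i j (h : {linear P i -> P j}) :
  f i * val (h (star_gen i)) = val (h (star_gen i)).
Proof. by rewrite -{1}(val_star_gen i) -star_proj_hom. Qed.

Lemma star_homE i j (v : P i) : (0 < i)%N -> (i < j <= e)%N ->
  val (star_hom e xi x g i j v) = val v * (x ^+ (j - i) * f j).
Proof.
move=> i0 /andP[ij je]; rewrite /star_hom /lideal_hom /= /star_exp.
suff -> : ((j + (e - i)) %% e = j - i)%N by [].
have -> : (j + (e - i) = j - i + e)%N by lia.
by rewrite modnDr modn_small //; lia.
Qed.

Lemma star_hom_comp i j k (v : P i) : (0 < i < j)%N -> (j < k <= e)%N ->
  star_hom e xi x g j k (star_hom e xi x g i j v) = star_hom e xi x g i k v.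
Proof.
move=> /andP[i0 ij] /andP[jk ke]; apply: val_inj.
rewrite !star_homE; try lia.
rewrite -!mulrA (mulrA (f j)) star_idem_xk -(mulrA (x ^+ (k - j))).
rewrite subnKC ?(ltnW jk) // star_idem_idem (mulrA (x ^+ _)) -exprD.
by congr (_ * (_ ^+ _ * _)); lia.
Qed.

Lemma star_hom_xpow i j (h : {linear P i -> P j}) : (0 < i <= e)%N -> (i < j <= e)%N ->
  xpow (j - i) (val (h (star_gen i))).
Proof.
move=> ie /andP[ij je].
have [|lam] := star_corner ie _ (star_hom_idem h) (star_proj_idem _) (j := j).
  by rewrite (ltnW ij).
move=> /(xpow_le (leqnSn _)) /xpowD h1.
rewrite -[val _](subrK (lam *: (x ^+ (j - i) * f j))); apply: h1.
by apply: xpowZ; exists (f j).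
Qed.

(* An endomorphism with nonzero leading coefficient is invertible by the
   geometric series, since [xpow 1] consists of nilpotent elements. *)
Lemma star_end_bij j (h : {linear P j -> P j}) : (0 < j <= e)%N ->
  ~ xpow 1 (val (h (star_gen j))) -> bijective h.
Proof.
move=> je nh; set y := val _ in nh; have fy : f j * y = y := star_hom_idem h.
have yf : y * f j = y := star_proj_idem _.
have [|lam] := star_corner je _ fy yf; first by rewrite leqnn; case/andP: je.
rewrite subnn mul1r => ylam; have lam0 : lam != 0.
  by apply/eqP => l0; apply: nh; move: ylam; rewrite l0 scale0r subr0.
pose u := f j - lam^-1 *: y.
have uP : xpow 1 u.
  have -> : u = - lam^-1 *: (y - lam *: f j).
    by rewrite scalerBr scalerA mulNr mulVf // !scaleNr scale1r opprK addrC.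
  exact: xpowZ.
have uf : u * f j = u by rewrite mulrBl star_idem_idem -scalerAl yf.
have fu : f j * u = u by rewrite mulrBr star_idem_idem -scalerAr fy.
have un n : xpow n (u ^+ n).
  elim: n => [|n IH]; first by exists 1; rewrite mul1r.
  by rewrite exprS; apply: (xpowM uP IH).
pose N := (e * m).+1; have uN : u ^+ N = 0 by apply: (xpow_nil _ (un N)); rewrite ltnS.
pose S := \sum_(i < N) u ^+ i.
have yE : y = lam *: (f j - u) by rewrite /u subKr scalerA divff // scale1r.
have comm_f : GRing.comm (f j) S.
  apply: commr_sum => i _; apply: commrX; rewrite /GRing.comm uf fu //.
have SE : (1 - u) * S = 1.
  apply: oppr_inj; rewrite -mulNr opprB -subrX1 uN sub0r //.
have SE' : S * (1 - u) = 1.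
  suff cS : GRing.comm S (1 - u) by rewrite cS.
  apply/commr_sym/commr_sum => i _; apply: commrX; apply: commr_sym.
  by apply: commrB; [apply: commr1|].
pose y' := lam^-1 *: (f j * S).
have fuE : f j - u = f j * (1 - u) by rewrite mulrBr mulr1 fu.
have fuE' : f j - u = (1 - u) * f j by rewrite mulrBl mul1r uf.
have scaleM (s s' : K) (z z' : b) : (s *: z) * (s' *: z') = (s * s') *: (z * z').
  by rewrite -scalerAl -scalerAr scalerA.
have yy' : y * y' = f j.
  rewrite yE /y' scaleM divff // scale1r fuE' -mulrA.
  by rewrite (mulrA (f j) (f j)) star_idem_idem comm_f mulrA SE mul1r.
have y'y : y' * y = f j.
  rewrite yE /y' scaleM mulVf // scale1r fuE.
  by rewrite comm_f -mulrA (mulrA (f j) (f j)) star_idem_idem mulrA -comm_f -mulrA SE' mulr1.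
have y'f : y' * f j = y'.
  have -> : y' * f j = lam^-1 *: (f j * S * f j) by exact: esym (scalerAl _ _ _).
  by rewrite -mulrA -comm_f mulrA star_idem_idem.
pose k (v : P j) : P j := lideal_elem (f j) (val v * y').
have kE v : val (k v) = val v * y' by rewrite -[in RHS]y'f mulrA.
exists k => v; apply: val_inj.
  rewrite kE star_proj_hom -/y -mulrA yy'; exact: star_proj_idem.
rewrite star_proj_hom -/y kE -mulrA y'y; exact: star_proj_idem.
Qed.

(** If the generator went into the ideal of [x] under [q], the composite with [h] would be divisible
    by x^(j-i+1), and so would x^(j-i) f_j. *)
Lemma star_factor_bij i j (h : {linear P i -> P j}) (q : {linear P j -> P j}) :
  (0 < i <= e)%N -> (i < j <= e)%N ->
  xpow (j - i).+1 (x ^+ (j - i) * f j - val (q (h (star_gen i)))) ->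
  bijective q.
Proof.
move=> ie ije xqh; apply: star_end_bij; first by lia.
move=> xq; apply: (@xpow_leading (j - i) j).
  by apply: leq_trans (leq_subr _ _) _; apply: (@leq_trans e); [lia|rewrite leq_pmulr].
rewrite -[X in xpow _ X](subrK (val (q (h (star_gen i))))).
apply: xpowD => //; rewrite star_proj_hom -addn1.
exact: xpowM (star_hom_xpow h ie ije) xq.
Qed.

(** Pulling the generator back through [q0] writes x^(j-i) f_j as an image under [q1] of something
    divisible by x^(j-i); so [q1] cannot raise the power of [x]. *)
Lemma star_target_bij i j (q0 : {linear P i -> P i}) (q1 : {linear P j -> P j}) :
  (0 < i <= e)%N -> (i < j <= e)%N -> bijective q0 ->
  (forall v, q1 (star_hom e xi x g i j v) = star_hom e xi x g i j (q0 v)) ->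
  bijective q1.
Proof.
move=> ie ije [q0' _ q0K] qh; apply: star_end_bij; first by lia.
move=> xq; apply: (@xpow_leading (j - i) j).
  by apply: leq_trans (leq_subr _ _) _; apply: (@leq_trans e); [lia|rewrite leq_pmulr].
set v := q0' (star_gen i).
have i0 : (0 < i)%N by case/andP: ie.
have vE := star_homE v i0 ije; have gE := star_homE (star_gen i) i0 ije.
have -> : x ^+ (j - i) * f j = val v * (x ^+ (j - i) * f j) * val (q1 (star_gen j)).
  rewrite -vE -star_proj_hom qh /v q0K gE val_star_gen (mulrA (f i)) star_idem_xk.
  by rewrite subnKC -?mulrA ?star_idem_idem //; lia.
rewrite -addn1; apply: xpowM xq; have [t tE] := xpow_comm (j - i) (val v).
by exists (t * f j); rewrite [RHS]mulrA -tE -mulrA.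
Qed.

End StarAlgebra.

(** * Submodules *)

Section Submodules.
Variable A : nzRingType.
Implicit Types M S : lmodType A.

Lemma submodule_full M : submodule (@full _ M).
Proof. by []. Qed.

Lemma submodule_null M : submodule (@null _ M).
Proof. by split=> // a x y -> ->; rewrite /null scaler0 addr0. Qed.

Lemma submoduleB M (N : M -> Prop) x y : submodule N -> N x -> N y -> N (x - y).
Proof. by move=> [_ Nl] Nx Ny; rewrite addrC -scaleN1r; apply: Nl. Qed.

Lemma submoduleD M (N : M -> Prop) x y : submodule N -> N x -> N y -> N (x + y).
Proof. by move=> [_ Nl] Nx Ny; rewrite -[x]scale1r; apply: Nl. Qed.

Lemma submodule_meet M (N N' : M -> Prop) :
  submodule N -> submodule N' -> submodule (fun x => N x /\ N' x).
Proof.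
move=> [N0 Nl] [N'0 N'l]; split=> // a x y [? ?] [? ?].
by split; [apply: Nl|apply: N'l].
Qed.

Lemma submodule_rad M : submodule (@rad_mod _ M).
Proof.
split=> [N [[]]//|a x y rx ry N Nmax]; have [[_ Nl] _ _ _] := Nmax.
by apply: Nl; [apply: rx|apply: ry].
Qed.

Lemma submodule_soc M : submodule (@soc_mod _ M).
Proof.
split=> [N []//|a x y rx ry N Nsub Nsoc]; have [_ Nl] := Nsub.
by apply: Nl; [apply: rx|apply: ry].
Qed.

Lemma submodule_image M M' (N : M -> Prop) (f : M -> M') :
  submodule N -> f 0 = 0 ->
  (forall a x y, N x -> N y -> f (a *: x + y) = a *: f x + f y) ->
  submodule (fun z => exists2 x, N x & f x = z).
Proof.
move=> [N0 Nl] f0 fl; split; first by exists 0.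
by move=> a _ _ [x Nx <-] [y Ny <-]; exists (a *: x + y); rewrite ?fl //; apply: Nl.
Qed.

Lemma subquot_map0 M M' (N : M -> Prop) (f : M -> M') : N 0 ->
  (forall a x y, N x -> N y -> f (a *: x + y) = a *: f x + f y) -> f 0 = 0.
Proof.
move=> N0 fl; have := fl 1 0 0 N0 N0; rewrite !scale1r addr0.
by move/(congr1 (fun y => y - f 0)); rewrite subrr addrK.
Qed.

Lemma subquot_iso_maximal M (N N' : M -> Prop) S :
  simple_mod S -> submodule N -> submodule N' -> sub N' N ->
  subquot_iso N N' S -> maximal_in N N'.
Proof.
move=> [[s s0] Ssimp] sN sN' N'N [f [fl fs fk]]; split=> //.
  move=> NN'; apply: s0; have [x Nx <-] := fs s.
  exact/fk/NN'.
move=> N'' sN'' N'N'' N''N.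
have f0 := subquot_map0 (proj1 sN) fl.
have := Ssimp _ (submodule_image sN'' f0
  (fun a x y Nx Ny => fl a x y (N''N _ Nx) (N''N _ Ny))).
case=> fN''; last first.
  by left=> x N''x; apply/(fk _ (N''N _ N''x))/fN''; exists x.
right=> x Nx; have [y N''y fxy] := fN'' (f x) I.
have N'xy : N' (x - y).
  have Ny := N''N _ N''y.
  apply/fk; first exact: submoduleB.
  have -> : x - y = (-1) *: y + x by rewrite scaleN1r addrC.
  by rewrite fl // fxy scaleN1r addNr.
by rewrite -(subrK y x); apply: submoduleD => //; apply: N'N''.
Qed.

Lemma subquot_iso_unique M (N N' : M -> Prop) S S' :
  submodule N -> subquot_iso N N' S -> subquot_iso N N' S' -> iso_mod S S'.
Proof.
move=> sN [f [fl fs fk]] [f' [fl' fs' fk']].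
have eqf x y : N x -> N y -> f x = f y <-> f' x = f' y.
  move=> Nx Ny; have Nxy := submoduleB sN Nx Ny.
  have xyE : x - y = (-1) *: y + x by rewrite scaleN1r addrC.
  have fxy : f (x - y) = f x - f y by rewrite xyE fl // scaleN1r addrC.
  have fxy' : f' (x - y) = f' x - f' y by rewrite xyE fl' // scaleN1r addrC.
  split=> e; apply/eqP; rewrite -subr_eq0.
    by rewrite -fxy'; apply/eqP/(fk' _ Nxy)/(fk _ Nxy); rewrite fxy e subrr.
  by rewrite -fxy; apply/eqP/(fk _ Nxy)/(fk' _ Nxy); rewrite fxy' e subrr.
have lift s : exists x, N x /\ f x = s by have [x] := fs s; exists x.
pose l s := projT1 (boolp.cid (lift s)).
have lN s : N (l s) by rewrite /l; case: (boolp.cid _) => x [].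
have lE s : f (l s) = s by rewrite /l; case: (boolp.cid _) => x [].
have lin : linear (f' \o l).
  move=> a s t /=; rewrite -fl' //; apply/eqf => //.
    by case: sN => _; apply.
  by rewrite fl // !lE.
pose F := HB.pack (f' \o l) (GRing.isLinear.Build A S S' _ (f' \o l) lin)
  : {linear S -> S'}.
have inj : injective F by move=> s t /= /eqf; rewrite !lE; apply.
have surj t : exists s, F s = t.
  have [x Nx <-] := fs' t; exists (f x) => /=.
  by apply/eqf => //; rewrite lE.
pose G t := projT1 (boolp.cid (surj t)).
have GK t : F (G t) = t by rewrite /G; case: (boolp.cid _).
by exists F; exists G => // s; apply: inj.
Qed.

Lemma subquot_iso_eq M (N N' N1 N1' : M -> Prop) S :
  (forall x, N x <-> N1 x) -> (forall x, N' x <-> N1' x) ->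
  subquot_iso N N' S -> subquot_iso N1 N1' S.
Proof.
move=> NN1 N'N1' [f [fl fs fk]]; exists f; split.
- by move=> a x y /NN1 Nx /NN1 Ny; apply: fl.
- by move=> s; have [x /NN1 Nx] := fs s; exists x.
by move=> x /NN1 Nx; rewrite -N'N1'; apply: fk.
Qed.

Lemma projective_lideal (f : A) : f * f = f -> projective_mod (lideal f).
Proof.
move=> ff M N p h psurj; have [c cE] := psurj (h (lideal_elem f 1)).
exists (lideal_hom (f *: c) : {linear lideal f -> M}) => y.
have yE : y = (val y : A) *: lideal_elem f 1.
  apply: val_inj; rewrite /= mul1r; case: y => y yP /=.
  by have /asboolP[a ->] := yP; rewrite /GRing.scale /= -mulrA ff.
have hE : h y = (val y : A) *: h (lideal_elem f 1) by rewrite {1}yE linearZ.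
have fE : f *: h (lideal_elem f 1) = h (lideal_elem f 1).
  rewrite -linearZ; congr (h _); apply: val_inj.
  by rewrite /GRing.scale /= /GRing.scale /= mul1r ff.
by rewrite hE /lideal_hom /= !linearZ cE /= fE.
Qed.

End Submodules.

Section FiniteLength.
Variables (K : fieldType) (A : falgType K) (M : lmodType A).
Hypothesis Mfg : fingen M.

(* Submodules are measured by the dimension of their preimage in a free module. *)
Lemma submodule_measure : exists (mu : (M -> Prop) -> nat) (d : nat),
  [/\ forall N, (mu N <= d)%N,
      forall N N', sub N N' -> (mu N <= mu N')%N
    & forall N N', submodule N -> submodule N' -> sub N N' -> ~ sub N' N ->
        (mu N < mu N')%N].
Proof.
have [s sP] := Mfg; pose W : vectType K := {ffun 'I_(size s) -> A}.
pose Phi (r : W) := \sum_(i < size s) r i *: s`_i.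
have PhiS x : exists r, Phi r = x.
  have [c ->] := sP x; exists [ffun i : 'I_(size s) => c`_i].
  by apply: eq_bigr => i _; rewrite ffunE.
have PhiD (r t : W) : Phi (r + t) = Phi r + Phi t.
  by rewrite -big_split; apply: eq_bigr => i _; rewrite ffunE scalerDl.
have PhiZ a (r : W) : Phi (a *: r) = (a%:A : A) *: Phi r.
  by rewrite scaler_sumr; apply: eq_bigr => i _; rewrite ffunE scalerA mulr_algl.
have Phi0 : Phi 0 = 0 by rewrite /Phi big1 // => i _; rewrite ffunE scale0r.
pose in_N (N : M -> Prop) (Z : {vspace W}) := forall r, r \in Z -> N (Phi r).
(* The clause [k = 0] keeps the set of dimensions nonempty for a predicate [N] that misses 0. *)
pose P N k := `[< k = 0%N \/ exists2 Z, in_N N Z & \dim Z = k >].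
have P0 N : exists k, P N k by exists 0%N; apply/asboolP; left.
have Pd N k : P N k -> (k <= \dim {:W})%N.
  by move=> /asboolP[->//|[Z _ <-]]; apply/dimvS/subvf.
pose mu N := ex_maxn (P0 N) (@Pd N); exists mu, (\dim {:W}); split.
- by move=> N; rewrite /mu; case: ex_maxnP => k /Pd.
- move=> N N' NN'; rewrite /mu; case: ex_maxnP => k kP _; case: ex_maxnP => k' _.
  apply; move: kP => /asboolP kP; apply/asboolP; case: kP => [|[Z ZN Zk]]; first by left.
  by right; exists Z => // r /ZN /NN'.
move=> N N' sN sN' NN' N'N.
have /existsNP[y /not_implyP[N'y nNy]] := N'N; have [r rE] := PhiS y.
rewrite /mu; case: ex_maxnP => k kP _; case: ex_maxnP => k' _; apply.
apply/asboolP; right.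
have [Z ZN <-] : exists2 Z, in_N N Z & \dim Z = k.
  move: kP => /asboolP[->|//]; exists 0%VS; last by rewrite dimv0.
  by move=> t; rewrite memv0 => /eqP ->; rewrite Phi0; case: sN.
have rZ : r \notin Z by apply/negP => /ZN; rewrite rE.
have r0 : r != 0 by apply: contraNneq rZ => ->; rewrite mem0v.
(* Strictness: adjoining a preimage [r] of an element of [N'] outside [N] raises the dimension by
   one. *)
exists (Z + <[r]>)%VS.
  move=> _ /memv_addP[t tZ [_ /vlineP[a ->] ->]]; rewrite PhiD PhiZ rE addrC.
  by case: sN' => _; apply=> //; apply/NN'/ZN.
rewrite dimv_disjoint_sum ?dim_vline ?r0 ?addn1 //.
apply/eqP; rewrite -subv0; apply/subvP => t /memv_capP[tZ /vlineP[a ta]].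
rewrite memv0 ta scaler_eq0; apply/orP; left; apply: contraR rZ => a0.
by rewrite -[r]scale1r -(mulVf a0) -scalerA -ta memvZ.
Qed.

Lemma exists_maximal (L : M -> Prop) :
  submodule L -> ~ sub (@full _ M) L ->
  exists L', maximal_in (@full _ M) L' /\ sub L L'.
Proof.
have [mu [d [mud mu_le mu_lt]]] := submodule_measure.
have [k] := ubnP (d - mu L)%N; elim: k L => // k IH L kL sL Lfull.
have [Lmax|] := pselect (maximal_in (@full _ M) L); first by exists L; split.
move=> nmax.
have [N'' [sN'' [LN'' [N''L fN'']]]] : exists N'', submodule N'' /\ sub L N'' /\
    ~ sub N'' L /\ ~ sub (@full _ M) N''.
  apply: contrapT => noN; apply: nmax; split=> // N'' sN'' LN'' _.
  have [?|nL] := pselect (sub N'' L); first by left.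
  have [?|nf] := pselect (sub (@full _ M) N''); first by right.
  by case: noN; exists N''.
have [|L' [L'max N''L']] := IH N'' _ sN'' fN''.
  by have := mu_lt _ _ sL sN'' LN'' N''L; have := mud N''; lia.
by exists L'; split=> // x /LN''/N''L'.
Qed.

Lemma exists_minimal (L : M -> Prop) :
  submodule L -> ~ sub L (@null _ M) ->
  exists L', maximal_in L' (@null _ M) /\ submodule L' /\ sub L' L.
Proof.
have [mu [d [mud mu_le mu_lt]]] := submodule_measure.
have [k] := ubnP (mu L)%N; elim: k L => // k IH L kL sL Lnull.
have [Lmin|nmin] := pselect (maximal_in L (@null _ M)).
  by exists L; split=> //; split.
have [N'' [sN'' [N''L [LN'' nN'']]]] : exists N'', submodule N'' /\ sub N'' L /\
    ~ sub L N'' /\ ~ sub N'' (@null _ M).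
  apply: contrapT => noN; apply: nmin; split=> //.
  - exact: submodule_null.
  - by move=> x ->; case: sL.
  move=> N'' sN'' _ N''L.
  have [?|nL] := pselect (sub N'' (@null _ M)); first by left.
  have [?|nf] := pselect (sub L N''); first by right.
  by case: noN; exists N''.
have [|L' [L'min [sL' L'N'']]] := IH N'' _ sN'' nN''.
  by have := mu_lt _ _ sN'' sL N''L LN''; lia.
by exists L'; split=> //; split=> // x /L'N''/N''L.
Qed.

End FiniteLength.

Section LocalModules.
Variables (K : fieldType) (A : falgType K).
Implicit Types S U : lmodType A.

(** A proper submodule of a finitely generated module lies in a maximal one, and a simple top makes
    the radical the only maximal submodule. *)
Lemma local_submodule (M : fgmod A) S (L : M -> Prop) :
  simple_mod S -> subquot_iso (@full _ M) (@rad_mod _ M) S -> submodule L ->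
  sub L (@rad_mod _ M) \/ sub (@full _ M) L.
Proof.
move=> simpS topS sL; have [?|nL] := pselect (sub (@full _ M) L); first by right.
left; have [L' [L'max LL']] := exists_maximal (fgmodP M) sL nL.
have [_ _ _ radmax] :=
  subquot_iso_maximal simpS (submodule_full M) (submodule_rad M) (fun _ _ => I) topS.
have [sL' _ nL' _] := L'max.
have [L'r|//] := radmax L' sL' (fun y ry => ry _ L'max) (fun _ _ => I).
by move=> y /LL'/L'r.
Qed.

(** Nakayama's lemma: an image that covers [Q] modulo its radical lies in no maximal submodule. *)
Lemma surjection_of_rad_kernel (M : lmodType A) (Q : fgmod A) (alpha : {linear M -> Q}) :
  (forall q, exists v, @rad_mod _ Q (q - alpha v)) ->
  forall q, exists v, alpha v = q.
Proof.
move=> arad; pose L (q : Q) := exists v, alpha v = q.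
have sL : submodule L.
  split; first by exists 0; rewrite linear0.
  by move=> a _ _ [v <-] [v' <-]; exists (a *: v + v'); rewrite linearP.
have [Lq q|nL] := pselect (sub (@full _ Q) L); first exact: Lq.
have [L' [L'max LL']] := exists_maximal (fgmodP Q) sL nL.
have [sL' _ nf _] := L'max; case: nf => q _; have [v rv] := arad q.
rewrite -(subrK (alpha v) q); apply: submoduleD => //; first exact: rv.
by apply: LL'; exists v.
Qed.

(** The surjection splits. If the image of the section were proper, it and the kernel would both lie
    in the radical of the local module [M], although they span [M]. *)
Lemma local_projective_iso (M Q : fgmod A) S (alpha : {linear M -> Q}) :
  simple_mod S -> subquot_iso (@full _ M) (@rad_mod _ M) S ->
  projective_mod Q -> (exists q : Q, q <> 0) ->
  (forall q, exists v, alpha v = q) -> bijective alpha.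
Proof.
move=> simpS topS Qproj [q0 q00] asurj.
have [s sK] := Qproj _ _ alpha (idfun : {linear Q -> Q}) asurj.
pose L (v : M) := exists q, s q = v.
have sL : submodule L.
  split; first by exists 0; rewrite linear0.
  by move=> a _ _ [v <-] [v' <-]; exists (a *: v + v'); rewrite linearP.
have sker : submodule (fun v => alpha v = 0).
  split; first by rewrite linear0.
  by move=> a v v' av av'; rewrite linearP av av' scaler0 addr0.
have Lfull : sub (@full _ M) L.
  have [kerr|kerf] := local_submodule simpS topS sker; last first.
    by have [v av] := asurj q0; case: q00; rewrite -av; apply: kerf.
  have [Lr|//] := local_submodule simpS topS sL.
  have [_ _ nfull _] := subquot_iso_maximal simpS (submodule_full M)
    (submodule_rad M) (fun _ _ => I) topS.
  case: nfull => v _; rewrite -(subrK (s (alpha v)) v).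
  apply: (submoduleD (submodule_rad M)).
    by apply: kerr; rewrite linearB sK /= subrr.
  by apply: Lr; exists (alpha v).
exists s => v; last exact: sK.
by have [q <-] := Lfull v I; rewrite sK.
Qed.

End LocalModules.

(** * The presentation attached to a leaf *)

Section MutationSource.
Variables (K : fieldType) (V E : finType) (e m : nat) (A : falgType K).
Variables (B : brauer_tree V E e m) (D : brauer_tree_algebra A B).
Variables (w : E) (x u : V).
Hypotheses (w_ends : ends B w = [set x; u]) (x_lone : lone B x) (x_exc : x != exc B).
Hypotheses (u_deg : (1 < #|edges_at B u|)%N) (c_neq : prev B u w != w).

Local Notation c := (prev B u w).
Local Notation P := (bt_proj D w).

Lemma lone_clockwise : clockwise B x w = [::].
Proof. by rewrite /clockwise (negPf x_exc) (eqP x_lone). Qed.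

Lemma clockwise_cons : exists s, clockwise B u w = c :: s.
Proof.
rewrite /clockwise; set n := (_ * _).-1%N.
have : (0 < n)%N.
  rewrite /n; case: ifP => _; last by rewrite mul1n; lia.
  by have := mult_gt0 B; nia.
by case: n => // n _ /=; eexists.
Qed.

Lemma composition_factors_nil (U : lmodType A) :
  composition_factors U [::] -> forall y : U, y = 0.
Proof. by move=> [N [_ N0 Nn _ _]] y; apply/Nn/N0. Qed.

Lemma composition_factors_cons (U S : lmodType A) s :
  composition_factors U (S :: s) ->
  exists N1 : U -> Prop, submodule N1 /\ subquot_iso (@full _ U) N1 S.
Proof.
move=> [N [Nsub N0 _ _ Niso]]; exists (N 1%N); split; first exact: Nsub.
by apply: subquot_iso_eq (Niso 0%N isT) => // y; split.
Qed.

(** Around the lone vertex [x] no edge is met, so that summand of the heart vanishes; the other one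
    has top the simple of the first edge clockwise after [w] at [u]. The order of the two vertices
    in [bt_heart] is unspecified, whence two symmetric cases. *)
Lemma leaf_heart : exists U : lmodType A,
  [/\ subquot_iso (@rad_mod _ P) (@soc_mod _ P) U, uniserial U
    & exists N1 : U -> Prop, submodule N1 /\ subquot_iso (@full _ U) N1 (bt_simple D c)].
Proof.
have [u1 [u2 [U1 [U2 [wE [phi [phil phis phik]] [un1 un2] cf1 cf2]]]]] := bt_heart D w.
have x_u : x != u.
  apply/eqP => xu; have := card_ends B w.
  by rewrite w_ends xu setUid cards1.
have [s sE] := clockwise_cons.
have [[e1 e2]|[e1 e2]] : (u1 = x /\ u2 = u) \/ (u1 = u /\ u2 = x).
  have : x \in [set u1; u2] by rewrite -wE w_ends !inE eqxx.
  have : u \in [set u1; u2] by rewrite -wE w_ends !inE eqxx orbT.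
  rewrite !inE => /orP[]/eqP ue /orP[]/eqP xe; subst; rewrite ?eqxx // in x_u *.
    by right.
  by left.
- have U10 : forall y : U1, y = 0.
    by apply: composition_factors_nil; move: cf1; rewrite e1 lone_clockwise.
  exists U2; split=> //; last first.
    by move: cf2; rewrite e2 sE; apply: composition_factors_cons.
  exists (snd \o phi); split.
  + by move=> a y z ry rz /=; rewrite phil.
  + by move=> t; have [y ry yE] := phis (0, t); exists y; rewrite //= yE.
  move=> y ry /=; rewrite -(phik y ry); split=> [y0|->//].
  by apply: injective_projections => //=; apply: U10.
have U20 : forall y : U2, y = 0.
  by apply: composition_factors_nil; move: cf2; rewrite e2 lone_clockwise.
exists U1; split=> //; last first.
  by move: cf1; rewrite e1 sE; apply: composition_factors_cons.
exists (fst \o phi); split.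
- by move=> a y z ry rz /=; rewrite phil.
- by move=> t; have [y ry yE] := phis (t, 0); exists y; rewrite //= yE.
move=> y ry /=; rewrite -(phik y ry); split=> [y0|->//].
by apply: injective_projections => //=; apply: U20.
Qed.

(* [M1] is the largest proper submodule of the radical of [P]. *)
Lemma leaf_rad : exists M1 : P -> Prop,
  [/\ submodule M1, sub M1 (@rad_mod _ P), subquot_iso (@rad_mod _ P) M1 (bt_simple D c)
    & forall L, submodule L -> sub L (@rad_mod _ P) -> ~ sub L M1 ->
        sub (@rad_mod _ P) L].
Proof.
have [U [[phi [phil phis phik]] Uun [N1 [sN1 [f [fl fs fk]]]]]] := leaf_heart.
have [r0 rl] := submodule_rad P; have [s0 sl] := submodule_soc P.
have N1iso : subquot_iso (@full _ U) N1 (bt_simple D c) by exists f.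
have [_ _ nN1 _] := subquot_iso_maximal (bt_simpleP D c) (submodule_full U) sN1
  (fun _ _ => I) N1iso.
have phi0 := subquot_map0 r0 phil.
exists (fun y => @rad_mod _ P y /\ N1 (phi y)); split.
- split; first by rewrite phi0; split=> //; case: sN1.
  move=> a y z [ry Ny] [rz Nz]; split; first exact: rl.
  by rewrite phil //; case: sN1 => _; apply.
- by move=> y [].
- exists (f \o phi); split.
  + by move=> a y z ry rz /=; rewrite phil // fl.
  + by move=> t; have [z _ <-] := fs t; have [y ry <-] := phis z; exists y.
  by move=> y ry /=; rewrite fk //; split=> [|[]].
move=> L sL Lr LM1.
have sphiL := submodule_image sL phi0
  (fun a y z Ly Lz => phil a y z (Lr _ Ly) (Lr _ Lz)).
have [phiN1|N1phi] := Uun _ _ sphiL sN1.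
  case: LM1 => y Ly; split; first exact: Lr.
  by apply: phiN1; exists y.
have [_ _ _ N1max] := subquot_iso_maximal (bt_simpleP D c) (submodule_full U) sN1
  (fun _ _ => I) N1iso.
have [phiN1|phifull] := N1max _ sphiL N1phi (fun _ _ => I).
  case: LM1 => y Ly; split; first exact: Lr.
  by apply: phiN1; exists y.
(* [L] already maps onto the heart [U], so it remains to contain the kernel. The socle of [P] is
   simple and meets every nonzero submodule, hence lies in [L]. *)
suff socL : sub (@soc_mod _ P) L.
  move=> y ry; have [z Lz zE] := phifull (phi y) I.
  rewrite -(subrK z y); apply: submoduleD => //; apply: socL.
  have rz := Lr _ Lz; apply/phik; first exact: submoduleB (submodule_rad P) ry rz.
  have -> : y - z = (-1) *: z + y by rewrite scaleN1r addrC.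
  by rewrite phil // zE scaleN1r addNr.
have [_ _ _ socmin] := subquot_iso_maximal (bt_simpleP D w) (submodule_soc P)
  (submodule_null P) (fun y (y0 : y = 0) => eq_ind_r _ s0 y0) (bt_soc D w).
have Lnull : ~ sub L (@null _ P).
  move=> Lnull; apply: LM1 => y /Lnull ->; split=> //.
  by rewrite phi0; case: sN1.
have [L1 [L1min [sL1 L1L]]] := exists_minimal (fgmodP P) sL Lnull.
have [||L0|socL] := socmin _ (submodule_meet (submodule_soc P) sL).
- by move=> y ->; split=> //; case: sL.
- by move=> y [].
- have [_ _ nL1 _] := L1min; case: nL1 => y Ly; apply: L0; split; last exact: L1L.
  by move=> N _ Nsoc; apply: (Nsoc _ sL1 L1min).
by move=> y /socL[].
Qed.

(** Here [N] is the radical of [P]: it is contained in it because the top is the simple of [w], and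
    a smaller [N] would make the simple of [c], the top of the radical, a factor of [P / N]. So [Q]
    covers a module with simple top indexed by [c]. *)
Lemma mutation_source (Q : fgmod A) (pi : {linear Q -> P}) :
  mutation_presentation pi (bt_simple D w) ->
  projective_mod Q /\ exists alpha : {linear bt_proj D c -> Q}, bijective alpha.
Proof.
move=> [N [[sN Nfac] Nmin Qproj Npi pirad]]; split=> //.
have [M1 [sM1 M1r M1iso M1sup]] := leaf_rad.
have Nr : sub N (@rad_mod _ P).
  apply: Nmin; first exact: submodule_rad.
  move=> N1 N2 sN1 rN2 [sN2 N2N1 nN1 _].
  have [N2r|N2f] := local_submodule (M := P) (bt_simpleP D w) (bt_top D w) sN2; last first.
    by case: nN1 => y _; apply: N2f.
  have [N1r|N1f] := local_submodule (M := P) (bt_simpleP D w) (bt_top D w) sN1.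
    by case: nN1 => y /N1r/rN2.
  apply: subquot_iso_eq (bt_top D w) => y; split=> //.
  - by move=> _; apply: N1f.
  - exact: rN2.
  exact: N2r.
have rN : sub (@rad_mod _ P) N.
  apply: M1sup => // NM1.
  have M1max := subquot_iso_maximal (bt_simpleP D c) (submodule_rad P) sM1 M1r M1iso.
  have M1w := Nfac _ _ (submodule_rad P) NM1 M1max.
  have := bt_simple_inj (subquot_iso_unique (submodule_rad P) M1iso M1w).
  by move/eqP; rewrite (negPf c_neq).
have [psi [psil psis psik]] := M1iso; have [top [topl tops topk]] := bt_top D c.
have pir q : @rad_mod _ P (pi q) by apply: Nr; apply/Npi; exists q.
have top_lin : linear top by move=> a y z; apply: topl.
have psipi_lin : linear (psi \o pi) by move=> a y z /=; rewrite linearP psil.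
pose top' := HB.pack top
  (GRing.isLinear.Build A (bt_proj D c) (bt_simple D c) _ top top_lin)
  : {linear bt_proj D c -> bt_simple D c}.
pose psipi := HB.pack (psi \o pi)
  (GRing.isLinear.Build A Q (bt_simple D c) _ (psi \o pi) psipi_lin)
  : {linear Q -> bt_simple D c}.
have Pproj : projective_mod (bt_proj D c).
  by apply: projective_lideal; rewrite bt_idem_mul eqxx.
have [t|alpha alphaE] := Pproj _ _ psipi top'.
  have [y ry <-] := psis t; have /Npi[q <-] := rN _ ry.
  by exists q.
exists alpha.
have [[s s0] _] := bt_simpleP D c.
apply: (local_projective_iso (M := bt_proj D c) (bt_simpleP D c) (bt_top D c) Qproj).
  have [y ry yE] := psis s; have /Npi[q qE] := rN _ ry; exists q => q0; apply: s0.
  by rewrite -yE -qE q0 linear0 (subquot_map0 _ psil) //; case: (submodule_rad P).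
apply: surjection_of_rad_kernel => q.
pose L (y : P) := exists v, pi (alpha v) = y.
have sL : submodule L.
  split; first by exists 0; rewrite !linear0.
  by move=> a _ _ [v <-] [v' <-]; exists (a *: v + v'); rewrite !linearP.
have [||v vE] := M1sup L sL _ _ (pi q) (pir q).
- by move=> _ [v <-].
- move=> LM1; have [v _ vE] := tops s; apply: s0; rewrite -vE.
  have := alphaE v; rewrite /= => <-.
  by apply/psik => //; apply: LM1; exists v.
by exists v; apply: pirad; rewrite linearB vE subrr.
Qed.

End MutationSource.

(** * Paths in a Brauer tree *)

Lemma first_common (E : eqType) (s t : seq E) : has (mem t) s ->
  exists c s1 s2 t1 t2,
    [/\ s = s1 ++ c :: s2, t = t1 ++ c :: t2 & ~~ has (mem t) s1].
Proof.
case/split_find => c s1 s2 ct ns1.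
have := ct; rewrite /= => ct'; case/splitPr: ct' ns1 => t1 t2 ns1.
by exists c, s1, s2, t1, t2; split=> //; rewrite cat_rcons.
Qed.

Section TreePaths.
Variables (V E : finType) (e m : nat) (B : brauer_tree V E e m).
Implicit Types (x y z u : V) (a b c w : E) (s t : seq E).

Local Notation ends := (ends B).
Local Notation other := (other ends).
Local Notation next := (next B).
Local Notation prev := (prev B).
Local Notation vpath := (vpath B).
Local Notation exc := (exc B).
Local Notation far := (far B).

Lemma ends_other a x : x \in ends a ->
  other a x != x /\ ends a = [set x; other a x].
Proof.
move=> xa; have /eqP/cards2P[p [q [pq aE]]] := card_ends B a.
rewrite /Defs.other; case: pickP => [y /andP[ya yx]|none] /=; last first.
  have := none p; have := none q; move: xa; rewrite aE !inE !eqxx orbT /=.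
  by case/orP => /eqP ->; rewrite ?eqxx eq_sym ?(negPf pq) // eq_sym (negPf pq).
split=> //; apply/eqP; rewrite eq_sym eqEcard cards2 card_ends eq_sym yx andbT.
by apply/subsetP => z; rewrite !inE => /orP[]/eqP ->.
Qed.

Lemma other_in a x : x \in ends a -> other a x \in ends a.
Proof. by move=> /ends_other[_ ->]; rewrite !inE eqxx orbT. Qed.

Lemma other_neq a x : x \in ends a -> other a x != x.
Proof. by move=> /ends_other[]. Qed.

Lemma other_eq a x y : x \in ends a -> y \in ends a -> y != x -> y = other a x.
Proof.
by move=> /ends_other[_ ->]; rewrite !inE => /orP[]/eqP -> //; rewrite eqxx.
Qed.

Lemma otherK a x : x \in ends a -> other a (other a x) = x.
Proof.
move=> xa; apply/esym/other_eq => //; first exact: other_in.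
by rewrite eq_sym other_neq.
Qed.

Lemma ends_cases a x y : x \in ends a -> y \in ends a -> y = x \/ y = other a x.
Proof. by move=> xa ya; have [->|/other_eq] := eqVneq y x; [left|right; auto]. Qed.

Local Notation walk := (walk ends).

Lemma walk_cat x s t y : walk x (s ++ t) y = [exists z, walk x s z && walk z t y].
Proof.
elim: s x => [|a s IH] x /=.
  apply/idP/existsP => [xty|[z /andP[/eqP ->]]//]; by exists x; rewrite eqxx.
rewrite IH; apply/andP/existsP => [[xa /existsP[z /andP[sz tz]]]|[z]].
  by exists z; rewrite xa sz.
by move=> /andP[/andP[xa sz] tz]; split=> //; apply/existsP; exists z; rewrite sz.
Qed.

Lemma walk_catI x s t y z : walk x s z -> walk z t y -> walk x (s ++ t) y.
Proof. by move=> sz ty; rewrite walk_cat; apply/existsP; exists z; rewrite sz. Qed.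

Lemma walk_rev x s y : walk x s y -> walk y (rev s) x.
Proof.
elim: s x => [|a s IH] x /=; first by rewrite eq_sym.
move=> /andP[xa /IH sx]; rewrite rev_cons -cats1; apply: walk_catI sx _ => /=.
by rewrite other_in // otherK // eqxx.
Qed.

Lemma disjoint_walks x y s t : uniq s -> uniq t -> ~~ has (mem s) t ->
  walk x s y -> walk x t y -> s = [::] /\ t = [::].
Proof.
move=> us ut st sy ty; have : s ++ rev t = [::].
  apply: (@tree_acyclic _ _ _ _ B x); last exact: walk_catI sy (walk_rev ty).
  by rewrite cat_uniq us rev_uniq ut andbT has_rev.
case: s us st sy => //=; case: t ut ty => // a t _ _ _ _ _ /eqP.
by rewrite rev_cons -size_eq0 size_rcons.
Qed.

(** Two walks with different first edges close up to a circuit at the first edge [c] of [s] that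
    also lies on [t]. *)
Lemma uniq_walk_unique x y s t :
  uniq s -> uniq t -> walk x s y -> walk x t y -> s = t.
Proof.
elim: s x t => [|a s IH] x t us ut.
  by move=> /eqP <- ty; apply/esym/(@tree_acyclic _ _ _ _ B x).
case: t ut => [|b t] ut sy ty.
  by move: ty sy => /= /eqP <- sy; apply: (@tree_acyclic _ _ _ _ B x).
have [ab|ab] := eqVneq a b.
  move: sy ty us ut; rewrite -ab /= => /andP[_ sy] /andP[_ ty] /andP[_ us] /andP[_ ut].
  by rewrite (IH _ _ us ut sy ty).
have [hs|ns] := boolP (has (mem (b :: t)) (a :: s)); last first.
  suff : ~~ has (mem (a :: s)) (b :: t) by move=> nst; have [] := disjoint_walks us ut nst sy ty.
  apply: contra ns => /hasP[c ct cs]; by apply/hasP; exists c.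
have [c [s1 [s2 [t1 [t2 [sE tE ns1]]]]]] := first_common hs.
have [us1 cs1] : uniq s1 /\ c \notin s1.
  by move: us; rewrite sE -cat_rcons cat_uniq rcons_uniq => /andP[/andP[]].
have [ut1 ct1] : uniq t1 /\ c \notin t1.
  by move: ut; rewrite tE -cat_rcons cat_uniq rcons_uniq => /andP[/andP[]].
have nst1 : ~~ has (mem s1) t1.
  apply: contra ns1 => /hasP[d dt ds]; apply/hasP; exists d => //=.
  by rewrite tE mem_cat dt.
move: sy ty; rewrite sE tE !walk_cat => /existsP[p /andP[s1p /= /andP[pc _]]].
move=> /existsP[q /andP[t1q /= /andP[qc _]]].
(* If both walks enter [c] at the same end, the circuit consists of the parts before [c]; otherwise
   [c] itself belongs to it. *)
have [qp|qp] := ends_cases pc qc.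
  rewrite qp in t1q; have [s10 t10] := disjoint_walks us1 ut1 nst1 s1p t1q.
  by move: ab; rewrite -[a]/(head a (a :: s)) -[b]/(head a (b :: t)) sE tE s10 t10 eqxx.
have [|||] := @disjoint_walks x q (rcons s1 c) t1 _ ut1 _ _ t1q.
- by rewrite rcons_uniq cs1.
- apply/hasP => -[d dt]; rewrite /= mem_rcons inE => /orP[/eqP dc|ds].
    by rewrite -dc dt in ct1.
  by case/hasP: nst1; exists d.
- by rewrite -cats1; apply: walk_catI s1p _; rewrite /= pc qp eqxx.
by case: (s1).
Qed.

Lemma vpath_uniq u : uniq (vpath u).
Proof. by have /andP[] := xchooseP (tree_connected B u exc). Qed.

Lemma vpath_walk u : walk u (vpath u) exc.
Proof. by have /andP[] := xchooseP (tree_connected B u exc). Qed.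

Lemma vpath_unique u s : uniq s -> walk u s exc -> s = vpath u.
Proof. by move=> us su; apply: uniq_walk_unique us (vpath_uniq u) su (vpath_walk u). Qed.

Lemma vpath_exc : vpath exc = [::].
Proof. by apply/esym/vpath_unique => //=; rewrite eqxx. Qed.

Lemma vpath_nil u : vpath u = [::] -> u = exc.
Proof. by have := vpath_walk u => + uE; rewrite uE /= => /eqP. Qed.

Lemma vpath_cons u a s : vpath u = a :: s -> u \in ends a /\ s = vpath (other a u).
Proof.
have := vpath_walk u; have := vpath_uniq u => + + uE; rewrite uE /=.
by move=> /andP[_ us] /andP[ua su]; split=> //; apply: vpath_unique.
Qed.

(** Either [a] lies on the path from [u], and then acyclicity makes it the first edge, or it can be
    prepended to that path. *)
Lemma vpath_edge a u : u \in ends a ->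
  vpath u = a :: vpath (other a u) \/ vpath (other a u) = a :: vpath u.
Proof.
move=> ua; have [au|au] := boolP (a \in vpath u); last first.
  right; apply/esym/vpath_unique; rewrite /= ?au ?vpath_uniq //.
  by rewrite other_in // otherK // vpath_walk.
have [s1 [s2 pE]] : exists s1 s2, vpath u = s1 ++ a :: s2.
  by case/splitPr: au => s1 s2; exists s1, s2.
left; have := vpath_walk u; have := vpath_uniq u; rewrite pE.
rewrite -cat_rcons cat_uniq => /andP[us1 _]; rewrite cat_rcons walk_cat.
move=> /existsP[z /andP[s1z /= /andP[za s2e]]].
move: us1; rewrite rcons_uniq => /andP[as1 us1].
have [zu|zu] := ends_cases ua za.
  have s10 : s1 = [::] by apply: (@tree_acyclic _ _ _ _ B u); rewrite // -{2}zu.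
  by move: pE; rewrite s10 /= => /vpath_cons[_ <-].
have : a :: s1 = [::].
  apply: (@tree_acyclic _ _ _ _ B z); rewrite /= ?as1 //.
  by rewrite za zu otherK // -zu.
by [].
Qed.

Lemma far_eq u a : u \in ends a -> vpath u = a :: vpath (other a u) -> far a = u.
Proof.
move=> ua uE; rewrite /Defs.far; case: pickP => [x /andP[xa]|none] /=.
  have [-> //|->] := ends_cases ua xa.
  by rewrite otherK // /dist uE /= ltnNge leqnSn.
by have := none u; rewrite ua /dist uE /= leqnn.
Qed.

Definition near a := other a (far a).

Lemma far_spec a : far a \in ends a /\ vpath (far a) = a :: vpath (near a).
Proof.
have /set0Pn[x xa] : ends a != set0 by rewrite -card_gt0 card_ends.
rewrite /near; have [xE|xE] := vpath_edge xa; first by rewrite (far_eq xa xE).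
rewrite (far_eq (other_in xa)); first by rewrite other_in // otherK.
by rewrite otherK.
Qed.

Lemma far_ends a : far a \in ends a. Proof. by have [] := far_spec a. Qed.

Lemma near_ends a : near a \in ends a.
Proof. exact/other_in/far_ends. Qed.

Lemma vpath_far a : vpath (far a) = a :: vpath (near a).
Proof. by have [] := far_spec a. Qed.

Lemma other_near a : other a (near a) = far a.
Proof. exact/otherK/far_ends. Qed.

Lemma near_neq_far a : near a != far a.
Proof. exact/other_neq/far_ends. Qed.

Lemma far_or_near a u : u \in ends a -> u = far a \/ u = near a.
Proof. exact/ends_cases/far_ends. Qed.

Lemma far_inj : injective far.
Proof. by move=> a b ab; have := vpath_far a; rewrite ab vpath_far => -[]. Qed.

Lemma far_exc a : far a != exc.
Proof. by apply/eqP => ae; have := vpath_far a; rewrite ae vpath_exc. Qed.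

Lemma entering_far a : entering B (far a) = Some a.
Proof. by rewrite /entering vpath_far. Qed.

Lemma enteringP u a : entering B u = Some a -> u = far a.
Proof.
rewrite /entering; case uE : (vpath u) => [//|b s] [<-].
by have [ub sE] := vpath_cons uE; apply/esym/far_eq => //; rewrite uE sE.
Qed.

Lemma far_surj u : u != exc -> exists a, u = far a.
Proof.
move=> ue; case uE : (vpath u) => [|a s]; first by rewrite (vpath_nil uE) eqxx in ue.
by exists a; apply: enteringP; rewrite /entering uE.
Qed.

Lemma mem_edges_at u a : (a \in edges_at B u) = (u \in ends a).
Proof. by rewrite inE. Qed.

Lemma next_image u : next u @: edges_at B u = edges_at B u.
Proof.
apply/setP => a; apply/imsetP/idP => [[b + ->]|].
  by rewrite !mem_edges_at; apply: next_ends.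
rewrite mem_edges_at => ua; have /iter_findex := next_cyclic (next_ends ua) ua.
move: (findex _ _ _) => k kE; exists (iter k (next u) a); last by rewrite -iterS iterSr.
rewrite mem_edges_at; elim: k {kE} => //= k; exact: next_ends.
Qed.

(** Cyclicity only provides reachability; it makes [next u] surjective on the finite set of edges at
    [u], hence injective there. *)
Lemma next_inj u a b : u \in ends a -> u \in ends b -> next u a = next u b -> a = b.
Proof.
move=> ua ub; have /imset_injP inj : #|next u @: edges_at B u| == #|edges_at B u|.
  by rewrite next_image.
by apply: inj; rewrite mem_edges_at.
Qed.

Lemma prev_spec u a : u \in ends a -> u \in ends (prev u a) /\ next u (prev u a) = a.
Proof.
move=> ua; rewrite /Defs.prev; case: pickP => [b /andP[]|none] /=.
  by rewrite mem_edges_at => ub /eqP.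
have := ua; rewrite -mem_edges_at -next_image => /imsetP[b ub ab].
by have := none b; rewrite ub ab eqxx.
Qed.

Lemma prev_next u a : u \in ends a -> prev u (next u a) = a.
Proof.
move=> ua; have [up nE] := prev_spec (next_ends ua).
exact: next_inj nE.
Qed.

Lemma prev_ends u a : u \in ends a -> u \in ends (prev u a).
Proof. by case/prev_spec. Qed.

Lemma next_prev u a : u \in ends a -> next u (prev u a) = a.
Proof. by case/prev_spec. Qed.

Lemma lone_eq u a b : lone B u -> u \in ends a -> u \in ends b -> a = b.
Proof.
move=> /cards1P[c cE]; rewrite -!mem_edges_at cE !inE.
by move=> /eqP -> /eqP ->.
Qed.

Lemma lone_next u a : lone B u -> u \in ends a -> next u a = a.
Proof. by move=> lu ua; apply: lone_eq lu (next_ends ua) ua. Qed.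

Lemma next_fix u a : u \in ends a -> next u a = a -> lone B u.
Proof.
move=> ua na; apply/cards1P; exists a; apply/setP => b.
rewrite mem_edges_at inE; apply/idP/eqP => [ub|-> //].
have /iter_findex := next_cyclic ua ub; move: (findex _ _ _) => k <-.
by elim: k => //= k ->.
Qed.

End TreePaths.

(** * Green's walk and its behaviour under mutation *)

Section FirstUp.
Variables (V E : finType) (e m : nat) (B : brauer_tree V E e m).

(* A dart [(x, a)] stands for walking along [a] from [x].  [first_up d a] says
   that the first dart pointing towards the exceptional vertex met by Green's
   walk from [d] on, [d] included, is the one along [a]. *)
Inductive first_up : V * E -> E -> Prop :=
  | first_up_here a : first_up (far B a, a) a
  | first_up_down b a :
      first_up (green_step B (near B b, b)) a -> first_up (near B b, b) a.

(** In the reversed pointing the point at [far B a] is crossed just before the walk goes up [a]. So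
    this is the successor relation of the cyclic order of the points. *)
Definition post_next a b := first_up (green_step B (far B a, a)) b.

Lemma green_step_down a :
  green_step B (near B a, a) = (far B a, next B (far B a) a).
Proof. by rewrite /green_step /= other_near. Qed.

Lemma green_step_up a :
  green_step B (far B a, a) = (near B a, next B (near B a) a).
Proof. by []. Qed.

(** The vertex of the primary edge carries two edges or more, so it is the near end of [w] and the
    lone vertex is the far end. *)
Lemma leaf_primary w : leaf B w -> primary B w -> exists c,
  [/\ lone B (far B w), near B w = far B c, next B (far B c) c = w,
      c != w & (1 < #|edges_at B (far B c)|)%N].
Proof.
move=> [x xw lx] [u [c [ue du uc wE]]]; have uE := enteringP uc.
exists c; rewrite -uE.
have ucE : u \in ends B c by rewrite uE far_ends.
have uw : u \in ends B w by rewrite wE next_ends.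
have cw : c != w.
  apply/eqP => cw; have : lone B u by apply: (next_fix ucE); rewrite -wE.
  by rewrite /lone => /eqP l1; rewrite l1 in du.
have nu : near B w = u.
  have [uf|->//] := far_or_near uw.
  by move: uc; rewrite uf entering_far => -[wc]; rewrite wc eqxx in cw.
split=> //.
suff -> : far B w = x by [].
have [->//|xn] := far_or_near xw.
by move: lx; rewrite xn nu /lone => /eqP l1; rewrite l1 in du.
Qed.

End FirstUp.

Section Mutation.
Variables (V E : finType) (e m : nat) (B B' : brauer_tree V E e m) (w c : E).
Hypothesis mutB : is_mutation B w B'.
Hypotheses (w_lone : lone B (far B w)) (w_near : near B w = far B c).
Hypotheses (w_next : next B (far B c) c = w) (c_neq : c != w).
Hypothesis c_deg : (1 < #|edges_at B (far B c)|)%N.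

Local Notation x := (far B w).
Local Notation u := (far B c).
Local Notation u' := (near B c).

Lemma u_lone : ~~ lone B u.
Proof. by move: c_deg; rewrite /lone; case: eqP => // ->. Qed.

Lemma mem_x a : x \in ends B a -> a = w.
Proof. by move=> xa; apply: lone_eq w_lone xa (far_ends B w). Qed.

Lemma u_neq_x : u != x.
Proof. by apply: contraNneq u_lone => ->; apply: w_lone. Qed.

Lemma u'_neq_u : u' != u.
Proof. exact: near_neq_far. Qed.

Lemma u'_neq_x : u' != x.
Proof.
apply/eqP => ux; have := near_ends B c; rewrite ux => /mem_x cw.
by move: c_neq; rewrite cw eqxx.
Qed.

Lemma w_ends : ends B w = [set x; u].
Proof. by have [_ ->] := ends_other (far_ends B w); rewrite -w_near. Qed.

Lemma prev_w : prev B u w = c.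
Proof. by rewrite -[w in LHS]w_next prev_next ?far_ends. Qed.

Lemma ends_w y : y \in ends B w -> y = x \/ y = u.
Proof. by rewrite w_ends !inE => /orP[]/eqP; [left|right]. Qed.

Lemma new_end_x : new_end B w x = x.
Proof. by rewrite /new_end w_lone. Qed.

Lemma new_end_u : new_end B w u = u'.
Proof. by rewrite /new_end (negPf u_lone) prev_w. Qed.

Lemma mut_exc : exc B' = exc B.
Proof. by case: mutB. Qed.

Lemma mut_ends_neq a : a != w -> ends B' a = ends B a.
Proof. by case: mutB => _ -> _ aw; rewrite /mut_ends (negPf aw). Qed.

Lemma mut_ends_w : ends B' w = [set x; u'].
Proof.
case: mutB => _ -> _; rewrite /mut_ends eqxx w_ends.
by rewrite imsetU1 imset_set1 new_end_x new_end_u.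
Qed.

Lemma del_next_neq y a : next B y a != w -> del_next B w y a = next B y a.
Proof. by rewrite /del_next => /negPf ->. Qed.

(** The [pick] in [mut_next] can only find [u], since the lone end [x] stays in place; and [w] is
    inserted at [u'] immediately before [c]. *)
Lemma mut_next_u' a : u' \in ends B' a ->
  next B' u' a = if a == w then c else if next B u' a == c then w else next B u' a.
Proof.
move=> ua; case: mutB => _ _ -> //; rewrite /mut_next.
case: pickP => [y /andP[yw /andP[ly _]]|/(_ u)]; last first.
  by rewrite -{1}w_near near_ends u_lone new_end_u eqxx.
have -> : y = u by have [yx|//] := ends_w yw; rewrite yx w_lone in ly.
rewrite prev_w; case: eqVneq => // aw; rewrite del_next_neq //.
apply/eqP => nw.
have ua' : u' \in ends B a by rewrite -mut_ends_neq.
have := next_ends ua'; rewrite nw => /ends_w[]/eqP.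
  by rewrite (negPf u'_neq_x).
by rewrite (negPf u'_neq_u).
Qed.

Lemma mut_next_neq y a : y != u' -> y \in ends B' a ->
  next B' y a = del_next B w y a.
Proof.
move=> yu ya; case: mutB => _ _ -> //; rewrite /mut_next.
case: pickP => // z /andP[zw /andP[lz /eqP zE]].
have [zx|zu] := ends_w zw; first by rewrite zx w_lone in lz.
by rewrite -zE zu new_end_u eqxx in yu.
Qed.

(** A path from a vertex other than [x] does not use [w], whose far end is lone; it is therefore
    still a path after the mutation. *)
Lemma mut_vpath y : y != x -> vpath B' y = vpath B y.
Proof.
have [n] := ubnP (size (vpath B y)); elim: n y => // n IH y yn yx.
case yE : (vpath B y) => [|b s].
  by rewrite (vpath_nil yE) -mut_exc vpath_exc.
have [yb sE] := vpath_cons yE.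
have bw : b != w.
  apply/eqP => bw; move: yx; rewrite -(far_eq yb) ?yE ?sE // bw; exact/negP/negPn.
have zx : other (ends B) b y != x.
  by apply: contraNneq bw => zx; apply/eqP/mem_x; rewrite -zx other_in.
have yb' : y \in ends B' b by rewrite mut_ends_neq.
have otherE : other (ends B') b y = other (ends B) b y.
  by rewrite /other mut_ends_neq.
have zE : vpath B' (other (ends B) b y) = s.
  by rewrite IH -?sE //; move: yn; rewrite yE.
have [|] := vpath_edge yb'; rewrite otherE zE // => sb. have := vpath_uniq B y; rewrite yE sb /= mem_head //.
Qed.

Lemma vpath_x : vpath B x = [:: w, c & vpath B u'].
Proof. by rewrite vpath_far w_near vpath_far. Qed.

Lemma mut_u'_w : u' \in ends B' w.
Proof. by rewrite mut_ends_w !inE eqxx orbT. Qed.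

Lemma mut_other_u'_w : other (ends B') w u' = x.
Proof.
have xw : x \in ends B' w by rewrite mut_ends_w !inE eqxx.
by rewrite -(other_eq mut_u'_w xw) // eq_sym u'_neq_x.
Qed.

Lemma mut_vpath_x : vpath B' x = w :: vpath B u'.
Proof.
have [uE|] := vpath_edge mut_u'_w; rewrite ?mut_other_u'_w; last first.
  by rewrite (mut_vpath u'_neq_x).
move: uE; rewrite (mut_vpath u'_neq_x) => uE; have [uw _] := vpath_cons uE.
by have [/eqP|/eqP] := ends_w uw; rewrite ?(negPf u'_neq_x) ?(negPf u'_neq_u).
Qed.

Lemma mut_far a : far B' a = far B a.
Proof.
have [->|aw] := eqVneq a w.
  have xw : x \in ends B' w by rewrite mut_ends_w !inE eqxx.
  apply: far_eq => //; rewrite mut_vpath_x -mut_other_u'_w otherK ?mut_u'_w //.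
  by rewrite (mut_vpath u'_neq_x).
have fa : far B a \in ends B' a by rewrite mut_ends_neq ?far_ends.
apply: far_eq => //; rewrite /other mut_ends_neq // -/(other (ends B) a _).
rewrite !mut_vpath ?vpath_far //.
  by apply: contraNneq aw => nx; apply/eqP/mem_x; rewrite -nx near_ends.
by apply: contraNneq aw => /far_inj ->.
Qed.

Lemma mut_near a : a != w -> near B' a = near B a.
Proof. by move=> aw; rewrite /near mut_far /other mut_ends_neq. Qed.

Lemma mut_near_w : near B' w = u'.
Proof. by rewrite /near mut_far -mut_other_u'_w otherK // mut_u'_w. Qed.

(** Before the mutation the walk runs down [c], then down and up [w]; afterwards it runs down and up
    [w], then down [c]. From [(u', c)] and [(u, w)] the first edge gone up is [w], as it is from
    [(u', w)] in the new tree. *)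
Definition mut_dart (d : V * E) : V * E :=
  if (d == (u, w)) || (d == (u', c)) then (u', w) else d.

(* Outside the two darts moved by [mut_dart], the walk of [B'] follows the walk
   of [B]. *)
Lemma mut_dart_next y a : y \in ends B a -> a != w -> (y == u) ==> (a != c) ->
  mut_dart (y, next B y a) = (y, next B' y a).
Proof.
move=> ya aw ac; have ya' : y \in ends B' a by rewrite mut_ends_neq.
have yx : y != x by apply: contraNneq aw => yx; apply/eqP/mem_x; rewrite -yx.
have nw : next B y a != w.
  apply/eqP => nw; have := next_ends ya; rewrite nw => /ends_w[/eqP|yu].
    by rewrite (negPf yx).
  move: ac; rewrite yu eqxx /= => /eqP; apply.
  by apply: (@next_inj _ _ _ _ B u); rewrite ?far_ends -?yu // nw yu w_next.
rewrite /mut_dart !xpair_eqE (negPf nw) andbF /=.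
have [yu|yu] := eqVneq y u'; last by rewrite mut_next_neq // del_next_neq.
subst y; rewrite /= mut_next_u' // (negPf aw).
by case: eqP.
Qed.

Lemma mut_first_up d a : first_up B d a -> first_up B' (mut_dart d) a.
Proof.
elim=> {d a} [a|b a _ IH].
  rewrite /mut_dart !xpair_eqE.
  have -> : (far B a == u) && (a == w) = false.
    by apply/andP => -[/eqP/far_inj -> /eqP cw]; move: c_neq; rewrite cw eqxx.
  have -> : (far B a == u') && (a == c) = false.
    by apply/andP => -[/eqP fa /eqP ac]; have := near_neq_far B c; rewrite -fa ac eqxx.
  by rewrite -mut_far; apply: first_up_here.
have [bw|bw] := eqVneq b w.
  subst b; move: IH; rewrite green_step_down lone_next ?far_ends //.
  rewrite /mut_dart !xpair_eqE w_near !eqxx /= eq_sym (negPf u_neq_x).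
  rewrite [w == c]eq_sym (negPf c_neq) andbF -mut_near_w => IH.
  apply: first_up_down; rewrite green_step_down mut_far.
  suff -> : next B' x w = w by [].
  rewrite mut_next_neq; last by rewrite mut_ends_w !inE eqxx.
    by rewrite /del_next !lone_next ?far_ends // if_same.
  by rewrite eq_sym u'_neq_x.
have [bc|bc] := eqVneq b c.
  subst b; move: IH; rewrite green_step_down w_next.
  by rewrite /mut_dart !eqxx orbT.
move: IH; rewrite green_step_down mut_dart_next ?far_ends //; last first.
  by apply/implyP.
have -> : mut_dart (near B b, b) = (near B b, b).
  by rewrite /mut_dart !xpair_eqE (negPf bw) (negPf bc) !andbF.
rewrite -mut_near // -mut_far => IH; apply: first_up_down.
by rewrite green_step_down.
Qed.

(** Mutation preserves the postorder successor. When [a] is [w], the new walk goes down [c] from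
    [u'] and so resumes at [u] where the old one left [w]. *)
Lemma mut_post_next a b : post_next B a b -> post_next B' a b.
Proof.
rewrite /post_next !green_step_up => /mut_first_up.
have [->|aw] := eqVneq a w.
  rewrite w_near mut_near_w mut_next_u' ?mut_u'_w // eqxx.
  have nw : next B u w != w.
    apply: contraNneq u_lone => nw; apply: next_fix nw.
    by rewrite -w_near near_ends.
  rewrite /mut_dart !xpair_eqE (negPf nw) andbF eq_sym (negPf u'_neq_u) /= => IH.
  rewrite -mut_near //; apply: first_up_down; rewrite green_step_down mut_far.
  rewrite mut_next_neq.
  - by rewrite /del_next w_next eqxx.
  - by rewrite eq_sym u'_neq_u.
  by rewrite mut_ends_neq ?far_ends.
rewrite mut_dart_next ?near_ends //; first by rewrite mut_near.
apply/implyP => /eqP nu; apply: contraNneq u'_neq_u => ac.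
by rewrite -{1}ac nu.
Qed.

(** Only [w] changes parent, and its new parent is the former grandparent, so transitivity
    suffices. *)
Lemma mut_parent (num : E -> nat) :
  (forall a b s, vpath B (far B a) = [:: a, b & s] -> (num a < num b)%N) ->
  forall a b s, vpath B' (far B' a) = [:: a, b & s] -> (num a < num b)%N.
Proof.
move=> numB a b s; rewrite mut_far; have [->|aw] := eqVneq a w.
  rewrite mut_vpath_x => -[uE]; have := numB _ _ _ vpath_x.
  by move/ltn_trans; apply; apply: (numB _ _ s); rewrite vpath_far uE.
by rewrite mut_vpath; [apply: numB|apply: contraNneq aw => /far_inj ->].
Qed.

End Mutation.

(** * The postorder numbering *)

Section PostOrder.
Variables (V E : finType) (e m : nat) (B : brauer_tree V E e m).
Implicit Types (a b s : E) (y : V).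

Local Notation near := (near B).
Local Notation far := (far B).
Local Notation next := (next B).
Local Notation exc := (exc B).
Local Notation step := (green_step B).
Local Notation first_up := (first_up B).

Lemma first_up_farE b s : first_up (far b, b) s -> s = b.
Proof.
move dE: (far b, b) => d fs; case: fs dE => [a [_ ->] //|a s' _ [fa ab]].
by have := near_neq_far B a; rewrite -fa ab eqxx.
Qed.

Lemma first_up_nearE b s : first_up (near b, b) s -> first_up (step (near b, b)) s.
Proof.
move dE: {1}(near b, b) => d fs; case: fs dE => [a [fa ab]|a s' fs [_ ->] //].
by have := near_neq_far B a; rewrite -fa ab eqxx.
Qed.

Lemma near_child y a b : y = far b -> y \in ends B a -> a != b -> near a = y.
Proof.
move=> -> ya; have [/far_inj->|-> //] := far_or_near ya; by rewrite eqxx.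
Qed.

(** Decreases when passing to an edge farther out; it measures inductions over subtrees. *)
Definition height b := (#|E| - dist B (far b))%N.

Lemma height_child a b : near a = far b -> (height a < height b)%N.
Proof.
move=> ab; have aE : dist B (far a) = (dist B (far b)).+1.
  by rewrite /dist vpath_far ab.
have := card_uniqP (vpath_uniq B (far a)); rewrite -/(dist B _) => {}aS.
have := max_card (mem (vpath B (far a))); rewrite aS /height -/(dist B _) => aS'.
by lia.
Qed.

Lemma step_down_cases b :
  step (near b, b) = (far b, b) \/
  exists2 a, near a = far b & step (near b, b) = (near a, a).
Proof.
rewrite green_step_down; have [->|nb] := eqVneq (next (far b) b) b; first by left.
have na := near_child erefl (next_ends (far_ends B b)) nb.
by right; exists (next (far b) b); rewrite ?na.
Qed.

Lemma first_up_exists_near b : exists s, first_up (near b, b) s.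
Proof.
have [n] := ubnP (height b); elim: n b => // n IH b bn.
have [bE|[a ab bE]] := step_down_cases b.
  by exists b; apply: first_up_down; rewrite bE; apply: first_up_here.
have [|s fs] := IH a; first by have := height_child ab; lia.
by exists s; apply: first_up_down; rewrite bE.
Qed.

Lemma first_up_exists y a : y \in ends B a -> exists s, first_up (y, a) s.
Proof.
move=> /far_or_near[]->; last exact: first_up_exists_near.
by exists a; apply: first_up_here.
Qed.

Lemma post_next_exists a : exists s, post_next B a s.
Proof. by apply: first_up_exists; apply/next_ends/near_ends. Qed.

Lemma star_post_next a s : is_star B -> post_next B a s -> s = next exc a.
Proof.
move=> starB.
have nearE b : near b = exc.
  by have [fe|->//] := far_or_near (starB b); have := far_exc B b; rewrite -fe eqxx.
rewrite /post_next green_step_up nearE; set b := next exc a.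
rewrite -[exc in (exc, _)](nearE b) => /first_up_nearE.
have [->|[c cb _]] := step_down_cases b; first exact: first_up_farE.
by have := far_exc B b; rewrite -cb nearE eqxx.
Qed.

Definition root a : E := last a (vpath B (far a)).

Lemma root_child a b : near a = far b -> root a = root b.
Proof. by move=> ab; rewrite /root vpath_far ab /= vpath_far. Qed.

Lemma root_exc a : exc \in ends B a -> root a = a.
Proof.
move=> ea; rewrite /root; have [ef|en] := far_or_near ea.
  by have := far_exc B a; rewrite -ef eqxx.
by rewrite vpath_far -en vpath_exc.
Qed.

(** Having gone down [b], the walk keeps descending until its first upward dart, so it does not
    leave the branch. *)
Lemma first_up_root b s : first_up (near b, b) s -> root s = root b.
Proof.
have [n] := ubnP (height b); elim: n b => // n IH b bn /first_up_nearE.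
have [->/first_up_farE-> //|[a ab ->]] := step_down_cases b.
rewrite -(root_child ab); apply: IH; have := height_child ab; lia.
Qed.

Lemma exc_root a : exc \in ends B (root a).
Proof.
have [n] := ubnP (dist B (far a)); elim: n a => // n IH a an.
have [na|na] := eqVneq (near a) exc.
  by rewrite root_exc // -na near_ends.
have [b nb] := far_surj na; rewrite (root_child nb); apply: IH.
by move: an; rewrite /dist vpath_far nb.
Qed.

Section Numbering.
Variables (r : E) (num : E -> nat).
Hypotheses (e_gt0 : (0 < e)%N) (num_inj : injective num).
Hypothesis num_range : forall a, (1 <= num a <= e)%N.
Hypothesis num_next : forall a s, post_next B a s -> num s = (num a %% e).+1.
Hypothesis r_exc : exc \in ends B r.
Hypothesis num_branch : forall a, (a \in branch B r) = (num a <= #|branch B r|)%N.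
Hypothesis num_root : branch B r = [set: E] -> num r = e.

Lemma near_root a : exc \in ends B a -> near a = exc.
Proof.
by move=> /far_or_near[fe|-> //]; have := far_exc B a; rewrite -fe eqxx.
Qed.

Lemma num_surj j : (j < e)%N -> exists a, num a = j.+1.
Proof.
move=> je; have numP a : ((num a).-1 < e)%N by have := num_range a; lia.
pose f a := Ordinal (numP a).
have f_inj : injective f.
  move=> a b [] ab; apply: num_inj; move: ab.
  by have := num_range a; have := num_range b; lia.
have [|h _ hK] := inj_card_bij f_inj; first by rewrite card_ord (num_edges B).
exists (h (Ordinal je)); have := congr1 val (hK (Ordinal je)); rewrite /= => hE.
by have := num_range (h (Ordinal je)); lia.
Qed.

(** This locates the origin of the cyclic numbering. The successor of the edge [p] preceding [r] is
    the first edge [a0] gone up in the initial branch. The numbers of that branch are an initial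
    interval containing [a0] but not [p], which forces the wraparound to occur between them. *)
Lemma first_number : exists a0 p,
  [/\ first_up (near r, r) a0, num a0 = 1%N, exc \in ends B p & num p = e].
Proof.
have [a0 a0P] := first_up_exists_near r; pose p := prev B exc r.
have pe : exc \in ends B p := prev_ends r_exc.
have pr : post_next B p a0.
  rewrite /post_next green_step_up near_root // next_prev //.
  by rewrite -{1}(near_root r_exc).
have pn := num_next pr.
suff pE : num p = e by exists a0, p; split=> //; rewrite pn pE modnn.
(* If [p] is [r], there is a single branch, the interval condition carries no information, and the
   convention [num_root] fixes the origin. *)
have [prE|npr] := eqVneq p r.
  rewrite prE; apply: num_root; apply/setP => a; rewrite !inE -/(root a).
  have l : lone B exc by apply: (next_fix r_exc); rewrite -{1}prE next_prev.
  by apply/eqP/(lone_eq l) => //; apply: exc_root.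
have a0r : a0 \in branch B r.
  by rewrite inE -/(root a0) (first_up_root a0P) root_exc.
have pr' : p \notin branch B r by rewrite inE -/(root p) root_exc.
move: a0r pr'; rewrite !num_branch -ltnNge pn => a0r pr'.
have [pE|pE] := eqVneq (num p) e; first by [].
move: a0r; rewrite modn_small; first by lia.
by have := num_range p; lia.
Qed.

(** The wraparound happens after an edge at the exceptional vertex only. *)
Lemma num_next_nonroot a s : near a != exc -> post_next B a s -> num s = (num a).+1.
Proof.
move=> na /num_next ->; have [_ [p [_ _ pe pE]]] := first_number.
rewrite modn_small // ltn_neqAle; have /andP[_ ->] := num_range a; rewrite andbT.
by apply: contraNneq na => ae; rewrite near_root // (num_inj (etrans ae (esym pE))).
Qed.

(** Both claims are proved together by induction on the height. The successor of a child [a] is the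
    first edge completed under its next sibling, or [b] itself after the last sibling; so numbers
    grow from sibling to sibling and up to [b]. *)
Lemma num_subtree b :
  (forall s, first_up (near b, b) s -> (num s <= num b)%N) /\
  (forall a, near a = far b -> (num a < num b)%N).
Proof.
have [n] := ubnP (height b); elim: n b => // n IH b bn.
have child a : near a = far b -> (num a < num b)%N.
  move=> ab.
  have ba : far b \in ends B a by rewrite -ab near_ends.
  have /iter_findex := next_cyclic ba (far_ends B b); move: (findex _ _ _) => k.
  elim: k a ab ba => [|k IHk] a ab ba.
    by move=> /= aE; have := near_neq_far B b; rewrite -{1}aE ab eqxx.
  rewrite iterSr => kE; have ne : near a != exc by rewrite ab far_exc.
  have [nb|nb] := eqVneq (next (far b) a) b.
    suff /(num_next_nonroot ne) -> : post_next B a b by [].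
    by rewrite /post_next green_step_up ab nb; apply: first_up_here.
  have ba' := next_ends ba; have na' := near_child erefl ba' nb.
  have [s fs] := first_up_exists_near (next (far b) a).
  have as_ : post_next B a s by rewrite /post_next green_step_up ab -{1}na'.
  have [|le_s _] := IH (next (far b) a); first by have := height_child na'; lia.
  have := IHk _ na' ba' kE; have := le_s _ fs.
  by rewrite (num_next_nonroot ne as_); lia.
split=> // s /first_up_nearE.
have [->/first_up_farE-> //|[a ab ->] fs] := step_down_cases b.
have [|le_s _] := IH a; first by have := height_child ab; lia.
by have := le_s _ fs; have := child _ ab; lia.
Qed.

Lemma num_parent a b (s : seq E) : vpath B (far a) = [:: a, b & s] -> (num a < num b)%N.
Proof.
rewrite vpath_far => -[nE]; have [_] := num_subtree b; apply.
by apply: enteringP; rewrite /entering nE.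
Qed.

Definition is_up (d : V * E) := d.1 == far d.2.

Definition up_vertices n d := [seq c.1 | c <- traject step d n & is_up c].

Lemma step_dart d : d.1 \in ends B d.2 -> (step d).1 \in ends B (step d).2.
Proof. by move=> dP; apply/next_ends/other_in. Qed.

(** The walk crosses the point at a vertex exactly when its next dart goes up from that vertex;
    hence the start one step later. *)
Lemma met_verticesE :
  met_vertices B (reversed_pointing B) r = up_vertices (2 * e) (step (exc, r)).
Proof.
rewrite /met_vertices /up_vertices; have : (exc, r).1 \in ends B (exc, r).2 by [].
move: (exc, r) (2 * e)%N => d n; elim: n d => // n IH d dP; rewrite !trajectS /=.
have -> : (reversed_pointing B (other (ends B) d.2 d.1) == Some d.2) = is_up (step d).
  rewrite /is_up /=; set y := other _ _ _; have yd : y \in ends B d.2 := other_in dP.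
  rewrite /reversed_pointing; have [ye|/far_surj[b yb]] := eqVneq y exc.
    by rewrite ye /entering vpath_exc [RHS]eq_sym (negPf (far_exc _ _)).
  rewrite yb entering_far /= -yb; apply/eqP/eqP => [[pE]|yE].
    by rewrite -pE next_prev // yb far_ends.
  congr Some; have -> : b = next y d.2 by apply: (@far_inj _ _ _ _ B); rewrite -yb.
  by rewrite prev_next.
by case: ifP => _ /=; [congr cons|]; apply: IH; apply: step_dart.
Qed.

(** From one upward dart to the next the number increases by one modulo [e]; [.-1] and [.+1] convert
    between numbers from 1 and residues. *)
Lemma nth_up_vertices n d s i b : first_up d s -> (i < size (up_vertices n d))%N ->
  num b = (((num s).-1 + i) %% e).+1 -> nth exc (up_vertices n d) i = far b.
Proof.
elim: n d s i => //= n IH d s i fs; rewrite /up_vertices /=.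
case: fs i => [{}s|c {}s fs] i.
  rewrite /is_up /= eqxx /=; case: i => [_|i isz] bE /=.
    congr far; apply: num_inj; rewrite bE addn0 modn_small; have := num_range s; lia.
  have [s' ss'] := post_next_exists s; apply: (IH _ s') => //.
  rewrite bE (num_next ss') /= modnDml; congr (_ %% _).+1.
  by have := num_range s; lia.
by rewrite /is_up /= (negPf (near_neq_far _ _)); apply: IH.
Qed.

Lemma first_up_reach d s : first_up d s -> exists k, iter k step d = (far s, s).
Proof.
elim=> [a|b a _ [k kE]]; first by exists 0%N.
by exists k.+1; rewrite iterSr.
Qed.

Lemma reach_up a : fconnect step (step (near r, r)) (far a, a).
Proof.
have [a0 [_ [a0P a01 _ _]]] := first_number.
have [j] : exists j, num a = j.+1 by exists (num a).-1; have := num_range a; lia.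
elim: j a => [|j IH] a aE.
  have -> : a = a0 by apply: num_inj; rewrite aE a01.
  have [k <-] := first_up_reach (first_up_nearE a0P); exact: fconnect_iter.
have je : (j < e)%N by have := num_range a; lia.
have [a' a'E] := num_surj je; apply: connect_trans (IH a' a'E) _.
have [s a's] := post_next_exists a'; have [k kE] := first_up_reach a's.
have -> : a = s.
  apply: num_inj; rewrite (num_next a's) a'E aE modn_small //.
  by have := num_range a; lia.
by rewrite -kE -iterSr; apply: fconnect_iter.
Qed.

(** An orbit consists of darts, and a dart is determined by its edge and its direction; so 2e steps
    are enough to see the whole orbit. *)
Lemma order_step d : d.1 \in ends B d.2 -> (order step d <= 2 * e)%N.
Proof.
move=> dP; pose D := [set d : V * E | d.1 \in ends B d.2].
have sub_D : {subset fconnect step d <= D}.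
  move=> d' /iter_findex <-; elim: (findex _ _ _) => [|k]; rewrite !inE //=.
  exact: step_dart.
apply: (@leq_trans #|D|); first exact/subset_leq_card/subsetP.
pose f (d : V * E) := (d.2, is_up d).
have f_inj : {in D &, injective f}.
  move=> [x a] [y b]; rewrite !inE /f /is_up /= => xa yb [ab]; subst b.
  have [->|->] := far_or_near xa; have [->|->] := far_or_near yb => //.
    by rewrite eqxx (negPf (near_neq_far _ _)).
  by rewrite eqxx (negPf (near_neq_far _ _)).
rewrite -(card_in_imset f_inj) (leq_trans (max_card _)) //.
by rewrite card_prod card_bool (num_edges B) mulnC.
Qed.

Lemma pointing_number_eq a :
  pointing_number B (reversed_pointing B) r a = num a.
Proof.
have [a0 [_ [a0P a01 _ _]]] := first_number.
rewrite /pointing_number met_verticesE -{1}(near_root r_exc).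
set d := step (near r, r); set W := up_vertices _ _.
have dP : d.1 \in ends B d.2 by apply: step_dart; rewrite near_ends.
have aW : far a \in W.
  have := reach_up a; rewrite fconnect_orbit => /trajectP[i ilt iE].
  apply/mapP; exists (far a, a) => //; rewrite mem_filter /is_up eqxx /=.
  by apply/trajectP; exists i => //; apply: leq_trans ilt (order_step dP).
have nthW i b : (i < size W)%N -> num b = (i %% e).+1 -> nth exc W i = far b.
  move=> isz bE; apply: (nth_up_vertices (first_up_nearE a0P)) => //.
  by rewrite a01.
set i := index (far a) W; have isz : (i < size W)%N by rewrite index_mem.
have [b bE] := num_surj (ltn_pmod i e_gt0).
have ab : a = b by apply: (@far_inj _ _ _ _ B); rewrite -(nthW i b) // nth_index.
(* The list of met vertices repeats with period [e], so a first occurrence has index below [e]. *)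
have [ie|ie] := ltnP i e; first by rewrite ab bE modn_small.
have i'i : (i - e < i)%N by lia.
have : nth exc W (i - e) = far a.
  rewrite ab; apply: nthW; first by lia.
  by rewrite bE -{1}(subnK ie) modnDr.
have := before_find exc i'i; rewrite /= => /eqP + e1.
by rewrite e1.
Qed.

End Numbering.

End PostOrder.

(** * One mutation *)

Lemma quasi_iso_ceq (A : nzRingType) (X Y : cplx A) (s s' : cmap X Y) :
  ceq s s' -> quasi_iso s -> quasi_iso s'.
Proof.
move=> ss' qs i; have [s_inj s_surj] := qs i; split.
  by move=> x dx [y yE]; apply: s_inj => //; exists y; rewrite ss'.
by move=> y dy; have [x dx [z zE]] := s_surj y dy; exists x => //; exists z; rewrite -ss'.
Qed.

Lemma tt_map_comp (A : nzRingType) (P0 Q0 P1 Q1 P2 Q2 : fgmod A)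
    (p : {linear P0 -> P1}) (q : {linear Q0 -> Q1})
    (p' : {linear P1 -> P2}) (q' : {linear Q1 -> Q2}) j y :
  tt_map p' q' j (tt_map p q j y) = tt_map (p' \o p) (q' \o q) j y.
Proof. by case: j y => [[|[|j]]|j]. Qed.

Section MutationStep.
Variables (K : fieldType) (V E : finType) (e m : nat) (xi : K).
Variables (b : falgType K) (x g : b).
Hypotheses (e_gt1 : (1 < e)%N) (xi_prim : e.-primitive_root xi).
Hypothesis star : star_algebra e m xi x g.
Variable num : E -> nat.
Hypothesis num_range : forall a, (1 <= num a <= e)%N.

Local Notation P a := (star_proj e xi g (num a)).
Local Notation hom a c := (star_hom e xi x g (num a) (num c)).

Lemma star_proj_projective i : projective_mod (star_proj e xi g i).
Proof. exact/projective_lideal/(star_idem_idem e_gt1 xi_prim star). Qed.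

Section Unit.
Variables (w c : E) (n : int) (Q : fgmod b).
Variables (h : {linear P w -> Q}) (h' : {linear P c -> Q}).
Hypothesis m_gt0 : (0 < m)%N.
Hypothesis w_lt_c : (num w < num c)%N.
Hypothesis hE : forall v, (idfun : {linear Q -> Q}) (h v) = h' (hom w c v).
Hypothesis h_deep : forall s : {linear Q -> P c},
  xpow x (num c - num w).+1 (val (s (h (star_gen e xi g (num w))))).
Hypothesis target_bij : forall (q0 : {linear P c -> P c}) (q1 : {linear Q -> Q}),
  bijective q0 -> (forall v, q1 (h' v) = h' (q0 v)) -> bijective q1.

(** On first terms, a homotopy alters [q0 \o p0] only by a map through [Q], which [h_deep] places
    one power of [x] deeper than [hom w c]. So [q0] is invertible, [target_bij] passes this to the
    second term, and [q] is a termwise isomorphism. *)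
Lemma star_map_unit (f : cmap (two_term n h) (two_term n h'))
    (q : cmap (two_term n h') (two_term n h')) :
  homotopic (tt_cmap n hE) (ccomp q f) -> quasi_iso q.
Proof.
have [p0 [p1 [ph fE]]] := tt_cmapP f; have [q0 [q1 [qh qE]]] := tt_cmapP q.
move=> hom_qf.
have comph v : (q1 \o p1) (h v) = h' ((q0 \o p0) v) by rewrite /= ph qh.
have qfE : ceq (ccomp q f) (tt_cmap n comph).
  by move=> i y /=; rewrite qE fE; apply: tt_map_comp.
have [s [s0 _]] := tt_homotopic (homotopic_trans hom_qf (ceq_homotopic qfE)).
have wr := num_range w; have cr : (num w < num c <= e)%N.
  by rewrite w_lt_c; case/andP: (num_range c).
have w0 : (0 < num w)%N by case/andP: wr.
have q0bij : bijective q0.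
  apply: (star_factor_bij e_gt1 m_gt0 xi_prim star (h := p0) wr cr).
  suff -> : x ^+ (num c - num w) * star_idem e xi g (num c) =
      val (hom w c (star_gen e xi g (num w))).
    by have := congr1 val (s0 (star_gen e xi g (num w))); rewrite /= => ->; apply: h_deep.
  rewrite (star_homE x e_gt1 m_gt0 xi_prim) // val_star_gen (mulrA (star_idem e xi g (num w))).
  rewrite (star_idem_xk e_gt1 xi_prim star) subnKC ?(ltnW w_lt_c) // -mulrA.
  by rewrite (star_idem_idem e_gt1 xi_prim star).
apply: (quasi_iso_ceq (s := tt_cmap n qh)); first by move=> i y; rewrite qE.
by apply: tt_cmap_quasi_iso q0bij (target_bij q0bij qh).
Qed.

End Unit.

Section Step.
Variables (A A' : falgType K) (B B' : brauer_tree V E e m).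
Variables (D : brauer_tree_algebra A B) (D' : brauer_tree_algebra A' B').
Variables (w c : E) (G : dfunctor A' A) (H : dfunctor A A') (F : dfunctor b A').
Hypothesis mutB : is_mutation B w B'.
Hypotheses (w_lone : lone B (far B w)) (w_near : near B w = far B c).
Hypotheses (w_next : next B (far B c) c = w) (c_neq : c != w).
Hypothesis c_deg : (1 < #|edges_at B (far B c)|)%N.
Hypothesis mutG : mutation_equivalence D D' w G H.
Hypothesis F_emb : exact_embedding F.
Hypothesis FE : forall a,
  diso (F (tree_component xi x g B' num a)) (stalk 0 (bt_proj D' a)).
Hypothesis num_parent : forall a d s,
  vpath B (far B a) = [:: a, d & s] -> (num a < num d)%N.

Let vpath_w : vpath B (far B w) = [:: w, c & vpath B (near B c)].
Proof. exact: vpath_x w_near. Qed.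

Let vpath_c' : vpath B' (far B' c) = c :: vpath B (near B c).
Proof.
rewrite (mut_far mutB w_lone w_near w_next c_neq c_deg).
rewrite (mut_vpath mutB w_lone) ?vpath_far //.
by apply: contraNneq c_neq => /far_inj ->.
Qed.

Let vpath_w' : vpath B' (far B' w) = w :: vpath B (near B c).
Proof.
rewrite (mut_far mutB w_lone w_near w_next c_neq c_deg).
exact: mut_vpath_x.
Qed.

Let w_lt_c : (num w < num c)%N := num_parent vpath_w.

(* [T_w] is the cone of a morphism between the components of [w] and [c] before
   the mutation, whose second terms agree. *)
Lemma component_cone : exists (n : int) (Q : fgmod b)
    (h : {linear P w -> Q}) (h' : {linear P c -> Q})
    (hE : forall v, (idfun : {linear Q -> Q}) (h v) = h' (hom w c v)),
  [/\ tree_component xi x g B' num w = two_term n h,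
      tree_component xi x g B' num c = two_term n h',
      tree_component xi x g B num w = two_term (n - 1) (hom w c),
      projective_mod Q
    & forall (f : cmap (two_term n h) (two_term n h'))
        (q : cmap (two_term n h') (two_term n h')),
        homotopic (tt_cmap n hE) (ccomp q f) -> quasi_iso q].
Proof.
have m_gt0 := mult_gt0 B; have cr := num_range c; have wr := num_range w.
rewrite /tree_component vpath_w vpath_c' vpath_w' w_lt_c.
(* If [c] is attached to the exceptional vertex, both components are stalks, that is, two-term
   complexes with zero second term; otherwise [Q] is the projective of the common parent [d]. *)
case dE : (vpath B (near B c)) => [|d s].
  pose o a : {linear P a -> fg_zero b} := \0.
  have hE v : (idfun : {linear fg_zero b -> fg_zero b}) (o w v) = o c (hom w c v) by [].
  exists 0, (fg_zero b), (o w), (o c), hE; split=> //=.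
  - by rewrite w_lt_c.
  - exact: fg_zero_projective.
  apply: star_map_unit => // [s|q0 q1 _ _].
    by rewrite linear0; apply: xpow0.
  by exists id => v; apply: fg_zero_eq.
have c_lt_d : (num c < num d)%N by apply: (num_parent (s := s)); rewrite vpath_far dE.
have w_lt_d : (num w < num d)%N := ltn_trans w_lt_c c_lt_d.
have dr := num_range d.
rewrite c_lt_d w_lt_d.
have hE v : (idfun : {linear P d -> P d}) (hom w d v) = hom c d (hom w c v).
  by rewrite /= (star_hom_comp e_gt1 m_gt0 xi_prim star) //; lia.
exists (tree_degree num (d :: s) - 1), (P d), (hom w d), (hom c d), hE; split=> //=.
- by rewrite w_lt_d.
- by rewrite c_lt_d.
- by rewrite w_lt_c c_lt_d.
- exact: star_proj_projective.
apply: star_map_unit => // [t|q0 q1 q0bij qh].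
  (* The exponent [num d - num w] already exceeds [num c - num w], whatever the map [t] back to
     [P c] is. *)
  rewrite (star_proj_hom e_gt1 xi_prim star) (star_homE x e_gt1 m_gt0 xi_prim); try lia.
  rewrite val_star_gen (mulrA (star_idem e xi g (num w))).
  rewrite (star_idem_xk e_gt1 xi_prim star) -!mulrA.
  by apply: xpow_le (ex_intro _ _ erefl); lia.
by apply: (star_target_bij e_gt1 m_gt0 xi_prim star _ _ q0bij qh); lia.
Qed.

Lemma mutation_step a :
  diso (G (F (tree_component xi x g B num a))) (stalk 0 (bt_proj D a)).
Proof.
have [[Gtri _ GH] Gcomp] := mutG.
have GF d : diso (G (F (tree_component xi x g B' num d))) (G (stalk 0 (bt_proj D' d))).
  exact: fobj_diso.
have [aw|aw] := eqVneq a w; last first.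
  have -> : tree_component xi x g B num a = tree_component xi x g B' num a.
    rewrite /tree_component (mut_far mutB w_lone w_near w_next c_neq c_deg).
    by rewrite (mut_vpath mutB w_lone) //; apply: contraNneq aw => /far_inj ->.
  have [T] := Gcomp a; rewrite /mutation_component (negPf aw) => ->.
  exact: diso_trans (GF a).
subst a; have [T] := Gcomp w; rewrite /mutation_component eqxx.
move=> [Q0 [pi [pres ->]]] Tw.
have [T'] := Gcomp c; rewrite /mutation_component (negPf c_neq) => -> Tc.
have w_c : prev B (far B c) w = c := prev_w w_next.
have [Q0proj [alpha alpha_bij]] : projective_mod Q0 /\
    exists alpha : {linear bt_proj D c -> Q0}, bijective alpha.
  have := mutation_source (w_ends w_near) w_lone (far_exc B w) c_deg _ pres.
  by rewrite w_c; apply.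
have [n [Q [h [h' [hE [wE' cE' wE Qproj unit]]]]]] := component_cone.
rewrite wE.
have Pproj := star_proj_projective.
(* Both sides are now written as cones, of [(hom w c, id)] and of the projection [stalk_proj], so
   that only these two maps have to be compared. *)
apply: diso_trans (fobj_diso (dcomp_functor G F)
  (diso_sym (cone_same_target_diso n hE))) _.
apply: diso_trans (cone_stalk_proj_diso 0 pi).
apply: cone_correspondence => //.
- apply: comp_exact_embedding => //; exact: equivalence_exact_embedding Gtri GH.
- exact: two_term_projective.
- exact: two_term_projective.
- apply: two_term_projective => //.
  by apply: projective_lideal; rewrite bt_idem_mul eqxx.
- apply: two_term_projective => //.
  exact: fg_zero_projective.
- by rewrite -wE'; apply: diso_trans (GF w) Tw.
- rewrite -cE'; apply: diso_trans (GF c) _; apply: diso_trans Tc _.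
  exact: stalk_diso alpha_bij.
exact: stalk_proj_factor.
Qed.

End Step.

End MutationStep.

Theorem theorem4p1 (K : fieldType) (e m : nat) (xi : K) (V E : finType)
    (l : nat) (B : nat -> brauer_tree V E e m) (w : nat -> E) (r : E)
    (A : nat -> falgType K)
    (D : forall k : nat, brauer_tree_algebra (A k) (B k))
    (G : forall k : nat, dfunctor (A k) (A k.+1))
    (H : forall k : nat, dfunctor (A k.+1) (A k))
    (num : E -> nat) (x g : A 0%N) :
  (1 < e)%N ->
  e.-primitive_root xi ->
  complete_mutation_reduction l B w ->
  (forall k : nat, (k < l)%N ->
     leaf (B k.+1) (w k.+1) /\ primary (B k.+1) (w k.+1)) ->
  exc (B l) \in ends (B l) r ->
  (forall k : nat, (k < l)%N ->
     mutation_equivalence (D k.+1) (D k) (w k.+1) (G k) (H k)) ->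
  natural_numbering (B l) (B 0%N) r num ->
  star_algebra e m xi x g ->
  (forall a : E, bt_idem (D 0%N) a = star_idem e xi g (num a)) ->
  forall a : E,
    diso (composite_inverse H (stalk 0 (bt_proj (D l) a)))
         (tree_component xi x g (B l)
            (pointing_number (B l) (reversed_pointing (B l)) r) a).
Proof.
move=> e_gt1 xi_prim [[mutB _ _] starB0] leafB r_exc mutG.
move=> [[num_inj num_range] num_next0 num_branch num_root] star idemE.
have e_gt0 : (0 < e)%N := ltnW e_gt1.
(* The successor rule is read off the star and carried outwards, since mutation preserves postorder
   successors. *)
have numP k : (k <= l)%N -> forall a s, post_next (B k) a s -> num s = (num a %% e).+1.
  elim: k => [|k IH] kl a s.
    by move=> /(star_post_next starB0) ->; apply: num_next0.
  have [wl wp] := leafB k kl; have [c [w_lone w_near w_next c_neq c_deg]] := leaf_primary wl wp.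
  move=> /(mut_post_next (mutB k kl) w_lone w_near w_next c_neq c_deg).
  exact/IH/ltnW.
have num_lt := num_parent e_gt0 num_inj num_range (numP l (leqnn l)) r_exc num_branch num_root.
have numE : pointing_number (B l) (reversed_pointing (B l)) r = num.
  apply: funext => a; exact: pointing_number_eq (numP l (leqnn l)) _ _ _ _.
(* This runs the other way: the origin of the numbering is tied to the initial branch of the last
   tree, where monotonicity is proved; it is then carried down to every intermediate tree. *)
have num_ltk k : (k <= l)%N -> forall a c s,
    vpath (B k) (far (B k) a) = [:: a, c & s] -> (num a < num c)%N.
  move=> kl; have [j] : exists j, (k + j = l)%N by exists (l - k)%N; rewrite subnKC.
  elim: j k kl => [|j IH] k kl; first by rewrite addn0 => ->.
  rewrite -addSnnS => kjl; have kl' : (k < l)%N by rewrite -kjl leq_addr.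
  have [wl wp] := leafB k kl'.
  have [c [w_lone w_near w_next c_neq c_deg]] := leaf_primary wl wp.
  by apply: (mut_parent (mutB k kl') w_lone w_near w_next c_neq c_deg); apply: IH.
rewrite numE => a.
(* [composite_inverse] is defined on objects only, so the induction carries the last clause instead
   of a quasi-inverse of the composite [F]. *)
have main k : (k <= l)%N -> exists F : dfunctor (A 0%N) (A k), [/\ exact_embedding F,
    forall a, diso (F (tree_component xi x g (B k) num a)) (stalk 0 (bt_proj (D k) a))
  & forall X Y, diso Y (F X) -> diso (composite_inverse H Y) X].
  elim: k => [_|k IH kl].
    exists (did_functor (A 0%N)); split=> //; first exact: did_exact_embedding.
    move=> c; rewrite /tree_component.
    have -> : vpath (B 0) (far (B 0) c) = [:: c].
      by rewrite vpath_far (near_root (starB0 c)) vpath_exc.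
    rewrite /star_proj -idemE; exact: diso_refl.
  have [F [F_emb FE FH]] := IH (ltnW kl).
  have [wl wp] := leafB k kl.
  have [c [w_lone w_near w_next c_neq c_deg]] := leaf_primary wl wp.
  have [[Gtri _ GH] _] := mutG k kl.
  exists (dcomp_functor (G k) F); split.
  - by apply: comp_exact_embedding => //; apply: equivalence_exact_embedding GH.
  - exact: (mutation_step e_gt1 xi_prim star num_range (mutB k kl) w_lone w_near
      w_next c_neq c_deg (mutG k kl) F_emb FE (num_ltk _ kl)).
  move=> X Y YX; apply: FH; apply: diso_trans (fobj_diso (H k) YX) _.
  have [[eta [eta_iso _]] _] := GH.
  by exists (eta (F X)); apply: eta_iso.
have [F [_ FE FH]] := main l (leqnn l).
by apply: FH; apply: diso_sym.
Qed.
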